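(* Let $T\subset\mathbb R^3$ be a tetrahedron with Alfeld split $T^{\rm R}$ and let $k\ge 1$. Then the sequence $$ {\rm RM}\xrightarrow{\subset}V_{k+3}^{1,{\rm curl}}(T^{\rm R})\xrightarrow{\operatorname{def}}\Sigma_{k+2}^{{\rm inc}^+}(T;\mathbb S)\xrightarrow{\operatorname{inc}}\Sigma_k^{\rm div}(T;\mathbb S)\xrightarrow{\operatorname{div}}\mathbb P_{k-1}^{-1}(T^{\rm R};\mathbb R^3)\to 0 $$ is exact.
   Context: The Alfeld split $T^{\rm R}=\{T_0,\dots,T_3\}$ of a tetrahedron $T$ is the subdivision obtained by joining the barycenter of $T$ to its four vertices; the vertices of $T^{\rm R}$ are the four vertices of $T$ and its barycenter. $\mathbb P_r(D)$ is the space of polynomials of total degree at most $r$ on $D$ ($\{0\}$ if $r<0$), and $\mathbb P_r^{-1}(T^{\rm R})=\{q\in L^2(T): q|_{T_i}\in\mathbb P_r(T_i),\ 0\le i\le 3\}$. For a scalar space $B$, $B(\cdot;\mathbb X)=B\otimes\mathbb X$. $\mathbb M$ and $\mathbb S$ are the spaces of all and of symmetric real $3\times3$ matrices. ${\rm RM}=\{\boldsymbol a+\boldsymbol b\times\boldsymbol x:\boldsymbol a,\boldsymbol b\in\mathbb R^3\}$ is the space of infinitesimal rigid motions. Operators (in the distributional sense): $(\operatorname{grad}\boldsymbol v)_{ij}=\partial_jv_i$, $\operatorname{def}\boldsymbol v=\operatorname{sym}\operatorname{grad}\boldsymbol v$; on matrix fields $\operatorname{curl}$ and $\operatorname{div}$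 act row-wise; $\operatorname{inc}\boldsymbol\tau=\operatorname{curl}S^{-1}(\operatorname{curl}\boldsymbol\tau)$ with $S^{-1}\boldsymbol\sigma=\boldsymbol\sigma^{\intercal}-\frac12(\operatorname{tr}\boldsymbol\sigma)\boldsymbol I$; for symmetric $\boldsymbol\tau$, $\operatorname{inc}\boldsymbol\tau=\operatorname{curl}\big((\operatorname{curl}\boldsymbol\tau)^{\intercal}\big)$. Sobolev spaces: $H^1({\rm curl},T)=\{\boldsymbol v\in H^1(T;\mathbb R^3):\operatorname{curl}\boldsymbol v\in H^1(T;\mathbb R^3)\}$; $H({\rm inc}^+,T;\mathbb S)=\{\boldsymbol\tau\in L^2(T;\mathbb S):\operatorname{curl}\boldsymbol\tau\in L^2(T;\mathbb M),\ \operatorname{inc}\boldsymbol\tau\in L^2(T;\mathbb S)\}$; $H({\rm div},T;\mathbb S)=\{\boldsymbol\tau\in L^2(T;\mathbb S):\operatorname{div}\boldsymbol\tau\in L^2(T;\mathbb R^3)\}$. Polynomial spaces: $V_{k+3}^{1,{\rm curl}}(T^{\rm R})=\mathbb P_{k+3}^{-1}(T^{\rm R};\mathbb R^3)\cap H^1({\rm curl},T)$; $\Sigma_{k+2}^{{\rm inc}^+}(T;\mathbb S)=\{\boldsymbol\tau\in\mathbb P_{k+2}^{-1}(T^{\rm R};\mathbb S)\cap H({\rm inc}^+,T;\mathbb S):\boldsymbol\tau\text{ is continuous at all vertices of }T^{\rm R}\}$; $\Sigma_k^{\rm div}(T;\mathbb S)=\mathbb P_k^{-1}(T^{\rm R};\mathbb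 S)\cap H({\rm div},T;\mathbb S)$. Exactness means that at each space the kernel of the outgoing map equals the range of the incoming map (so the last map is surjective). *)

(* Defs.v *)
From HB Require Import structures.
From mathcomp Require Import all_boot all_order all_algebra.
From mathcomp Require Import all_classical all_reals all_analysis.
From mathcomp Require Import(canonicals, coercions) mpoly.

Set Implicit Arguments.
Unset Strict Implicit.
Unset Printing Implicit Defensive.

Import Order.TTheory GRing.Theory Num.Theory.
Import numFieldNormedType.Exports.

Local Open Scope classical_set_scope.
Local Open Scope ring_scope.

(** Points, and vector values, are row vectors.  The indices [j + 1] and
    [j + 2] in ['I_3] are taken modulo 3, so that the cross product and the
    curl read [(b x c)_j = b_{j+1} c_{j+2} - b_{j+2} c_{j+1}]. *)

Definition cross (R : pzRingType) (b c : 'rV[R]_3) : 'rV[R]_3 :=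
  \row_j (b 0 (j + 1) * c 0 (j + 2) - b 0 (j + 2) * c 0 (j + 1)).

Section Geometry.
Context {R : realType}.
Implicit Types a : 'I_4 -> 'rV[R]_3.

Definition nondegenerate_tetra a : bool :=
  row_free (\matrix_(i < 3) (a (lift ord0 i) - a ord0)).

Definition tetra a : set 'rV[R]_3 :=
  [set x | exists t : 'I_4 -> R,
     [/\ forall i, 0 <= t i, \sum_i t i = 1 & x = \sum_i t i *: a i]].

Definition barycenter a : 'rV[R]_3 := 4^-1 *: \sum_i a i.

Definition alfeld a (i : 'I_4) : set 'rV[R]_3 :=
  tetra (fun j => if j == i then barycenter a else a j).

Definition alfeld_vertices a : set 'rV[R]_3 :=
  range a `|` [set barycenter a].

End Geometry.

(** The library has no measure on ['rV_3]: integration goes through the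
    product Lebesgue measure on [R * R * R] and the identification [vec3]. *)

Section Integration.
Context {R : realType}.

Definition vec3 (p : measurableTypeR R * measurableTypeR R * measurableTypeR R)
  : 'rV[R]_3 := \row_j [:: p.1.1; p.1.2; p.2]`_j.

Definition leb3 :=
  ((@lebesgue_measure R \x @lebesgue_measure R) \x @lebesgue_measure R)%E.

Definition ae_on (D : set 'rV[R]_3) (P : 'rV[R]_3 -> Prop) : Prop :=
  {ae leb3, forall p, D (vec3 p) -> P (vec3 p)}.

Definition int_on (D : set 'rV[R]_3) (f : 'rV[R]_3 -> R) : R :=
  Rintegral leb3 (vec3 @^-1` D) (f \o vec3).

Definition L2 (D : set 'rV[R]_3) (f : 'rV[R]_3 -> R) : Prop :=
  ((f \o vec3) \_ (vec3 @^-1` D)) \in Lfun leb3 2%:E.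

End Integration.

(** Elements of [L^2(T)] are represented by functions on R^3; their values off
    [T] are irrelevant, and two of them are identified when they agree almost
    everywhere on [T], i.e. when they define the same distribution. *)
Notation mxfield R m n := ('rV[R]_3 -> 'M[R]_(m, n)).

Section Distributions.
Context {R : realType}.

Definition pderiv (j : 'I_3) (f : 'rV[R]_3 -> R) : 'rV[R]_3 -> R :=
  fun x => 'D_(delta_mx 0 j) f x.

Definition Cinfty (f : 'rV[R]_3 -> R) : Prop :=
  forall (s : seq 'I_3) x, differentiable (foldr pderiv f s) x.

Definition test_fun (T : set 'rV[R]_3) (phi : 'rV[R]_3 -> R) : Prop :=
  let supp := closure [set x | phi x != 0] in
  [/\ Cinfty phi, compact supp & supp `<=` interior T].

(** Distributions on the interior of [T]: only the values on test functions
    are meaningful, see [deq].  Linearity and continuity are not recorded, as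
    all distributions below are obtained from [L^2] functions by [distr] and
    by linear differential operators. *)
Definition dist : Type := ('rV[R]_3 -> R) -> R.

Definition deq m n (T : set 'rV[R]_3) (D1 D2 : 'M[dist]_(m, n)) : Prop :=
  forall phi, test_fun T phi -> forall i j, D1 i j phi = D2 i j phi.

Definition distr m n (T : set 'rV[R]_3) (u : mxfield R m n) : 'M[dist]_(m, n) :=
  \matrix_(i, j) fun phi => int_on T (fun x => u x i j * phi x).

Definition dpart (j : 'I_3) (D : dist) : dist := fun phi => - D (pderiv j phi).

Definition dzero m n : 'M[dist]_(m, n) := \matrix_(i, j) fun=> 0.

Definition dsym n (D : 'M[dist]_n) : 'M[dist]_n :=
  \matrix_(i, j) fun phi => 2^-1 * (D i j phi + D j i phi).

Definition dgrad (v : 'rV[dist]_3) : 'M[dist]_3 :=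
  \matrix_(i, j) dpart j (v 0 i).

Definition ddef (v : 'rV[dist]_3) : 'M[dist]_3 := dsym (dgrad v).

(** Row-wise; [m = 1] is the curl of a vector. *)
Definition dcurl m (D : 'M[dist]_(m, 3)) : 'M[dist]_(m, 3) :=
  \matrix_(i, j) fun phi =>
    dpart (j + 1) (D i (j + 2)) phi - dpart (j + 2) (D i (j + 1)) phi.

(** Row-wise; the result is written as a row vector. *)
Definition ddiv (D : 'M[dist]_3) : 'rV[dist]_3 :=
  \row_i fun phi => \sum_j dpart j (D i j) phi.

Definition Sinv (D : 'M[dist]_3) : 'M[dist]_3 :=
  \matrix_(i, j) fun phi => D j i phi - 2^-1 * (\sum_l D l l phi) *+ (i == j).

Definition dinc (D : 'M[dist]_3) : 'M[dist]_3 := dcurl (Sinv (dcurl D)).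

End Distributions.

Section Spaces.
Context {R : realType}.
Implicit Types (a : 'I_4 -> 'rV[R]_3) (T : set 'rV[R]_3).

Definition L2_field m n T : set (mxfield R m n) :=
  [set u | forall i j, L2 T (fun x => u x i j)].

Definition L2_sym T : set (mxfield R 3 3) :=
  [set u | L2_field T u /\ ae_on T (fun x => (u x)^T = u x)].

Definition in_space m n T (A : set (mxfield R m n)) (D : @matrix (@dist R) m n) :=
  exists2 g, A g & deq T D (distr T g).

Definition in_H1 m n T (D : @matrix (@dist R) m n) : Prop :=
  in_space T (L2_field T) D /\
  forall j, in_space T (L2_field T) (map_mx (dpart j) D).

Definition H1_curl T : set (mxfield R 1 3) :=
  [set v | [/\ L2_field T v, in_H1 T (distr T v)
             & in_H1 T (dcurl (distr T v))]].

Definition H_inc_plus T : set (mxfield R 3 3) :=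
  [set u | [/\ L2_sym T u, in_space T (L2_field T) (dcurl (distr T u))
             & in_space T (L2_sym T) (dinc (distr T u))]].

Definition H_div T : set (mxfield R 3 3) :=
  [set u | L2_sym T u /\ in_space T (L2_field T) (ddiv (distr T u))].

(** [mpoly.msize p] is the total degree plus one. *)
Definition pw_poly m n (r : nat) a : set (mxfield R m n) :=
  [set u | L2_field (tetra a) u /\
    forall (l : 'I_4) i j, exists2 p : mpoly.mpoly 3 R,
      (mpoly.msize p <= r.+1)%N &
      ae_on (alfeld a l) (fun x => u x i j = mpoly.meval (x 0) p)].

Definition pw_poly_sym (r : nat) a : set (mxfield R 3 3) :=
  pw_poly r a `&` L2_sym (tetra a).

Definition continuous_at_vertices m n a (u : mxfield R m n) : Prop :=
  exists2 g : mxfield R m n, ae_on (tetra a) (fun x => g x = u x) &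
    forall z, alfeld_vertices a z -> g x @[x --> within (tetra a) (nbhs z)] --> g z.

Definition RM : set (mxfield R 1 3) :=
  [set v | exists b c : 'rV[R]_3, v = fun x => b + cross c x].

Definition V_1_curl (r : nat) a : set (mxfield R 1 3) :=
  pw_poly r a `&` H1_curl (tetra a).

Definition Sigma_inc (r : nat) a : set (mxfield R 3 3) :=
  [set u | [/\ pw_poly_sym r a u, H_inc_plus (tetra a) u
             & continuous_at_vertices a u]].

Definition Sigma_div (r : nat) a : set (mxfield R 3 3) :=
  pw_poly_sym r a `&` H_div (tetra a).

End Spaces.

Section Exactness.
Context {R : realType}.
Variable T : set 'rV[R]_3.

(** [F] restricts to a map from [A] to [B]. *)
Definition maps_to m n p q (F : @matrix (@dist R) m n -> @matrix (@dist R) p q)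
    (A : set (mxfield R m n)) (B : set (mxfield R p q)) : Prop :=
  forall u, A u -> in_space T B (F (distr T u)).

(** Exactness at [B] of [A --F--> B --G--> ...]. *)
Definition exact_at m n p q s t
    (F : @matrix (@dist R) m n -> @matrix (@dist R) p q) (A : set (mxfield R m n))
    (B : set (mxfield R p q))
    (G : @matrix (@dist R) p q -> @matrix (@dist R) s t) : Prop :=
  forall w, B w ->
    deq T (G (distr T w)) (dzero s t) <->
    exists2 u, A u & deq T (F (distr T u)) (distr T w).

End Exactness.

(* Main.v *)
Require Import Defs.
From HB Require Import structures.
From mathcomp Require Import all_boot all_order all_algebra.
From mathcomp Require Import ring lra.
From mathcomp Require Import(canonicals, coercions) mpoly.
From mathcomp Require Import all_classical all_reals all_analysis.
From mathcomp Require Import measurable_realfun.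

Set Implicit Arguments.
Unset Strict Implicit.
Unset Printing Implicit Defensive.

Import Order.TTheory GRing.Theory Num.Theory.
Import numFieldNormedType.Exports.

Local Open Scope classical_set_scope.
Local Open Scope ring_scope.

(** The cells of the Alfeld split are the regions where one of the four barycentric coordinates
    [blam l] is smallest. A piecewise polynomial is thus a family of four polynomials, and every
    interface lies in a plane [on_face i j] through the barycenter. Membership in the Sobolev spaces
    becomes algebra on these planes: continuity ([cont]) when the gradient is a function, tangential
    continuity ([tcont]) for the curl, normal continuity ([ncont]) for the divergence. Exactness
    then follows from the BGG construction, which derives the elasticity complex from vector-valued
    de Rham complexes.

    De Rham level. On one cell, potentials with exact degree control come from inverting
    [s.+1 + euler], where [euler] is the Euler operator centred at the barycenter. As the planes are
    unions of lines through that point, the inversion respects traces, and the cell potentials can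
    be glued: [grad_lift], [curl_lift] and [div_lift] give continuous potentials for curl-free
    tangentially continuous, divergence-free normally continuous, and arbitrary piecewise data. The
    hard one is [curl_lift], where a tangentially continuous potential is made continuous by
    subtracting a piecewise gradient ([tcont_decomp], resting on the Newton expansion [newton]).

    BGG level. The links are [sinv_curl_def] (S^{-1} curl def v is half the gradient of curl v),
    [sinv_curl_skw] (S^{-1} curl turns the skew matrix of w into - grad w) and [div_Smx] (div S t
    measures the asymmetry of curl t). With them [exact_Sinc], [exact_Sdiv] and [exact_P] each apply
    the lifts twice: one application treats the rows, the other restores symmetry. [exact_V] is the
    classical kernel computation for def.

    Analysis. [pw_ibp] integrates by parts a continuous piecewise polynomial, by translation
    invariance and dominated convergence applied to difference quotients. For normally continuous
    fields, [pw_div_ibp] avoids surface integrals: the lifts write the field as v + curl c with v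
    and c continuous, and the curl part cancels by symmetry of second derivatives. Conversely, if
    the weak divergence is an integrable function, cutoffs inside the cells identify it with the
    piecewise divergence ([weak_div_identify]), and a lens-shaped test function then excludes a
    normal jump ([lens_absurd], [ncont_of_weak]). Partial derivatives and curl components are
    divergences of auxiliary fields, which settles [cont] and [tcont] as well. By [pw_weak0] a
    piecewise polynomial is determined by its distribution, so equalities of distributions become
    equalities of polynomials.

    Vertex continuity in [Sigma_inc] is obtained from [three_cells]: a symmetric tangentially
    continuous field takes equal values wherever three cells meet, and every vertex of the split
    lies in at least three cells. *)

Notation pl R := (mpoly.mpoly 3 R).
(** The total degree is at most [n - 1]; [msz p 0] means [p = 0], so negative degrees need no
    separate treatment. *)
Notation msz p n := (is_true (leq (mpoly.msize p) n)).
Notation cst := (mpoly.mpolyC 3).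
Notation pd := mpoly.mderiv.

Lemma sum3 (V : nmodType) (F : 'I_3 -> V) : \sum_i F i = F 0 + F 1 + F 2.
Proof.
rewrite !big_ord_recl big_ord0 addr0 addrA.
by congr (F _ + F _ + F _); apply/val_inj.
Qed.

Lemma ord3P (P : 'I_3 -> Prop) : P 0 -> P 1 -> P 2 -> forall i, P i.
Proof.
move=> P0 P1 P2 [[|[|[|//]]]] h.
- by have -> : Ordinal h = 0 by apply/val_inj.
- by have -> : Ordinal h = 1 by apply/val_inj.
- by have -> : Ordinal h = 2 by apply/val_inj.
Qed.

Lemma I3E : ((0 + 1)%R = 1%R :> 'I_3) * ((0 + 2)%R = 2%R :> 'I_3) *
  ((1 + 1)%R = 2%R :> 'I_3) * ((1 + 2)%R = 0%R :> 'I_3) *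
  ((2 + 1)%R = 0%R :> 'I_3) * ((2 + 2)%R = 1%R :> 'I_3).
Proof. by do ![split]; apply/val_inj. Qed.

(** * Polynomials in three variables: evaluation, derivatives, degree bounds, restriction to
    lines *)

Section Poly.
Context {R : realFieldType}.
Local Notation pl := (pl R).
Implicit Types (p q : pl) (x y : 'rV[R]_3).

Definition X (i : 'I_3) : pl := mpoly.mpolyX R (mpoly.mnm1 i).
Definition ev x p : R := mpoly.meval (x 0) p.

Lemma evD x p q : ev x (p + q) = ev x p + ev x q. Proof. exact: rmorphD. Qed.
Lemma evB x p q : ev x (p - q) = ev x p - ev x q. Proof. exact: rmorphB. Qed.
Lemma evN x p : ev x (- p) = - ev x p. Proof. exact: rmorphN. Qed.
Lemma evM x p q : ev x (p * q) = ev x p * ev x q. Proof. exact: rmorphM. Qed.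
Lemma ev0 x : ev x 0 = 0. Proof. exact: rmorph0. Qed.
Lemma ev1 x : ev x 1 = 1. Proof. exact: rmorph1. Qed.
Lemma evC x c : ev x (cst c) = c. Proof. exact: mpoly.mevalC. Qed.
Lemma evZ x c p : ev x (c *: p) = c * ev x p. Proof. exact: mpoly.mevalZ. Qed.
Lemma evX x i : ev x (X i) = x 0 i. Proof. exact: mpoly.mevalXU. Qed.
Lemma evXn x p n : ev x (p ^+ n) = ev x p ^+ n. Proof. exact: rmorphXn. Qed.
Lemma ev_sum I (r : seq I) (P : pred I) (F : I -> pl) x :
  ev x (\sum_(i <- r | P i) F i) = \sum_(i <- r | P i) ev x (F i).
Proof. exact: raddf_sum. Qed.
Definition evE := (evD, evB, evN, evM, ev0, ev1, evC, evZ, evX, evXn, ev_sum).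

Lemma cstE c : cst c = c%:A :> pl.
Proof. by rewrite -mpoly.mul_mpolyC mulr1. Qed.
Lemma cst0 : cst 0 = 0 :> pl. Proof. exact: mpoly.mpolyC0. Qed.

Lemma pdD i p q : pd i (p + q) = pd i p + pd i q. Proof. exact: raddfD. Qed.
Lemma pdN i p : pd i (- p) = - pd i p. Proof. exact: raddfN. Qed.
Lemma pdB i p q : pd i (p - q) = pd i p - pd i q. Proof. exact: raddfB. Qed.
Lemma pd0 i : pd i 0 = 0 :> pl. Proof. exact: raddf0. Qed.
Lemma pdZ i c p : pd i (c *: p) = c *: pd i p. Proof. exact: mpoly.mderivZ. Qed.
Lemma pdM i p q : pd i (p * q) = pd i p * q + p * pd i q.
Proof. exact: mpoly.mderivM. Qed.
Lemma pdC i c : pd i (cst c) = 0 :> pl. Proof. exact: mpoly.mderivC. Qed.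
Lemma pdX i j : pd i (X j) = (i == j)%:R.
Proof.
rewrite /X mpoly.mderivX mpoly.mnm1E eq_sym; case: eqP => [->|_]; last first.
  by rewrite scale0r.
rewrite scale1r.
suff -> : mpoly.mnm_sub (mpoly.mnm1 j) (mpoly.mnm1 j) = @mpoly.mnm0 3.
  by rewrite mpoly.mpolyX0.
by apply/mpoly.mnmP => k; rewrite mpoly.mnmBE mpoly.mnm0E subnn.
Qed.
Lemma pd_sum i I (r : seq I) (P : pred I) (F : I -> pl) :
  pd i (\sum_(j <- r | P j) F j) = \sum_(j <- r | P j) pd i (F j).
Proof. exact: raddf_sum. Qed.
Lemma pd_comm i j p : pd i (pd j p) = pd j (pd i p).
Proof. exact: mpoly.mderiv_comm. Qed.
Definition pdE := (pdD, pdB, pdN, pd0, pdZ, pdM, pdC, pdX).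

Lemma msz0 n : msz (0 : pl) n. Proof. by rewrite mpoly.msize0. Qed.
Lemma mszC c n : msz (cst c : pl) n.+1.
Proof. by rewrite mpoly.msizeC; case: (_ != _). Qed.
Lemma mszD p q n : msz p n -> msz q n -> msz (p + q) n.
Proof.
move=> pn qn; apply: leq_trans (mpoly.msizeD_le _ _) _.
by rewrite geq_max pn qn.
Qed.
Lemma mszN p n : msz p n -> msz (- p) n.
Proof. by rewrite mpoly.msizeN. Qed.
Lemma mszB p q n : msz p n -> msz q n -> msz (p - q) n.
Proof. by move=> pn qn; exact: (mszD pn (mszN qn)). Qed.
Lemma mszZ c p n : msz p n -> msz (c *: p) n.
Proof. by apply: leq_trans; exact: mpoly.msizeZ_le. Qed.
Lemma mszW p m n : (m <= n)%N -> msz p m -> msz p n.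
Proof. by move=> mn /leq_trans; apply. Qed.
Lemma msz_eq0 p : msz p 0 -> p = 0.
Proof. by rewrite leqn0 mpoly.msize_poly_eq0 => /eqP. Qed.
Lemma mszM p q m n : msz p m -> msz q n -> msz (p * q) (m + n).-1.
Proof.
have [->|p0] := eqVneq p 0; first by rewrite mul0r => *; exact: msz0.
have [->|q0] := eqVneq q 0; first by rewrite mulr0 => *; exact: msz0.
move=> pm qn; rewrite mpoly.msizeM //.
by rewrite -!subn1 leq_sub2r // leq_add.
Qed.
Lemma mszX i : msz (X i) 2.
Proof. by rewrite mpoly.msizeX mpoly.mdeg1. Qed.
Lemma msz_sum I (r : seq I) (P : pred I) (F : I -> pl) n :
  (forall i, P i -> msz (F i) n) -> msz (\sum_(i <- r | P i) F i) n.
Proof.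
by move=> H; apply: (big_ind (fun p => msz p n)) => //; [exact: msz0|move=> p q; exact: mszD].
Qed.
Lemma mszMl p q n : msz p 2 -> msz q n -> msz (p * q) n.+1.
Proof. by move=> p2 /(mszM p2); rewrite addSn. Qed.

(** Generation by products with coordinates centred at [o]. It serves the induction principle
    [pl_ind], where [n] tracks the degree and [o] can be chosen freely. *)
Inductive gen (o : 'I_3 -> R) : nat -> pl -> Prop :=
| gen_0 n : gen o n 0
| gen_C n c : gen o n.+1 (cst c)
| gen_X n i p : gen o n p -> gen o n.+1 ((X i - cst (o i)) * p)
| gen_D n p q : gen o n p -> gen o n q -> gen o n (p + q).

Lemma genW o n m p : (n <= m)%N -> gen o n p -> gen o m p.
Proof.
move=> nm H; elim: H m nm => {n p} [n|n c|n i p H IH|n p q _ IHp _ IHq] [|m] // nm;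
  try (by constructor; auto).
Qed.

Lemma genZ o n c p : gen o n p -> gen o n (c *: p).
Proof.
elim=> {n p} [n|n d|n i p H IH|n p q _ IHp _ IHq].
- by rewrite scaler0; constructor.
- by rewrite -mpoly.mul_mpolyC -mpoly.mpolyCM; constructor.
- by rewrite scalerAr; constructor.
- by rewrite scalerDr; constructor.
Qed.

Lemma gen_base o o' n p : gen o n p -> gen o' n p.
Proof.
elim=> {n p} [n|n d|n i p H IH|n p q _ IHp _ IHq]; try by constructor.
have -> : (X i - cst (o i)) * p = (X i - cst (o' i)) * p + (o' i - o i) *: p.
  by rewrite -mpoly.mul_mpolyC mpoly.mpolyCB -mulrDl addrA subrK.
by constructor; [constructor | apply: genW (genZ _ IH)].
Qed.

Lemma genP o n p : msz p n -> gen o n p.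
Proof.
move=> pn; apply: (@gen_base (fun=> 0)).
rewrite (mpoly.mpolyE p) big_seq; elim/big_ind: _ => [||m mp]; try by constructor.
apply: genZ; apply: (@genW _ (mpoly.mdeg m).+1).
  by apply: leq_trans pn; exact: mpoly.msize_mdeg_lt.
move: {mp} m; move=> m; move: {2}(mpoly.mdeg m) (erefl (mpoly.mdeg m)) => k.
elim: k m => [|k IH] m mk.
  move/eqP: (mk); rewrite mpoly.mdeg_eq0 => /eqP ->.
  by rewrite mpoly.mpolyX0 -mpoly.mpolyC1; constructor.
have [i mi] : exists i, (0 < m i)%N.
  apply/existsP; rewrite -[X in is_true X]negbK; apply/negP.
  rewrite negb_exists => /forallP h; move: mk; rewrite mpoly.mdegE big1 // => i _.
  by apply/eqP; rewrite -leqn0 leqNgt.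
have mE : m = mpoly.mnm_add (mpoly.mnm1 i) (mpoly.mnm_sub m (mpoly.mnm1 i)).
  apply/mpoly.mnmP => j; rewrite mpoly.mnmDE mpoly.mnmBE mpoly.mnm1E.
  by case: eqP => [<-|_]; rewrite ?subn0 // addnC subnK.
have dE : mpoly.mdeg (mpoly.mnm_sub m (mpoly.mnm1 i)) = k.
  by move: mk; rewrite {1}mE mpoly.mdegD mpoly.mdeg1 => -[].
rewrite mE mpoly.mpolyXD mpoly.mdegD mpoly.mdeg1 add1n.
have -> : mpoly.mpolyX R (mpoly.mnm1 i) = X i - cst 0 by rewrite cst0 subr0.
by constructor; apply: IH.
Qed.

Lemma pl_ind (o : 'I_3 -> R) (Q : nat -> pl -> Prop) :
  (forall n, Q n 0) -> (forall n c, Q n.+1 (cst c)) ->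
  (forall n i p, Q n p -> Q n.+1 ((X i - cst (o i)) * p)) ->
  (forall n p q, Q n p -> Q n q -> Q n (p + q)) ->
  forall n p, msz p n -> Q n p.
Proof. by move=> ? ? ? ? n p /(genP o); elim; auto. Qed.

Lemma msz_pd i p n : msz p n -> msz (pd i p) n.-1.
Proof.
move=> pn; suff [] : msz p n /\ msz (pd i p) n.-1 by [].
move: n p pn; apply: (pl_ind (o := fun=> 0)) => /=.
- by move=> n; rewrite pd0 !msz0.
- by move=> n c; rewrite pdC msz0 mszC.
- move=> n j p [pn dpn]; split.
    by apply: mszMl => //; rewrite cst0 subr0 mszX.
  rewrite cst0 subr0 pdM pdX; apply: mszD.
    by case: eqP => _; rewrite ?mul1r ?mul0r // msz0.
  case: n => [|n] in pn dpn *; last by apply: mszMl => //; exact: mszX.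
  by rewrite (msz_eq0 dpn) mulr0 msz0.
- by move=> n p q [] ? ? [] ? ?; rewrite pdD; split; apply: mszD.
Qed.

Lemma pd_const p : (forall i, pd i p = 0) -> p = cst (mpoly.mcoeff (@mpoly.mnm0 3) p).
Proof.
move=> dp; apply/mpoly.mpolyP => m; rewrite mpoly.mcoeffC.
have [->|m0] := eqVneq m (@mpoly.mnm0 3); first by rewrite mulr1.
have [i mi] : exists i, (0 < m i)%N.
  apply/existsP; rewrite -[X in is_true X]negbK; apply/negP.
  rewrite negb_exists => /forallP h; move/eqP: m0; apply.
  by apply/mpoly.mnmP => i; apply/eqP; rewrite mpoly.mnm0E -leqn0 leqNgt.
have := congr1 (mpoly.mcoeff (mpoly.mnm_sub m (mpoly.mnm1 i))) (dp i).
rewrite mpoly.mcoeff_mderiv mpoly.mcoeff0 mpoly.submK; last first.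
  by apply/mpoly.mnm_lepP => j; rewrite mpoly.mnm1E; case: eqP => // <-.
by move/eqP; rewrite mulrn_eq0 /= => /eqP ->; rewrite mulr0.
Qed.

Definition line x y : pl -> {poly R} :=
  mpoly.mmap polyC (fun i => (x 0 i)%:P + y 0 i *: 'X).

Lemma lineD x y p q : line x y (p + q) = line x y p + line x y q.
Proof. exact: rmorphD. Qed.
Lemma lineM x y p q : line x y (p * q) = line x y p * line x y q.
Proof. exact: rmorphM. Qed.
Lemma lineC x y c : line x y (cst c) = c%:P.
Proof. exact: mpoly.mmapC. Qed.
Lemma lineX x y i : line x y (X i) = (x 0 i)%:P + y 0 i *: 'X.
Proof. by rewrite /line /X mpoly.mmapX mpoly.mmap1U. Qed.

Lemma line_ev x y p t : (line x y p).[t] = ev (x + t *: y) p.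
Proof.
have [n] : exists n, msz p n by [exists (mpoly.msize p)]; move: n p; apply: (pl_ind (o := fun=> 0)) => /=.
- by move=> _; rewrite /line rmorph0 horner0 ev0.
- by move=> _ c; rewrite lineC hornerC evC.
- move=> _ i p IH; rewrite cst0 subr0 lineM hornerM IH evM lineX evX.
  by rewrite !hornerE !mxE [t * _]mulrC.
- by move=> _ p q IHp IHq; rewrite lineD hornerD IHp IHq evD.
Qed.

Lemma line_deriv x y p : (line x y p)^`() = \sum_i y 0 i *: line x y (pd i p).
Proof.
have [n] : exists n, msz p n by [exists (mpoly.msize p)]; move: n p; apply: (pl_ind (o := fun=> 0)) => /=.
- move=> _; rewrite big1 ?{1}/line ?rmorph0 ?deriv0 // => i _.
  by rewrite pd0 /line rmorph0 scaler0.
- move=> _ c; rewrite lineC derivC big1 // => i _.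
  by rewrite pdC /line rmorph0 scaler0.
- move=> _ i p IH; rewrite cst0 subr0 lineM derivM IH lineX.
  rewrite derivD derivC derivZ derivX add0r.
  under [RHS]eq_bigr do rewrite pdM lineD 2!lineM scalerDr pdX.
  rewrite [RHS]big_split /= [X in _ = X + _](bigD1 i) //= eqxx [line x y 1]rmorph1.
  rewrite mul1r [X in _ = _ + X + _]big1; last first.
    by move=> j /negbTE ->; rewrite [line x y 0]rmorph0 mul0r scaler0.
  rewrite addr0 alg_polyC mul_polyC; congr (_ + _); rewrite mulr_sumr.
  by apply: eq_bigr => j _; rewrite lineX scalerAr.
- move=> _ p q IHp IHq; rewrite lineD derivD IHp IHq -big_split /=.
  by apply: eq_bigr => i _; rewrite pdD lineD scalerDr.
Qed.

(* A nonzero univariate polynomial has finitely many roots. *)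
Lemma line_eq0 x y p (e : R) : 0 < e ->
  (forall t, 0 < t -> t < e -> ev (x + t *: y) p = 0) -> line x y p = 0.
Proof.
move=> e0 H; apply/eqP/negPn/negP => q0.
set n := size (line x y p).
pose s := [seq e * (i.+1)%:R / (n.+2)%:R | i <- iota 0 n].
have us : uniq s.
  rewrite map_inj_uniq ?iota_uniq // => i j /(divIf _) h.
  have {}h := h (lt0r_neq0 (ltr0Sn _ _)).
  by move/(mulfI (lt0r_neq0 e0))/eqP: h; rewrite eqr_nat => /eqP [].
have rs : all (root (line x y p)) s.
  apply/allP => _ /mapP[i + ->]; rewrite mem_iota /= => ni.
  apply/rootP; rewrite line_ev; apply: H.
    by rewrite divr_gt0 ?mulr_gt0 ?ltr0Sn.
  rewrite ltr_pdivrMr ?ltr0Sn // ltr_pM2l // ltr_nat ltnS.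
  exact: (leq_trans ni (leqnSn _)).
by have := max_poly_roots q0 rs us; rewrite size_map size_iota ltnn.
Qed.

Lemma line_zero x y p (e : R) : 0 < e ->
  (forall t, 0 < t -> t < e -> ev (x + t *: y) p = 0) ->
  forall t, ev (x + t *: y) p = 0.
Proof. by move=> e0 /(line_eq0 e0) h t; rewrite -line_ev h horner0. Qed.

(** Induction on the degree: the partial derivatives vanish everywhere too, as seen on lines
    parallel to the axes, so [p] is a constant, with value zero. *)
Lemma ev_inj0 p : (forall x, ev x p = 0) -> p = 0.
Proof.
have [n pn] : exists n, msz p n by exists (mpoly.msize p).
elim: n p pn => [|n IH] p pn H; first exact: msz_eq0.
have dp i : pd i p = 0.
  apply: IH => [|x]; first exact: msz_pd pn.
  have := @line_eq0 x (delta_mx 0 i) p 1 ltr01 (fun t _ _ => H _).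
  move/(congr1 (fun q : {poly R} => q^`().[0])); rewrite line_deriv deriv0 horner0.
  rewrite horner_sum (bigD1 i) //= big1 => [|j /negbTE ji]; last first.
    by rewrite mxE eqxx ji scale0r horner0.
  by rewrite addr0 mxE !eqxx scale1r line_ev scale0r addr0.
by rewrite (pd_const dp) -(evC 0 (mpoly.mcoeff _ _)) -pd_const // H cst0.
Qed.

Lemma ev_inj p q : (forall x, ev x p = ev x q) -> p = q.
Proof.
by move=> H; apply/eqP; rewrite -subr_eq0; apply/eqP/ev_inj0 => x;
  rewrite evB H subrr.
Qed.

Definition sub (f : 'I_3 -> pl) : pl -> pl := mpoly.mmap (cst (R:=R)) f.

Lemma subsD f p q : sub f (p + q) = sub f p + sub f q.
Proof. exact: rmorphD. Qed.
Lemma subsM f p q : sub f (p * q) = sub f p * sub f q.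
Proof. exact: rmorphM. Qed.
Lemma subsC f c : sub f (cst c) = cst c.
Proof. exact: mpoly.mmapC. Qed.
Lemma subsX f i : sub f (X i) = f i.
Proof. by rewrite /sub /X mpoly.mmapX mpoly.mmap1U. Qed.

Lemma ev_sub f p x : ev x (sub f p) = ev (\row_i ev x (f i)) p.
Proof.
have [n] : exists n, msz p n by [exists (mpoly.msize p)]; move: n p; apply: (pl_ind (o := fun=> 0)) => /=.
- by move=> _; rewrite /sub rmorph0 !ev0.
- by move=> _ c; rewrite subsC !evC.
- by move=> _ i p IH; rewrite cst0 subr0 subsM !evM IH subsX evX mxE.
- by move=> _ p q IHp IHq; rewrite subsD !evD IHp IHq.
Qed.

Lemma msz_sub f : (forall i, msz (f i) 2) ->
  forall n p, msz p n -> msz (sub f p) n.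
Proof.
move=> f2; apply: (@pl_ind (fun=> 0) (fun n p => msz (sub f p) n)) => /=.
- by move=> n; rewrite /sub rmorph0 msz0.
- by move=> n c; rewrite subsC mszC.
- by move=> n i p IH; rewrite cst0 subr0 subsM subsX mszMl.
- by move=> n p q IHp IHq; rewrite subsD mszD.
Qed.
End Poly.

Lemma I3N : ((0 == 1 :> 'I_3) = false) * ((1 == 0 :> 'I_3) = false) *
  ((0 == 2 :> 'I_3) = false) * ((2 == 0 :> 'I_3) = false) *
  ((1 == 2 :> 'I_3) = false) * ((2 == 1 :> 'I_3) = false).
Proof. by []. Qed.

(** * The Euler operator and polynomial Poincare lemmas on one cell *)

Section Euler.
Context {R : realFieldType}.
Local Notation pl := (pl R).
Variable o : 'rV[R]_3.
Implicit Types (p q : pl) (x y : 'rV[R]_3).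

Definition Xt i : pl := X i - cst (o 0 i).
(** The operator [(x - o) . grad], which multiplies the part homogeneous of degree [m] about [o] by
    [m]; hence [s.+1 + euler] is invertible degree by degree. *)
Definition euler p : pl := \sum_i Xt i * pd i p.

Lemma ev_Xt x i : ev x (Xt i) = x 0 i - o 0 i.
Proof. by rewrite !evE. Qed.
Lemma pd_Xt i j : pd i (Xt j) = (i == j)%:R.
Proof. by rewrite !pdE subr0. Qed.
Lemma msz_Xt i : msz (Xt i) 2.
Proof. by apply: mszB; [exact: mszX|exact: mszC]. Qed.

Lemma eulerD p q : euler (p + q) = euler p + euler q.
Proof. by rewrite -big_split; apply: eq_bigr => i _; rewrite pdD mulrDr. Qed.
Lemma eulerN p : euler (- p) = - euler p.
Proof. by rewrite -sumrN; apply: eq_bigr => i _; rewrite pdN mulrN. Qed.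
Lemma eulerB p q : euler (p - q) = euler p - euler q.
Proof. by rewrite eulerD eulerN. Qed.
Lemma eulerZ c p : euler (c *: p) = c *: euler p.
Proof. by rewrite scaler_sumr; apply: eq_bigr => i _; rewrite pdZ scalerAr. Qed.
Lemma euler0 : euler 0 = 0.
Proof. by rewrite /euler big1 // => i _; rewrite pd0 mulr0. Qed.
Lemma eulerC c : euler (cst c) = 0.
Proof. by rewrite /euler big1 // => i _; rewrite pdC mulr0. Qed.
Lemma euler_sum I (r : seq I) (P : pred I) (F : I -> pl) :
  euler (\sum_(i <- r | P i) F i) = \sum_(i <- r | P i) euler (F i).
Proof. by apply: (big_morph euler eulerD euler0). Qed.
Lemma eulerM p q : euler (p * q) = euler p * q + p * euler q.
Proof.
rewrite /euler mulr_suml mulr_sumr -big_split; apply: eq_bigr => i _ /=.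
rewrite pdM; ring.
Qed.
Lemma euler_Xt i : euler (Xt i) = Xt i.
Proof.
rewrite /euler (bigD1 i) //= big1 => [|j /negbTE ji]; last first.
  by rewrite pd_Xt ji mulr0.
by rewrite pd_Xt eqxx mulr1 addr0.
Qed.
Lemma pd_euler i p : pd i (euler p) = pd i p + euler (pd i p).
Proof.
rewrite /euler pd_sum; under eq_bigr do rewrite pdM pd_Xt pd_comm.
rewrite big_split /= (bigD1 i) //= big1 => [|j /negbTE ji]; last first.
  by rewrite eq_sym ji mul0r.
by rewrite eqxx mul1r addr0.
Qed.
Lemma msz_euler p n : msz p n -> msz (euler p) n.
Proof.
move=> pn; apply: msz_sum => i _; case: n pn => [/msz_eq0 ->|n pn].
  by rewrite pd0 mulr0 msz0.
by apply: mszMl; [exact: msz_Xt | exact: msz_pd pn].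
Qed.

(** If [F] solves the equation for [s.+1] and [p], then [Xt i * F] solves it for [s] and [Xt i * p];
    the induction therefore quantifies over [s]. *)
Lemma euler_solve s n p : msz p n ->
  exists2 F, msz F n & s.+1%:R *: F + euler F = p.
Proof.
move=> pn; move: n p pn s.
apply: (@pl_ind _ (o 0)
  (fun n p => forall s, exists2 F, msz F n & s.+1%:R *: F + euler F = p)).
- by move=> n s; exists 0; [exact: msz0 | rewrite scaler0 euler0 addr0].
- move=> n c s; exists (cst (c / s.+1%:R)); first exact: mszC.
  by rewrite eulerC addr0 !cstE scalerA mulrC divfK // pnatr_eq0.
- move=> n i p IH s; have [F Fn <-] := IH s.+1.
  exists (Xt i * F); first by apply: mszMl => //; exact: msz_Xt.
  rewrite eulerM euler_Xt -[in RHS]natr1 scalerDl scale1r -/(Xt i).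
  by rewrite -!mpoly.mul_mpolyC; ring.
- move=> n p q IHp IHq s; have [F Fn <-] := IHp s; have [G Gn <-] := IHq s.
  exists (F + G); first exact: mszD.
  by rewrite eulerD scalerDr addrACA.
Qed.

Lemma line_Xt y i : line o y (Xt i) = y 0 i *: 'X.
Proof.
by rewrite [LHS]rmorphB /= [mpoly.mmap _ _ _]lineX [mpoly.mmap _ _ _]lineC addrC addKr.
Qed.

Lemma line_euler y p : line o y (euler p) = 'X * (line o y p)^`().
Proof.
rewrite line_deriv mulr_sumr [LHS]rmorph_sum /=; apply: eq_bigr => i _.
by rewrite -/(line o y _) lineM line_Xt -scalerAl scalerAr.
Qed.

(** On a single line through [o] the operator multiplies the coefficient of [t^k] by [s + 1 + k].
    Identities on a plane through [o] can thus be inverted without leaving the plane. *)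
Lemma euler_uniq s y p :
  (forall t, ev (o + t *: y) (s.+1%:R *: p + euler p) = 0) -> ev (o + y) p = 0.
Proof.
move=> H; have := line_eq0 ltr01 (fun t _ _ => H t).
rewrite lineD line_euler => h.
suff L0 : line o y p = 0 by rewrite -[y]scale1r -line_ev L0 horner0.
apply/polyP => k; rewrite coef0.
move/(congr1 (fun q : {poly R} => q`_k)): h.
rewrite /line mpoly.mmapZ mul_polyC -/(line o y p) coefD coefZ coefXM coef0.
case: k => [|k] /=; first by rewrite addr0 => /eqP; rewrite mulf_eq0 pnatr_eq0 => /eqP.
rewrite coef_deriv -[_ *+ k.+1]mulr_natl -mulrDl -natrD => /eqP.
by rewrite mulf_eq0 pnatr_eq0 addSn => /eqP.
Qed.

Lemma euler_inj s p : s.+1%:R *: p + euler p = 0 -> p = 0.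
Proof.
move=> h; apply: ev_inj0 => x; rewrite -(addrNK o x) addrC.
by apply: (euler_uniq (s := s)) => t; rewrite h ev0.
Qed.

Definition curl (v : 'I_3 -> pl) (j : 'I_3) : pl :=
  pd (j + 1) (v (j + 2)) - pd (j + 2) (v (j + 1)).
Definition div (v : 'I_3 -> pl) : pl := \sum_j pd j (v j).
Definition crossX (F : 'I_3 -> pl) (j : 'I_3) : pl :=
  F (j + 1) * Xt (j + 2) - F (j + 2) * Xt (j + 1).

Lemma curl_crossX F j : curl (crossX F) j = 2%:R *: F j + euler (F j) - Xt j * div F.
Proof.
rewrite /curl /crossX /div /euler !sum3 scaler_nat.
move: j; apply: ord3P; rewrite !I3E !pdB !pdM !pd_Xt !I3N ?eqxx /=; ring.
Qed.

(** The potential is [F x (X - o)] with [2 F + euler F = w]. Taking divergences, [div F] solves the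
    homogeneous equation with constant 3, so it vanishes and the last term of [curl_crossX] drops
    out. *)
Lemma curl_potential n (w : 'I_3 -> pl) : (forall j, msz (w j) n) -> div w = 0 ->
  exists F, [/\ forall j, msz (F j) n, forall j, 2%:R *: F j + euler (F j) = w j &
    forall j, curl (crossX F) j = w j].
Proof.
move=> wn dw.
have /fin_all_exists2[F Fn FE] : forall j, exists2 F, msz F n &
    2%:R *: F + euler F = w j by move=> j; exact: euler_solve.
exists F; split=> // j; rewrite curl_crossX FE.
suff -> : div F = 0 by rewrite mulr0 subr0.
apply: (@euler_inj 2); rewrite -dw /div scaler_sumr euler_sum -big_split /=.
apply: eq_bigr => i _; rewrite -FE pdD pdZ pd_euler addrA; congr (_ + _).
by rewrite -[3%:R]natr1 scalerDl scale1r.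
Qed.

(** The potential is [(X - o) . F] with [F + euler F = u]. The antisymmetric part of the gradient of
    [F] solves the homogeneous equation with constant 2, so [F] inherits curl-freeness from [u]. *)
Lemma grad_potential n (u : 'I_3 -> pl) : (forall j, msz (u j) n) ->
    (forall i j, pd i (u j) = pd j (u i)) ->
  exists phi, [/\ msz phi n.+1, forall i, pd i phi = u i & ev o phi = 0].
Proof.
move=> un cu.
have /fin_all_exists2[F Fn FE] : forall j, exists2 F, msz F n &
    1%:R *: F + euler F = u j by move=> j; exact: euler_solve.
exists (\sum_i Xt i * F i); split.
- by apply: msz_sum => i _; apply: mszMl => //; exact: msz_Xt.
- move=> i; rewrite pd_sum -FE /euler.
  under eq_bigr do rewrite pdM pd_Xt.
  rewrite big_split /= (bigD1 i) //= big1 => [|j /negbTE ji]; last first.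
    by rewrite eq_sym ji mul0r.
  rewrite eqxx mul1r addr0 scale1r; congr (_ + _); apply: eq_bigr => j _.
  congr (_ * _); apply/eqP; rewrite -subr_eq0; apply/eqP.
  apply: (@euler_inj 1); rewrite eulerB.
  move: (cu i j); rewrite -!FE !pdD !pdZ !pd_euler !scale1r.
  rewrite scaler_nat !mulr2n => h.
  have -> (A B C D : pl) : A - B + (A - B) + (C - D) = (A + (A + C)) - (B + (B + D)) by ring.
  by rewrite h subrr.
- by rewrite ev_sum big1 // => i _; rewrite evM ev_Xt subrr mul0r.
Qed.

Lemma ray_const y phi : (forall t, \sum_i y 0 i * ev (o + t *: y) (pd i phi) = 0) ->
  ev (o + y) phi = ev o phi.
Proof.
move=> H; have L0 : (line o y phi)^`() = 0.
  rewrite line_deriv.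
  have -> : \sum_i y 0 i *: line o y (pd i phi) =
            line o y (\sum_i y 0 i *: pd i phi).
    rewrite [RHS]rmorph_sum; apply: eq_bigr => i _.
    by rewrite [RHS]mpoly.mmapZ mul_polyC.
  apply: (line_eq0 ltr01) => t _ _; rewrite ev_sum -[RHS](H t).
  by apply: eq_bigr => i _; rewrite evZ.
have -> : ev (o + y) phi = (line o y phi).[1] by rewrite line_ev scale1r.
have -> : ev o phi = (line o y phi).[0] by rewrite line_ev scale0r addr0.
suff -> : line o y phi = ((line o y phi)`_0)%:P by rewrite !hornerC.
apply/polyP => -[|k]; rewrite coefC //=.
move/(congr1 (fun q : {poly R} => q`_k)): L0; rewrite coef_deriv coef0.
by move/eqP; rewrite mulrn_eq0 => /eqP.
Qed.

Lemma div_potential n p : msz p n ->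
  exists2 v, (forall j, msz (v j) n.+1) & div v = p.
Proof.
move=> pn; have [F Fn FE] := euler_solve 2 pn.
exists (fun j => Xt j * F) => [j|]; first by apply: mszMl => //; exact: msz_Xt.
rewrite -FE /div /euler; under eq_bigr do rewrite pdM pd_Xt eqxx mul1r.
rewrite big_split /= sumr_const card_ord scaler_nat; congr (_ + _).
Qed.
End Euler.

(** * Division of a polynomial by an affine form *)

Section Division.
Context {R : realFieldType}.
Local Notation pl := (pl R).
Variables (l : pl) (e : 'rV[R]_3).
Hypotheses (l2 : msz l 2) (le : forall x t, ev (x + t *: e) l = ev x l + t).

(** Coordinates of [x - l(x) e], the projection along [e] onto the plane [l = 0]. Substituting them
    extends the trace on that plane constantly along [e]. *)
Definition plproj i : pl := X i - e 0 i *: l.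

Lemma ev_plproj x p : ev x (sub plproj p) = ev (x - ev x l *: e) p.
Proof.
rewrite ev_sub; congr (ev _ p); apply/rowP => i.
by rewrite !mxE !evE mulrC.
Qed.

Lemma ev_plproj_l x : ev (x - ev x l *: e) l = 0.
Proof. by rewrite -scaleNr le subrr. Qed.

Lemma msz_plproj p n : msz p n -> msz (sub plproj p) n.
Proof. by apply: msz_sub => i; apply: mszB; [exact: mszX | exact: mszZ]. Qed.

Lemma hadamard n p : msz p n -> exists2 q, msz q n.-1 & p = sub plproj p + l * q.
Proof.
move=> pn; suff [_] : msz p n /\ exists2 q, msz q n.-1 & p = sub plproj p + l * q by [].
move: n p pn; apply: (pl_ind (o := fun=> 0)) => /=.
- move=> n; split; first exact: msz0.
  by exists 0; [exact: msz0 | rewrite [sub _ _]rmorph0 mulr0 addr0].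
- move=> n c; split; first exact: mszC.
  by exists 0; [exact: msz0 | rewrite subsC mulr0 addr0].
- move=> n i p [pn [q qn pE]]; rewrite cst0 subr0; split.
    by apply: mszMl => //; exact: mszX.
  exists (X i * q + e 0 i *: sub plproj p).
    apply: mszD; last by apply: mszZ; exact: msz_plproj.
    case: n => [|n] in pn qn *; last by apply: mszMl => //; exact: mszX.
    by rewrite (msz_eq0 qn) mulr0 msz0.
  rewrite subsM subsX {1}pE /plproj -!mpoly.mul_mpolyC; ring.
- move=> n p q [pn [f fn pE]] [qn [g gn qE]]; split; first exact: mszD.
  exists (f + g); first exact: mszD.
  by rewrite subsD mulrDr addrACA -pE -qE.
Qed.

Lemma plane_div n p : msz p n -> (forall x, ev x l = 0 -> ev x p = 0) ->
  exists2 q, msz q n.-1 & p = l * q.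
Proof.
move=> /hadamard[q qn pE] H; exists q => //; rewrite {1}pE.
suff -> : sub plproj p = 0 by rewrite add0r.
by apply: ev_inj0 => x; rewrite ev_plproj; apply/H/ev_plproj_l.
Qed.
End Division.

Definition dotp (R : pzRingType) n (u v : 'rV[R]_n) : R := \sum_k u 0 k * v 0 k.

(** * Piecewise polynomials on the Alfeld split and the three lifting theorems *)

Section Alfeld.
Context {R : realFieldType}.
Local Notation pl := (pl R).
Variables (o : 'rV[R]_3) (r d : 'I_4 -> 'rV[R]_3).
Hypothesis d_sum : \sum_l d l = 0.
Hypothesis d_r : forall l k, dotp (d l) (r k) = (l == k)%:R - 4^-1.
Implicit Types (p q : pl) (x y : 'rV[R]_3).

(** The barycentric coordinate of index [l], shifted by 1/4 so as to vanish at [o]; [d l] is its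
    gradient. *)
Definition mu l : pl := \sum_k d l 0 k *: Xt o k.
(** The plane spanned by the interface of the cells [i] and [j], with normal [d i - d j]. A
    polynomial vanishes on the triangle exactly when it vanishes on the plane, so all continuity
    conditions are stated on the plane. *)
Definition on_face i j x := ev x (mu i) = ev x (mu j).
Definition cont (p : 'I_4 -> pl) :=
  forall i j x, on_face i j x -> ev x (p i) = ev x (p j).
Definition jump (v : 'I_4 -> 'I_3 -> pl) i j x k := ev x (v i k) - ev x (v j k).
(** The jump is parallel to the normal, expressed by the vanishing of the 2 by 2 minors. *)
Definition tcont (v : 'I_4 -> 'I_3 -> pl) :=
  forall i j x, on_face i j x -> forall a b,
    (d i - d j) 0 a * jump v i j x b = (d i - d j) 0 b * jump v i j x a.
Definition ncont (v : 'I_4 -> 'I_3 -> pl) :=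
  forall i j x, on_face i j x -> \sum_k (d i - d j) 0 k * jump v i j x k = 0.

Lemma pd_mu k l : pd k (mu l) = cst (d l 0 k).
Proof.
rewrite /mu pd_sum (bigD1 k) //= big1 => [|j /negbTE jk]; last first.
  by rewrite pdZ pd_Xt eq_sym jk scaler0.
by rewrite pdZ pd_Xt eqxx addr0 cstE.
Qed.

Lemma msz_mu l : msz (mu l) 2.
Proof. by apply: msz_sum => k _; apply: mszZ; exact: msz_Xt. Qed.

Lemma msz_muX l m p n : msz p n -> msz (mu l ^+ m * p) (n + m).
Proof.
move=> pn; elim: m => [|m IH]; first by rewrite mul1r addn0.
by rewrite exprS -mulrA addnS; apply: mszMl => //; exact: msz_mu.
Qed.

Lemma ev_mu x l : ev x (mu l) = dotp (d l) (x - o).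
Proof. by rewrite ev_sum; apply: eq_bigr => k _; rewrite evZ ev_Xt !mxE. Qed.

Lemma dotpDr (u v w : 'rV[R]_3) : dotp u (v + w) = dotp u v + dotp u w.
Proof. by rewrite -big_split; apply: eq_bigr => k _; rewrite mxE mulrDr. Qed.
Lemma dotpZr c (u v : 'rV[R]_3) : dotp u (c *: v) = c * dotp u v.
Proof. by rewrite /dotp mulr_sumr; apply: eq_bigr => k _; rewrite mxE mulrCA. Qed.
Lemma dotpBl (u v w : 'rV[R]_3) : dotp (u - v) w = dotp u w - dotp v w.
Proof. by rewrite -sumrB; apply: eq_bigr => k _; rewrite !mxE mulrBl. Qed.

Lemma ev_muD x y l : ev (x + y) (mu l) = ev x (mu l) + dotp (d l) y.
Proof. by rewrite !ev_mu -dotpDr addrAC. Qed.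

Lemma face_ray i j x t : on_face i j x -> on_face i j (o + t *: (x - o)).
Proof.
by rewrite /on_face !ev_mu => h; rewrite addrC addKr !dotpZr h.
Qed.

Lemma face_shift i j k x t : i != k -> j != k -> on_face i j x ->
  on_face i j (x - t *: r k).
Proof.
move=> /negbTE ik /negbTE jk; rewrite /on_face -!scaleNr !ev_muD => ->.
by rewrite !dotpZr !d_r ik jk.
Qed.

Lemma mu_div i j n p : i != j -> msz p n ->
    (forall x, on_face i j x -> ev x p = 0) ->
  exists2 q, msz q n.-1 & p = (mu i - mu j) * q.
Proof.
move=> ij pn H; apply: (@plane_div _ (mu i - mu j) (- r j)) => //.
- by apply: mszB; exact: msz_mu.
- move=> x t; rewrite scalerN -scaleNr !evB !ev_muD !dotpZr !d_r eqxx (negbTE ij) /=.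
  ring.
- by move=> x; rewrite evB => /eqP; rewrite subr_eq0 => /eqP /H.
Qed.

(** Newton interpolation with nodes [mu l]. The divided differences by [mu l - mu a] are polynomials
    by [mu_div] and match again on the faces, so the induction continues with one cell fewer and the
    degree lowered by one. The coefficients are single global polynomials. *)
Lemma newton (s : seq 'I_4) N (p : 'I_4 -> pl) : uniq s ->
    (forall l, l \in s -> msz (p l) N) ->
    (forall i j x, i \in s -> j \in s -> on_face i j x -> ev x (p i) = ev x (p j)) ->
  exists C : {poly pl}, (forall m, msz C`_m (N - m)) /\
    forall l, l \in s -> p l = C.[mu l].
Proof.
elim: s N p => [|a s IH] N p /=.
  by move=> _ _ _; exists 0; split => // m; rewrite coef0 msz0.
move=> /andP[as_ us] pN pc.
have la l : l \in s -> l != a by move=> ls; apply: contraNneq as_ => <-.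
have /choice[q qP] : forall l, exists q, l \in s -> msz q N.-1 /\ p l - p a = (mu l - mu a) * q.
  move=> l; case: (boolP (l \in s)) => ls; last by exists 0.
  have [||q qN qE] := @mu_div l a N (p l - p a) (la _ ls).
  - by apply: mszB; apply: pN; rewrite inE ?eqxx ?ls ?orbT.
  - move=> x /pc h; rewrite evB h ?subrr // inE ?eqxx ?ls ?orbT //.
  - by exists q.
have [||C [CN CE]] := IH N.-1 q us; first by move=> l /qP[].
  move=> i j x si sj ij.
  have key y : on_face i j y -> ev y (mu i) - ev y (mu a) != 0 -> ev y (q i - q j) = 0.
    move=> ijy nz; apply: (mulfI nz); rewrite mulr0 evB mulrBr {2}[ev y (mu i)]ijy.
    rewrite -!evB -!evM -(qP _ si).2 -(qP _ sj).2 !evB opprB addrA addrNK.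
    by rewrite (pc i j y) ?subrr // inE ?si ?sj orbT.
  apply/eqP; rewrite -subr_eq0 -evB; apply/eqP.
  have [nz|] := boolP (ev x (mu i) - ev x (mu a) != 0); first exact: key.
  rewrite negbK => /eqP z.
  (* Where [mu i] and [mu a] coincide, division is impossible; moving by [- t r a] stays in the
     plane of [i] and [j] and makes their difference equal to [t]. *)
  have := @line_zero _ x (- r a) (q i - q j) 1 ltr01 _ 0.
  rewrite scale0r addr0; apply => t t0 _; apply: key.
    by rewrite scalerN; apply: face_shift => //; exact: la.
  rewrite !ev_muD scalerN -scaleNr !dotpZr !d_r eqxx (negbTE (la _ si)) /=.
  have -> : ev x (mu i) + - t * (0 - 4^-1) - (ev x (mu a) + - t * (1 - 4^-1)) =
    (ev x (mu i) - ev x (mu a)) + t by ring.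
  by rewrite z add0r lt0r_neq0.
exists ((p a)%:P + ('X - (mu a)%:P) * C); split.
- move=> m; rewrite coefD coefC mulrBl coefB coefXM coefCM.
  apply: mszD.
    by case: m => [|m] /=; rewrite ?msz0 // subn0 pN // inE eqxx.
  apply: mszB.
    case: m => [|m] /=; first exact: msz0.
    by apply: mszW (CN m); case: (N) => [|N'] //=; rewrite subSS.
  have := CN m; case E : (N.-1 - m)%N => [|k].
    by move/msz_eq0 ->; rewrite mulr0 msz0.
  move=> h; apply: (mszW (m := k.+2)); first by case: (N) E => [|N'] //= E; rewrite subSn ?E // ltnW // -subn_gt0 E.
  by apply: mszMl => //; exact: msz_mu.
- move=> l; rewrite inE hornerD hornerC hornerM hornerXsubC => /orP[/eqP ->|ls].
    by rewrite subrr mul0r addr0.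
  by rewrite -CE // -(qP _ ls).2 addrC subrK.
Qed.

(** The trace is corrected one face at a time: the defect on the face of [i] and [a] is extended
    constantly along [r a]. This direction is tangent to the other planes of [i], so by
    compatibility the correction vanishes on the faces already treated. *)
Lemma face_extend i N (g : 'I_4 -> pl) (s : seq 'I_4) : uniq s -> i \notin s ->
    (forall j, j \in s -> msz (g j) N) ->
    (forall j k x, j \in s -> k \in s -> on_face i j x -> on_face i k x ->
       ev x (g j) = ev x (g k)) ->
  exists2 p, msz p N & forall j x, j \in s -> on_face i j x -> ev x p = ev x (g j).
Proof.
elim: s => [|a s IH] /=; first by exists 0; first exact: msz0.
move=> /andP[as_ us]; rewrite inE negb_or => /andP[ia is_] gN gc.
have [||p pN pE] := IH us is_.
- by move=> j js; apply: gN; rewrite inE js orbT.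
- by move=> j k x js ks; apply: gc; rewrite inE ?js ?ks orbT.
pose L := mu i - mu a.
have Le x t : ev (x + t *: - r a) L = ev x L + t.
  rewrite scalerN -scaleNr !evB !ev_muD !dotpZr !d_r eqxx (negbTE ia) /=; ring.
have gaN : msz (g a) N by apply: gN; rewrite inE eqxx.
exists (p + sub (plproj L (- r a)) (g a - p)).
  apply: mszD => //; apply: msz_plproj; last exact: mszB.
  by apply: mszB; exact: msz_mu.
have L0 x : on_face i a x <-> ev x L = 0.
  by rewrite evB; split => [->|/eqP]; rewrite ?subrr // subr_eq0 => /eqP.
move=> j x; rewrite inE evD ev_plproj => /orP[/eqP -> /L0 ->|js ij].
  by rewrite scale0r subr0 evB addrC subrK.
have ya : on_face i a (x - ev x L *: - r a) by apply/L0; exact: ev_plproj_l.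
have ja : j != a by apply: contraNneq as_ => <-.
have yj : on_face i j (x - ev x L *: - r a).
  by rewrite scalerN -scaleNr; apply: face_shift.
rewrite [X in _ + X]evB (pE j) // (pE j) // (gc a j) ?subrr ?addr0 //.
  by rewrite inE eqxx.
by rewrite inE js orbT.
Qed.

(** The factor of [d i - d j] in the jump of a tangentially continuous field, extracted by pairing
    with [r i], since [(d i - d j) . r i = 1]. *)
Definition jcoef (v : 'I_4 -> 'I_3 -> pl) i j : pl :=
  \sum_k r i 0 k *: (v i k - v j k).

Lemma jcoefE v i j x : tcont v -> i != j -> on_face i j x ->
  forall k, jump v i j x k = (d i - d j) 0 k * ev x (jcoef v i j).
Proof.
move=> tv ij fx k; have n1 : dotp (d i - d j) (r i) = 1.
  by rewrite dotpBl !d_r eqxx eq_sym (negbTE ij) /=; ring.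
rewrite -[LHS]mul1r -n1 /dotp mulr_suml /jcoef ev_sum mulr_sumr.
apply: eq_bigr => b _; rewrite evZ evB -/(jump v i j x b).
by rewrite mulrAC (tv i j x fx b k) mulrAC -!mulrA; congr (_ * _); rewrite mulrC.
Qed.

(** Where three cells meet, the jump from [i] to [j] plus that from [j] to [k] is the jump from [i]
    to [k]; pairing with [r i], which [d j - d k] annihilates, compares the two factors. *)
Lemma jcoef_edge v i j k x : tcont v -> i != j -> i != k -> on_face i j x ->
  on_face i k x -> ev x (jcoef v i j) = ev x (jcoef v i k).
Proof.
move=> tv ij ik xj xk; have [<- //|jk] := eqVneq j k.
have xjk : on_face j k x by rewrite /on_face -xj -xk.
have E : forall b, (d i - d j) 0 b * ev x (jcoef v i j) +
    (d j - d k) 0 b * ev x (jcoef v j k) = (d i - d k) 0 b * ev x (jcoef v i k).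
  by move=> b; rewrite -!jcoefE // /jump; ring.
have {E}: \sum_b (r i 0 b * ((d i - d j) 0 b * ev x (jcoef v i j) +
    (d j - d k) 0 b * ev x (jcoef v j k))) =
  \sum_b (r i 0 b * ((d i - d k) 0 b * ev x (jcoef v i k))).
  by apply: eq_bigr => b _; rewrite E.
have S (u : 'rV[R]_3) c : \sum_b r i 0 b * (u 0 b * c) = dotp u (r i) * c.
  by rewrite /dotp mulr_suml; apply: eq_bigr => b _; ring.
under eq_bigr do rewrite mulrDr.
rewrite big_split /= !S !dotpBl !d_r eqxx !(eq_sym _ i) (negbTE ij) (negbTE ik) /=.
by move=> h; lra.
Qed.

Lemma jcoef_sym v i j x : tcont v -> i != j -> on_face i j x ->
  ev x (jcoef v i j) = ev x (jcoef v j i).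
Proof.
move=> tv ij xij; have ji : j != i by rewrite eq_sym.
have xji : on_face j i x by rewrite /on_face xij.
have E b : (d i - d j) 0 b * ev x (jcoef v i j) = (d i - d j) 0 b * ev x (jcoef v j i).
  rewrite -jcoefE // -[LHS]opprK /jump opprB -[X in - X]/(jump v j i x b) jcoefE //.
  by rewrite -mulNr !mxE opprB.
have n1 : dotp (d i - d j) (r i) = 1.
  by rewrite dotpBl !d_r eqxx (negbTE ji) /=; ring.
rewrite -[LHS]mul1r -[RHS]mul1r -n1 /dotp !mulr_suml; apply: eq_bigr => b _.
by rewrite mulrAC E mulrAC.
Qed.

(* [mu] generates the continuous piecewise polynomials over the global ones, and
   [v - p grad mu] is continuous once [p] takes the values [jcoef v i j] on the faces. *)
Lemma tcont_decomp v N : tcont v -> (forall l k, msz (v l k) N) ->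
  exists C : {poly pl}, (forall m, msz C`_m (N - m)) /\
    forall k, cont (fun l => v l k - d l 0 k *: C.[mu l]).
Proof.
move=> tv vN.
have gN i j : msz (jcoef v i j) N by apply: msz_sum => k _; apply: mszZ; exact: mszB.
have /fin_all_exists2[p pN pE] : forall i, exists2 p, msz p N &
    forall j x, i != j -> on_face i j x -> ev x p = ev x (jcoef v i j).
  move=> i; have [||||p pN pE] := @face_extend i N (jcoef v i) (rem i (enum 'I_4)).
  - by rewrite rem_uniq // enum_uniq.
  - by rewrite mem_rem_uniq ?enum_uniq // !inE eqxx.
  - by move=> *; exact: gN.
  - move=> j k x; rewrite !mem_rem_uniq ?enum_uniq // !inE => /andP[ji _] /andP[ki _].
    by apply: jcoef_edge; rewrite // eq_sym.
  - exists p => // j x ij; apply: pE.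
    by rewrite mem_rem_uniq ?enum_uniq // !inE eq_sym ij mem_enum.
have pc : cont p.
  move=> i j x xij; have [-> //|ij] := eqVneq i j.
  have ji : j != i by rewrite eq_sym.
  by rewrite (pE i j) // jcoef_sym // (pE j i).
have [||C [CN CE]] := @newton (enum 'I_4) N p (enum_uniq _).
- by move=> l _; exact: pN.
- by move=> i j x _ _; exact: pc.
exists C; split => // k i j x xij; rewrite !evB !evZ -!CE ?mem_enum //.
have [-> //|ij] := eqVneq i j.
have := jcoefE tv ij xij k; rewrite /jump -(pE _ _ _ ij xij) !mxE mulrBl => h.
by rewrite -(pc _ _ _ xij); lra.
Qed.

(** The cell potentials are normalised to vanish at [o]. The jump of [u] is normal to the face
    plane, hence has no component along rays from [o] in that plane, and the jump of the potentials
    stays zero along them ([ray_const]). *)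
Lemma grad_lift (u : 'I_4 -> 'I_3 -> pl) n : tcont u ->
    (forall l k, msz (u l k) n) ->
    (forall l a b, pd a (u l b) = pd b (u l a)) ->
  exists phi : 'I_4 -> pl, [/\ forall l, msz (phi l) n.+1, cont phi &
    forall l k, pd k (phi l) = u l k].
Proof.
move=> tu un cu.
have /fin_all_exists[phi phiP] l := grad_potential o (un l) (cu l).
exists phi; split=> [l|i j x xij|l k]; try by case: (phiP l).
have [-> //|ij] := eqVneq i j.
have [_ gi oi] := phiP i; have [_ gj oj] := phiP j.
apply/eqP; rewrite -subr_eq0 -evB -(subrK o x) addrC.
rewrite (@ray_const _ o (x - o)) ?evB ?oi ?oj ?subrr // => t.
have xt := face_ray t xij.
under eq_bigr do rewrite pdB gi gj evB -/(jump u i j _ _) jcoefE // mulrA.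
rewrite -mulr_suml; have -> : \sum_b (x - o) 0 b * (d i - d j) 0 b = 0.
  transitivity (dotp (d i - d j) (x - o)); first by apply: eq_bigr => b _; rewrite mulrC.
  by rewrite dotpBl -!ev_mu xij subrr.
by rewrite mul0r.
Qed.

(** The mean [fb] of the four pieces is a global polynomial and a global divergence. The remainders
    come from [mu l * w], as [d l . w = f l - fb] by duality of [d] and [r]; such a field is
    continuous because [w] is global. The term with [F] cancels the contribution of [div w]. *)
Lemma div_lift (f : 'I_4 -> pl) n : (forall l, msz (f l) n) ->
  exists v : 'I_4 -> 'I_3 -> pl, [/\ forall l k, msz (v l k) n.+1,
    forall k, cont (v^~ k) & forall l, div (v l) = f l].
Proof.
move=> fn; pose fb := 4^-1 *: \sum_l f l.
have fbn : msz fb n by apply: mszZ; apply: msz_sum.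
have [g gn gE] := div_potential o fbn.
pose w k := \sum_l r l 0 k *: (f l - fb).
have wn k : msz (w k) n by apply: msz_sum => l _; apply: mszZ; exact: mszB.
have dw l : \sum_k d l 0 k *: w k = f l - fb.
  rewrite /w; under eq_bigr do rewrite scaler_sumr.
  rewrite exchange_big /=.
  transitivity (\sum_m ((l == m)%:R - 4^-1) *: (f m - fb)).
    apply: eq_bigr => m _; rewrite -d_r /dotp scaler_suml.
    by apply: eq_bigr => k _; rewrite scalerA.
  under eq_bigr do rewrite scalerBl.
  have fb4 : fb *+ 4 = \sum_l f l.
    by rewrite -[_ *+ 4]scaler_nat /fb scalerA divff ?pnatr_eq0 // scale1r.
  rewrite sumrB -scaler_sumr sumrB sumr_const card_ord fb4 subrr scaler0 subr0.
  rewrite (bigD1 l) //= eqxx scale1r big1 ?addr0 // => m /negbTE ml.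
  by rewrite eq_sym ml scale0r.
(* The constant 4: with [x] centred at [o], the divergence of [mu l x F] is
   [mu l (F + 3 F + euler F)], one [F] coming from the gradient of [mu l]. *)
have [F Fn FE] : exists2 F, msz F n.-1 & 4%:R *: F + euler o F = div w.
  apply: euler_solve; apply: msz_sum => k _; exact: msz_pd.
exists (fun l k => g k + mu l * (w k - Xt o k * F)); split.
- move=> l k; apply: mszD => //; apply: mszMl; first exact: msz_mu.
  apply: mszB => //; case: n {fn fbn gn wn gE} Fn => [/msz_eq0 ->|n Fn].
    by rewrite mulr0 msz0.
  by apply: mszMl => //; exact: msz_Xt.
- by move=> k i j x xij; rewrite !evD !evM xij.
move=> l; rewrite -[RHS](subrK fb) -dw -gE /div.
under eq_bigr do rewrite pdD pdM pd_mu pdB pdM pd_Xt eqxx mul1r mpoly.mul_mpolyC scalerBr.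
rewrite !big_split /= sumrN addrC; congr (_ + _).
have -> : \sum_i d l 0 i *: (Xt o i * F) = mu l * F.
  by rewrite /mu mulr_suml; apply: eq_bigr => k _; rewrite scalerAl.
rewrite -mulr_sumr sumrB -/(div w) -FE big_split /= sumr_const card_ord -/(euler o F).
by rewrite scaler_nat; ring.
Qed.

(** The Poincare potentials [F l x (X - o)] of the cells are tangentially continuous. By
    [tcont_decomp] they differ from a continuous field by [d l * C(mu l)], which is, up to a
    continuous field, the gradient of a primitive of [C] in [mu l]. Subtracting that gradient leaves
    the curl unchanged. *)
Lemma curl_lift (w : 'I_4 -> 'I_3 -> pl) n : ncont w -> (forall l k, msz (w l k) n) ->
    (forall l, div (w l) = 0) ->
  exists v : 'I_4 -> 'I_3 -> pl, [/\ forall l k, msz (v l k) n.+1,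
    forall k, cont (v^~ k) & forall l k, curl (v l) k = w l k].
Proof.
move=> nw wn dw.
have /fin_all_exists[F FP] l := curl_potential o (wn l) (dw l).
have Fn l k : msz (F l k) n by case: (FP l).
have FE l k : 2%:R *: F l k + euler o (F l k) = w l k by case: (FP l).
(* The equation [2 F + euler F = w] passes to the normal jump on the plane, where [euler_uniq]
   inverts it line by line. *)
have nF i j x : on_face i j x -> \sum_k (d i - d j) 0 k * jump F i j x k = 0.
  move=> xij; pose h := \sum_k (d i - d j) 0 k *: (F i k - F j k).
  have <- : ev x h = \sum_k (d i - d j) 0 k * jump F i j x k.
    by rewrite ev_sum; apply: eq_bigr => k _; rewrite evZ evB.
  rewrite -(subrK o x) addrC; apply: (euler_uniq (s := 1)) => t.
  rewrite /h euler_sum scaler_sumr -big_split /= ev_sum -[RHS](nw _ _ _ (face_ray t xij)).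
  by apply: eq_bigr => k _; rewrite eulerZ eulerB /jump -!FE !evE; ring.
pose v0 l := crossX o (F l).
have v0n l k : msz (v0 l k) n.+1.
  by apply: mszB; rewrite mulrC; apply: mszMl => //; exact: msz_Xt.
(* The cross product of [n] with [f x y] is a combination of [n . y] and [n . f], both zero on the
   face. *)
have tv0 : tcont v0.
  move=> i j x xij a b; have := nF i j x xij.
  have : \sum_k (d i - d j) 0 k * (x - o) 0 k = 0.
    by rewrite -/(dotp _ _) dotpBl -!ev_mu xij subrr.
  have jv c : jump v0 i j x c = jump F i j x (c + 1) * (x - o) 0 (c + 2) -
       jump F i j x (c + 2) * (x - o) 0 (c + 1).
    by rewrite /jump /v0 /crossX !evE !mxE; ring.
  rewrite !jv !sum3; set m := d i - d j; set f := jump F i j x; set y := x - o.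
  move=> E1 E2.
  have K (P Q A B : R) : P - Q = A * (m 0 0 * y 0 0 + m 0 1 * y 0 1 + m 0 2 * y 0 2) -
      B * (m 0 0 * f 0 + m 0 1 * f 1 + m 0 2 * f 2) -> P = Q.
    by rewrite E1 E2 !mulr0 subr0 => /eqP; rewrite subr_eq0 => /eqP.
  move: a; apply: ord3P; move: b; apply: ord3P; rewrite !I3E.
  - by [].
  - apply: (K _ _ (f 2) (y 0 2)); ring.
  - apply: (K _ _ (- f 1) (- y 0 1)); ring.
  - apply: (K _ _ (- f 2) (- y 0 2)); ring.
  - by [].
  - apply: (K _ _ (f 0) (y 0 0)); ring.
  - apply: (K _ _ (f 1) (y 0 1)); ring.
  - apply: (K _ _ (- f 0) (- y 0 0)); ring.
  - by [].
have [C [CN Cc]] := tcont_decomp tv0 v0n.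
(* [P] integrates [C] termwise in [mu l]; its gradient is [d l * C(mu l)] plus [z], where [z] is
   continuous, being a polynomial in [mu l] with global coefficients. *)
pose z l k : pl := \sum_(m < size C) (m.+1%:R^-1 *: (mu l ^+ m.+1 * pd k C`_m)).
pose P l : pl := \sum_(m < size C) (m.+1%:R^-1 *: (mu l ^+ m.+1 * C`_m)).
have zP l k : pd k (P l) = d l 0 k *: C.[mu l] + z l k.
  rewrite /P pd_sum /z horner_coef scaler_sumr -big_split /=; apply: eq_bigr => m _.
  rewrite pdZ pdM scalerDr; congr (_ + _).
  have -> : pd k (mu l ^+ m.+1) = (m.+1%:R * d l 0 k) *: mu l ^+ m.
    elim: (nat_of_ord m) => [|q IH].
      by rewrite expr1 pd_mu cstE expr0 mul1r.
    rewrite exprS pdM IH pd_mu mpoly.mul_mpolyC -scalerAr -exprS -scalerDl.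
    by congr (_ *: _); rewrite -[in RHS]natr1 mulrDl mul1r addrC.
  rewrite -scalerAl scalerA mulrA mulVf ?pnatr_eq0 // mul1r.
  by rewrite mulrC.
have zn l k : msz (z l k) n.+1.
  apply: msz_sum => m _; apply: mszZ; case: (leqP m n) => mn; last first.
    have := CN m; rewrite (eqP (mn : (n.+1 - m == 0)%N)) => /msz_eq0 ->.
    by rewrite pd0 mulr0 msz0.
  have := msz_pd k (CN m); rewrite subSn // => /msz_muX -/(_ l m.+1).
  by rewrite addnS subnK.
have zc k i j x : on_face i j x -> ev x (z i k) = ev x (z j k).
  move=> xij; rewrite /z !ev_sum; apply: eq_bigr => m _.
  by rewrite !evZ !evM !evXn xij.
clearbody P z.
exists (fun l k => v0 l k - d l 0 k *: C.[mu l] - z l k); split.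
- move=> l k; apply: mszB; last exact: zn.
  apply: mszB; first exact: v0n.
  apply: mszZ; rewrite horner_coef; apply: msz_sum => m _; rewrite mulrC.
  case: (leqP m n.+1) => mn; first by rewrite -(subnK mn); exact: msz_muX.
  by have := CN m; rewrite (eqP (ltnW mn)) => /msz_eq0 ->; rewrite mulr0 msz0.
- move=> k i j x xij; have /= h := Cc k i j x xij.
  by rewrite evB h (zc k i j x xij) -evB.
move=> l k; have [_ _ cF] := FP l; rewrite -cF -/(v0 l) /curl.
have E b : v0 l b - d l 0 b *: C.[mu l] - z l b = v0 l b - pd b (P l).
  by rewrite zP opprD addrA.
rewrite !E !pdB [pd (k + 1) (pd _ _)]pd_comm; ring.
Qed.

End Alfeld.

(** * Lebesgue measure on space: translation invariance, boxes, measurability of open sets *)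

Section Measure.
Context {R : realType}.
Local Notation mR := (measurableTypeR R).
Local Notation R3 := (mR * mR * mR)%type.
Local Notation leb := (@lebesgue_measure R).

Definition preserves d (T : measurableType d) (m : set T -> \bar R) (f : T -> T) :=
  measurable_fun setT f /\ forall A, measurable A -> m (f @^-1` A) = m A.

Lemma leb_shift (h : R) : preserves leb (fun x : mR => (x + h : mR)).
Proof.
have mf : measurable_fun setT (fun x : mR => (x + h : mR)) by exact: measurable_funD.
split => // A mA.
pose m' := measure_function_pushforward__canonical__measure_function_Measure leb mf.
rewrite [RHS](@lebesgue_measure_unique R m') // => X [[a b] _ <-].
have -> : m' `]a, b]%classic = leb `]a - h, b - h]%classic.
  rewrite /m' /= /pushforward; congr (leb _); apply/seteqP.
  by split=> x /=; rewrite !in_itv /= ltrBlDr lerBrDr.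
rewrite !lebesgue_measure_itv /= !lte_fin ltrD2r.
by case: ifP => // _; rewrite -!EFinB; congr (_%:E); ring.
Qed.

Lemma preserves_prod d1 d2 (T1 : measurableType d1) (T2 : measurableType d2)
    (m1 : {sigma_finite_measure set T1 -> \bar R})
    (m2 : {sigma_finite_measure set T2 -> \bar R}) f g :
  preserves m1 f -> preserves m2 g ->
  preserves (m1 \x m2)%E (fun p => (f p.1, g p.2)).
Proof.
move=> [mf fE] [mg gE].
have mfg : measurable_fun setT (fun p : T1 * T2 => (f p.1, g p.2)).
  apply: measurable_fun_pair; first by apply: measurableT_comp => //; exact: measurable_fst.
  by apply: measurableT_comp => //; exact: measurable_snd.
split=> // A mA.
pose m' := measure_function_pushforward__canonical__measure_function_Measure
  (m1 \x m2)%E mfg.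
rewrite [RHS](@product_measure_unique _ _ _ _ _ m1 m2 m') // => B C mB mC.
rewrite /m' /= /pushforward.
have -> : (fun p : T1 * T2 => (f p.1, g p.2)) @^-1` (B `*` C) =
          (f @^-1` B) `*` (g @^-1` C) by [].
have pB : measurable (f @^-1` B) by rewrite -[X in measurable X]setTI; exact: mf.
have pC : measurable (g @^-1` C) by rewrite -[X in measurable X]setTI; exact: mg.
by rewrite product_measure1E //; congr (_ * _)%E; [exact: fE|exact: gE].
Qed.

Definition shift3 (v : 'rV[R]_3) (p : R3) : R3 :=
  (p.1.1 + v 0 0, p.1.2 + v 0 1, p.2 + v 0 2).

Lemma vec3_0 (p : R3) : vec3 p 0 0 = p.1.1. Proof. by rewrite mxE. Qed.
Lemma vec3_1 (p : R3) : vec3 p 0 1 = p.1.2. Proof. by rewrite mxE. Qed.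
Lemma vec3_2 (p : R3) : vec3 p 0 2 = p.2. Proof. by rewrite mxE. Qed.

Lemma vec3_shift v p : vec3 (shift3 v p) = vec3 p + v.
Proof.
apply/rowP => j; rewrite [RHS]mxE; move: j; apply: ord3P.
- by rewrite !vec3_0.
- by rewrite !vec3_1.
- by rewrite !vec3_2.
Qed.

Lemma leb2_sigma_finite : sigma_finite setT (leb \x leb)%E.
Proof.
have /sigma_finiteP[F [TF ndF Foo]] := sigma_finiteT leb.
exists (fun n => F n `*` F n).
  rewrite -setXTT TF predeqE => -[x y]; split.
    move=> [/= [n _ Fnx] [k _ Gky]]; exists (maxn n k) => //; split.
    - by move: x Fnx; exact/subsetPset/ndF/leq_maxl.
    - by move: y Gky; exact/subsetPset/ndF/leq_maxr.
  by move=> [n _ []/= ? ?]; split; exists n.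
move=> k; have [? ?] := Foo k; split; first exact: measurableX.
by rewrite product_measure1E// lte_mul_pinfty// ge0_fin_numE.
Qed.

(* The library only registers products of finite measures as sigma-finite. *)
Definition leb2 : {sigma_finite_measure set (mR * mR)%type -> \bar R} :=
  HB.pack_for {sigma_finite_measure set (mR * mR)%type -> \bar R} (leb \x leb)%E
    (Measure_isSigmaFinite.Build _ _ _ (leb \x leb)%E leb2_sigma_finite).

Lemma leb3_shift v : preserves leb3 (shift3 v).
Proof.
have H : preserves leb2 (fun p : mR * mR => (p.1 + v 0 0 : mR, p.2 + v 0 1 : mR)).
  exact: (preserves_prod (leb_shift _) (leb_shift _)).
exact: (@preserves_prod _ _ _ _ leb2 leb _ _ H (leb_shift _)).
Qed.

Definition vec3i (x : 'rV[R]_3) : R3 := (x 0 0, x 0 1, x 0 2).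
Lemma vec3K : cancel (@vec3 R) vec3i.
Proof. by move=> [[a b] c]; rewrite /vec3i vec3_0 vec3_1 vec3_2. Qed.
Lemma vec3iK : cancel vec3i (@vec3 R).
Proof.
by move=> x; apply/rowP; apply: ord3P; rewrite ?vec3_0 ?vec3_1 ?vec3_2.
Qed.

Definition box3 (c : 'rV[R]_3) (e : R) : set R3 :=
  (`]c 0 0 - e, c 0 0 + e[ `*` `]c 0 1 - e, c 0 1 + e[) `*` `]c 0 2 - e, c 0 2 + e[.

Lemma measurable_box3 c e : measurable (box3 c e).
Proof. by do 2 (apply: measurableX => //). Qed.

Lemma box3P c e (p : R3) : box3 c e p <-> forall j, `|c 0 j - vec3 p 0 j| < e.
Proof.
have E (a b : R) : `|a - b| < e <-> b \in `]a - e, a + e[.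
  by rewrite distrC in_itv /= ltr_distl.
split=> [[[/= h0 h1] h2]|H].
  by apply: ord3P; rewrite ?vec3_0 ?vec3_1 ?vec3_2; apply/E.
by split; [split|]; apply/E; [rewrite -vec3_0|rewrite -vec3_1|rewrite -vec3_2].
Qed.

Lemma box3_measure c e : 0 < e -> leb3 (box3 c e) = ((2 * e) ^+ 3)%:E.
Proof.
move=> e0; rewrite /box3 /leb3.
have E a : leb `]a - e, a + e[%classic = (2 * e)%:E.
  rewrite lebesgue_measure_itv /= lte_fin ltrBlDr -addrA ltrDl addr_gt0 //.
  by rewrite -EFinB; congr (_%:E); ring.
transitivity ((2 * e)%:E * (2 * e)%:E * (2 * e)%:E)%E; last first.
  by rewrite -!EFinM; congr (_%:E); ring.
rewrite product_measure1E //; last exact: measurableX.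
congr (_ * _)%E; last exact: E.
apply: eq_trans (@product_measure1E _ _ _ _ _ leb leb _ _ _ _) _ => //.
by congr (_ * _)%E; exact: E.
Qed.

Lemma open_box (A : set 'rV[R]_3) x : open A -> A x ->
  exists2 e : R, 0 < e & forall y : 'rV[R]_3, (forall j, `|x 0 j - y 0 j| < e) -> A y.
Proof.
move=> oA Ax; have : nbhs x A by apply: open_nbhs_nbhs.
move/nbhs_ballP => [e /= e0 eA]; exists e => // y H; apply: eA; split => // i j.
by rewrite (ord1 i); exact: H.
Qed.

(** An open set is the union of the countably many rational boxes it contains; this links the
    topology of row vectors to the product sigma-algebra. *)
Lemma measurable_open_vec3 (A : set 'rV[R]_3) : open A -> measurable (@vec3 R @^-1` A).
Proof.
move=> oA.
pose D : set (rat * rat * rat * nat) := [set q | box3 (\row_j [:: ratr q.1.1.1; ratr q.1.1.2; ratr q.1.2]`_j) (q.2.+1%:R^-1) `<=` @vec3 R @^-1` A].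
pose F (q : rat * rat * rat * nat) := if `[< D q >] then
  box3 (\row_j [:: ratr q.1.1.1; ratr q.1.1.2; ratr q.1.2]`_j) (q.2.+1%:R^-1) else set0.
suff -> : @vec3 R @^-1` A = \bigcup_q F q.
  apply: countable_bigcupT_measurable => [|q]; first exact: countableP.
  by rewrite /F; case: asboolP => // _; exact: measurable_box3.
apply/seteqP; split => [p Ap|p [q _]]; last first.
  by rewrite /F; case: asboolP => // Dq /Dq.
have [e e0 eA] := open_box oA Ap.
have [n ne] : exists n : nat, (n.+1%:R^-1 : R) < e / 2.
  have [n _ /(_ n (leqnn n)) H] := near_infty_natSinv_lt (PosNum (divr_gt0 e0 (ltr0Sn R 1))).
  by exists n.
have ra j : exists q : rat, `|vec3 p 0 j - ratr q| < (n.+1%:R^-1 : R).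
  have : vec3 p 0 j - n.+1%:R^-1 < vec3 p 0 j + n.+1%:R^-1.
    by rewrite ltrBlDr -addrA ltrDl addr_gt0 // invr_gt0 ltr0n.
  move=> /rat_in_itvoo[q]; rewrite in_itv /= => /andP[q1 q2]; exists q.
  by rewrite distrC ltr_distl q1 q2.
have [q0 h0] := ra 0; have [q1 h1] := ra 1; have [q2 h2] := ra 2.
have B : box3 (\row_j [:: ratr q0; ratr q1; ratr q2]`_j) (n.+1%:R^-1) p.
  by apply/box3P; apply: ord3P; rewrite mxE /= distrC.
exists (q0, q1, q2, n) => //; rewrite /F; case: asboolP => // -[] y /= /box3P yB.
apply: eA => j; move/box3P : B => /(_ j); move: (yB j).
set a := \row_j0 _; move=> H1 H2.
rewrite -(subrK (a 0 j) (vec3 p 0 j)) -addrA.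
apply: le_lt_trans (ler_normD _ _) _; rewrite [e]splitr; apply: ltrD.
  by rewrite distrC; exact: lt_trans ne.
exact: lt_trans ne.
Qed.

Lemma continuous_measurable_vec3 (f : 'rV[R]_3 -> R) : continuous f ->
  measurable_fun setT (f \o @vec3 R).
Proof.
move=> cf; apply: (measurability _ (RGenOpens.measurableE R)).
move=> _ [_ [a [b ->] <-]]; rewrite setTI comp_preimage.
by apply: measurable_open_vec3; move/continuousP : cf; apply; exact: interval_open.
Qed.

Definition plane (n : 'rV[R]_3) c : set R3 := [set p | \sum_j n 0 j * vec3 p 0 j = c].

End Measure.

(** * Integrals over the whole space: linearity, dominated convergence, translation *)

Section Integral.
Context {R : realType}.
Local Notation mR := (measurableTypeR R).
Local Notation R3 := (mR * mR * mR)%type.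
Implicit Types (f g : 'rV[R]_3 -> R).

Definition mf3 f := measurable_fun setT (f \o @vec3 R : R3 -> R).
Definition integ f := leb3.-integrable setT (EFin \o (f \o @vec3 R)).
Definition I3 f : R := Rintegral leb3 setT (f \o @vec3 R).

Lemma integ_mf f : integ f -> mf3 f.
Proof. by move=> /integrableP[/measurable_EFinP]. Qed.

Lemma integD f g : integ f -> integ g -> integ (fun x => f x + g x).
Proof.
move=> fi gi; apply: (eq_integrable measurableT _ _ _ (integrableD measurableT fi gi)).
by move=> x _ /=; rewrite EFinD.
Qed.

Lemma I3D f g : integ f -> integ g -> I3 (fun x => f x + g x) = I3 f + I3 g.
Proof. by move=> fi gi; rewrite /I3 -RintegralD. Qed.

Lemma integZ c f : integ f -> integ (fun x => c * f x).
Proof.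
move=> fi; apply: (eq_integrable measurableT _ _ _ (integrableZl measurableT c fi)).
by move=> x _ /=; rewrite EFinM.
Qed.

Lemma I3Z c f : integ f -> I3 (fun x => c * f x) = c * I3 f.
Proof. by move=> fi; rewrite /I3 -RintegralZl. Qed.

Lemma integ_sum (J : Type) (s : seq J) (F : J -> 'rV[R]_3 -> R) :
  (forall j, integ (F j)) -> integ (fun x => \sum_(j <- s) F j x).
Proof.
move=> H; elim: s => [|j s IH].
  apply: (eq_integrable measurableT _ _ _ (integrable0 leb3 setT)).
  by move=> x _ /=; rewrite big_nil.
apply: (eq_integrable measurableT _ _ _ (integD (H j) IH)).
by move=> x _ /=; rewrite big_cons.
Qed.

Lemma I3_sum (J : Type) (s : seq J) (F : J -> 'rV[R]_3 -> R) :
  (forall j, integ (F j)) -> I3 (fun x => \sum_(j <- s) F j x) = \sum_(j <- s) I3 (F j).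
Proof.
move=> H; elim: s => [|j s IH].
  rewrite big_nil /I3 (@eq_Rintegral _ _ _ _ _ (fun=> 0)).
    by rewrite Rintegral_cst // mul0r.
  by move=> x _ /=; rewrite big_nil.
rewrite big_cons -IH -I3D //; last exact: integ_sum.
by congr I3; apply/funext => x; rewrite big_cons.
Qed.

Lemma I3_ae f g : mf3 f -> mf3 g -> {ae leb3, forall p, f (vec3 p) = g (vec3 p)} ->
  I3 f = I3 g.
Proof.
move=> mf mg fg; rewrite /I3 /Rintegral; congr fine.
apply: ae_eq_integral => //; try exact/measurable_EFinP.
by apply: filterS fg => p /= h _; rewrite h.
Qed.

Lemma integ_le f g : mf3 f -> integ g -> (forall x, `|f x| <= g x) -> integ f.
Proof.
move=> mf gi fg; apply: (le_integrable measurableT _ _ gi).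
  exact/measurable_EFinP.
by move=> x _ /=; rewrite lee_fin (le_trans (fg _)) // ler_norm.
Qed.

Definition cbox (c : 'rV[R]_3) K : set 'rV[R]_3 := [set x | forall j, `|c 0 j - x 0 j| < K].

Lemma cboxE c K : @vec3 R @^-1` cbox c K = box3 c K.
Proof. by apply/seteqP; split=> p /= /box3P. Qed.

Lemma cbox_integral c K : 0 < K ->
  (\int[leb3]_p (\1_(cbox c K) (vec3 p))%:E = ((2 * K) ^+ 3)%:E)%E.
Proof.
move=> K0; rewrite (eq_integral (fun p => (\1_(box3 c K) p)%:E)); last first.
  by move=> p _ /=; rewrite -cboxE !indicE.
rewrite integral_indic ?setIT //; last exact: measurable_box3.
exact: box3_measure.
Qed.

Lemma integ_cbox c K : integ (\1_(cbox c K)).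
Proof.
have [K0|K0] := leP K 0.
  apply: (eq_integrable measurableT _ _ _ (integrable0 leb3 setT)) => x _ /=.
  by rewrite indicE memNset // => /(_ 0); rewrite ltNge (le_trans K0).
apply/integrableP; split.
  apply/measurable_EFinP; have -> : \1_(cbox c K) \o @vec3 R = \1_(box3 c K) :> (R3 -> R).
    by rewrite -cboxE; apply/funext => p /=; rewrite !indicE.
  by apply: measurable_indic; exact: measurable_box3.
rewrite (eq_integral (fun p => (\1_(cbox c K) (vec3 p))%:E)); last first.
  by move=> p _ /=; rewrite ger0_norm.
by rewrite cbox_integral // ltry.
Qed.

Lemma I3_cbox c K : 0 < K -> I3 (\1_(cbox c K)) = (2 * K) ^+ 3.
Proof. by move=> K0; rewrite /I3 /Rintegral /= cbox_integral. Qed.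

Definition bbox K (x : 'rV[R]_3) := forall j, `|x 0 j| < K.

Lemma integ_box K : integ (\1_[set x | bbox K x]).
Proof.
suff -> : [set x | bbox K x] = cbox 0 K by exact: integ_cbox.
by apply/seteqP; split=> x /= h j; have := h j; rewrite mxE sub0r normrN.
Qed.

Definition nice f := [/\ mf3 f, exists C, forall x, `|f x| <= C &
  exists K, forall x, ~ bbox K x -> f x = 0].

Lemma nice_integ f : nice f -> integ f.
Proof.
move=> [mf [C fC] [K fK]]; apply: (integ_le mf (integZ C (integ_box K))) => x.
rewrite indicE; have [Kx|/fK ->] := pselect (bbox K x).
  by rewrite mem_set // mulr1.
rewrite normr0 mulr_ge0 //; exact: le_trans (fC 0).
Qed.

Lemma dct (f_ : nat -> 'rV[R]_3 -> R) f g : (forall n, mf3 (f_ n)) -> mf3 f ->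
    {ae leb3, forall p, f_ n (vec3 p) @[n --> \oo] --> f (vec3 p)} ->
    integ g -> (forall n x, `|f_ n x| <= g x) ->
  I3 (f_ n) @[n --> \oo] --> I3 f.
Proof.
move=> mfn mf cv gi fg.
have [] := @dominated_convergence _ R3 R leb3 setT measurableT
  (fun n => EFin \o (f_ n \o @vec3 R)) (EFin \o (f \o @vec3 R)) (EFin \o (g \o @vec3 R)) _ _ _ gi _.
- by move=> n; apply/measurable_EFinP; exact: mfn.
- exact/measurable_EFinP.
- apply: filterS cv => p cvp _; apply: cvg_EFin; [exact: nearW|exact: cvp].
- by apply: aeW => p n _ /=; rewrite lee_fin.
move=> fi _ cI; rewrite /I3 /Rintegral.
apply: fine_cvg; rewrite fineK //; apply: integrable_fin_num => //.
Qed.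

Lemma I3_shift v f : integ f -> I3 (fun x => f (x + v)) = I3 f.
Proof.
move=> fi; have mf := integ_mf fi; have [ms sE] := leb3_shift v.
have E : (fun x => f (x + v)) \o @vec3 R = (f \o @vec3 R) \o shift3 v.
  by apply/funext => p /=; rewrite vec3_shift.
rewrite /I3 /Rintegral E; congr fine.
pose m' := measure_function_pushforward__canonical__measure_function_Measure
  (leb3 : {measure set R3 -> \bar R}) ms.
have mE A : measurable A -> A `<=` setT -> leb3 A = m' A.
  by move=> mA _; apply/esym; exact: sE.
have fi' : leb3.-integrable (shift3 v @^-1` setT) ((EFin \o (f \o @vec3 R)) \o shift3 v).
  have mfs : measurable_fun setT ((f \o @vec3 R) \o shift3 v).
    by apply: measurableT_comp => //; exact: mf.
  apply/integrableP; split; first exact/measurable_EFinP.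
  move/integrableP : fi => [_]; apply: le_lt_trans.
  rewrite le_eqVlt; apply/orP; left; apply/eqP.
  apply: etrans; last by apply/esym; exact: (eq_measure_integral m' mE).
  apply/esym.
  apply: (@ge0_integral_pushforward _ _ _ _ R (shift3 v) ms leb3 setT
    (fun p => `|(EFin \o (f \o @vec3 R)) p|%E)) => //.
  by apply: measurableT_comp => //; exact/measurable_EFinP.
apply: etrans; last by apply/esym; exact: (eq_measure_integral m' mE).
apply/esym; apply: (@integral_pushforward _ _ _ _ R (shift3 v) ms leb3 setT
  (EFin \o (f \o @vec3 R)) _ fi' measurableT).
exact/measurable_EFinP.
Qed.
End Integral.

(** * Null planes, and vanishing of the integral of a derivative *)

Section Integral2.
Context {R : realType}.
Local Notation mR := (measurableTypeR R).
Local Notation R3 := (mR * mR * mR)%type.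
Implicit Types (f g : 'rV[R]_3 -> R).

Lemma mf3_cont f : continuous f -> mf3 f.
Proof. exact: continuous_measurable_vec3. Qed.

Lemma dotp_continuous (n : 'rV[R]_3) : continuous (dotp n : 'rV[R]_3 -> R).
Proof.
have -> : dotp n = fun x : 'rV[R]_3 => n 0 0 * x 0 0 + n 0 1 * x 0 1 + n 0 2 * x 0 2.
  by apply/funext => x; rewrite /dotp sum3.
have H j : continuous (fun x : 'rV[R]_3 => n 0 j * x 0 j).
  by move=> x; apply: continuousM; [exact: cst_continuous|exact: coord_continuous].
by move=> x; exact: (cvgD (cvgD (H 0 x) (H 1 x)) (H 2 x)).
Qed.

Lemma plane_measurable (n : 'rV[R]_3) c :
  measurable (@vec3 R @^-1` [set x | dotp n x = c]).
Proof.
rewrite -[X in measurable X]setTI.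
exact: (mf3_cont (@dotp_continuous n)) measurableT _ (measurable_set1 c).
Qed.

(** The translates by [v / (i + 1)] are pairwise disjoint, have equal measure and stay in one
    bounded box, so their common measure is zero. *)
Lemma plane_box_null (n v : 'rV[R]_3) c K : dotp n v = 1 ->
  leb3 (@vec3 R @^-1` [set x | dotp n x = c] `&` box3 0 K) = 0%E.
Proof.
move=> nv; set P := _ `&` _.
have mP : measurable P.
  by apply: measurableI; [exact: plane_measurable|exact: measurable_box3].
have [C vC] : exists C, forall j, `|v 0 j| <= C.
  exists (\sum_j `|v 0 j|) => j; rewrite (bigD1 j) //= lerDl.
  by apply: sumr_ge0.
have C0 : 0 <= C := le_trans (normr_ge0 _) (vC 0).
pose L := Num.max 1 K + C; have L0 : 0 < L.
  by rewrite ltr_wpDr // lt_max ltr01.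
pose S (i : nat) := shift3 ((i.+1%:R^-1 : R) *: v) @^-1` P.
have mS i : measurable (S i).
  by rewrite -[X in measurable X]setTI; have [m _] := leb3_shift ((i.+1%:R^-1 : R) *: v); exact: m.
have SE i : leb3 (S i) = leb3 P by have [_ ->] := leb3_shift ((i.+1%:R^-1 : R) *: v).
have SL i : S i `<=` box3 0 L.
  move=> p [_ /box3P]; rewrite vec3_shift => H; apply/box3P => j; have := H j.
  have z : (0 : 'rV[R]_3) 0 j = 0 by rewrite mxE.
  rewrite !z !sub0r !normrN => {}H.
  have E : vec3 p 0 j = (vec3 p + i.+1%:R^-1 *: v) 0 j - i.+1%:R^-1 * v 0 j.
    by rewrite [in RHS]mxE [X in _ + X - _]mxE addrK.
  rewrite E.
  apply: le_lt_trans (ler_normB _ _) _; apply: ltr_leD.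
    by apply: (lt_le_trans H); rewrite le_max lexx orbT.
  rewrite normrM ger0_norm ?invr_ge0 //; apply: le_trans (vC j).
  by rewrite ler_piMl // invf_le1 // ler1n.
have dS : trivIset setT S.
  apply/trivIsetP => i j _ _ ij; apply/seteqP; split => // p [[h1 _] [h2 _]].
  move: h1 h2; rewrite /= !vec3_shift !dotpDr !dotpZr nv !mulr1 => {1}<- /addrI.
  move/invr_inj/eqP; rewrite eqr_nat eqSS => /eqP ji; move/eqP: ij; apply.
  by rewrite ji.
have Pfin : leb3 P \is a fin_num.
  rewrite ge0_fin_numE // -(SE 0%N); apply: (@le_lt_trans _ _ (leb3 (box3 0 L))).
    by apply: le_measure; rewrite ?inE //; exact: measurable_box3.
  by rewrite box3_measure // ltry.
have key N : N%:R * fine (leb3 P) <= (2 * L) ^+ 3.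
  rewrite -lee_fin EFinM fineK // -(box3_measure 0 L0).
  have -> : (N%:R%:E * leb3 P = leb3 (\big[setU/set0]_(i < N) S i))%E.
    apply: etrans (esym (measure_bigsetU leb3 mS dS N)).
    rewrite (eq_bigr (fun=> leb3 P)); last by move=> i _; exact: SE.
    by rewrite -(fineK Pfin) sumEFin sumr_const card_ord -EFinM mulr_natl.
  apply: le_measure; rewrite ?inE; [|exact: measurable_box3|].
    by apply: bigsetU_measurable => i _.
  by move=> p; rewrite -bigcup_mkord => -[i _ /SL].
rewrite -(fineK Pfin); congr (_%:E); apply/eqP; rewrite eq_le fine_ge0 // andbT leNgt.
apply/negP => a0; have := archi_boundP (ltW (divr_gt0 (exprn_gt0 3 (mulr_gt0 (ltr0Sn R 1) L0)) a0)).
by rewrite ltr_pdivrMr // ltNge key.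
Qed.

Lemma plane_null (n v : 'rV[R]_3) c : dotp n v = 1 ->
  {ae leb3, forall p, dotp n (vec3 p) <> c}.
Proof.
move=> nv; apply: (@negligibleS _ _ _ _ (\bigcup_K (@vec3 R @^-1` [set x | dotp n x = c] `&` box3 0 K%:R))).
  move=> p /= /contrapT pc.
  exists (Num.bound (\sum_j `|vec3 p 0 j|)) => //; split => //.
  apply/box3P => j; rewrite mxE sub0r normrN.
  apply: le_lt_trans (archi_boundP _); last exact: sumr_ge0.
  by rewrite (bigD1 j) //= lerDl sumr_ge0.
apply: negligible_bigcup => K; exists (@vec3 R @^-1` [set x | dotp n x = c] `&` box3 0 K%:R).
split => //; last exact: (plane_box_null _ _ nv).
by apply: measurableI; [exact: plane_measurable|exact: measurable_box3].
Qed.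

Lemma I3_gt0 f x e c : integ f -> (forall y, 0 <= f y) -> 0 < e -> 0 < c ->
  (forall y, cbox x e y -> c <= f y) -> 0 < I3 f.
Proof.
move=> fi f0 e0 c0 fc.
have E y : f y = c * \1_(cbox x e) y + (f y + - c * \1_(cbox x e) y) by ring.
rewrite (_ : f = fun y => c * \1_(cbox x e) y + (f y + - c * \1_(cbox x e) y)); last by apply/funext => y; exact: E.
have bi := integ_cbox x e.
rewrite (I3D (integZ c bi) (integD fi (integZ (- c) bi))) (I3Z c bi) I3_cbox //.
apply: ltr_pwDl; first by rewrite mulr_gt0 // exprn_gt0 // mulr_gt0.
apply: Rintegral_ge0 => p _ /=; rewrite indicE mulNr subr_ge0.
have [h|h] := pselect (cbox x e (vec3 p)); last by rewrite memNset // mulr0.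
by rewrite mem_set // mulr1; exact: fc.
Qed.

Definition edir (k : 'I_3) : 'rV[R]_3 := delta_mx 0 k.

(** By translation invariance every difference quotient of [F] has integral zero; the Lipschitz
    bound and the bounded support dominate the quotients, so the limit has integral zero as well. *)
Lemma int_deriv0 (k : 'I_3) F F' K L : mf3 F' -> nice F ->
    (forall x, ~ bbox K x -> F x = 0) -> 0 <= L ->
    (forall x h, `|h| <= 1 -> `|F (x + h *: edir k) - F x| <= L * `|h|) ->
    {ae leb3, forall p, (fun n => n.+1%:R * (F (vec3 p + n.+1%:R^-1 *: edir k) - F (vec3 p)))
       @ \oo --> F' (vec3 p)} ->
  I3 F' = 0.
Proof.
move=> mF' nF FK L0 FL cv.
have Fi := nice_integ nF; have [mF _ _] := nF.
pose q n x := n.+1%:R * (F (x + n.+1%:R^-1 *: edir k) - F x).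
have mFs v : mf3 (fun x => F (x + v)).
  have [ms _] := leb3_shift v.
  have -> : mf3 (fun x => F (x + v)) = measurable_fun setT ((F \o @vec3 R) \o shift3 v).
    by rewrite /mf3; congr measurable_fun; apply/funext => p /=; rewrite vec3_shift.
  by apply: measurableT_comp.
have iFs v : integ (fun x => F (x + v)).
  have [_ [C FC] _] := nF; apply: nice_integ; split => //; first by exists C.
  exists (K + \sum_j `|v 0 j|) => x nx; apply: FK => h; apply: nx => j.
  have -> : x 0 j = (x + v) 0 j - v 0 j by rewrite mxE addrK.
  apply: le_lt_trans (ler_normB _ _) _; apply: ltr_leD; first exact: h.
  by rewrite (bigD1 j) //= lerDl sumr_ge0.
have qE n : q n = (fun x => n.+1%:R * (F (x + n.+1%:R^-1 *: edir k) + -1 * F x)).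
  by apply/funext => x; rewrite mulN1r.
have q0 n : I3 (q n) = 0.
  rewrite qE (I3Z _ (integD (iFs _) (integZ (-1) Fi))) (I3D (iFs _) (integZ (-1) Fi)).
  by rewrite (I3Z _ Fi) I3_shift // mulN1r subrr mulr0.
have bi := integZ L (integ_box (K + 1)).
have qb n x : `|q n x| <= L * \1_[set x | bbox (K + 1) x] x.
  have n0 : 0 <= (n.+1%:R^-1 : R) by rewrite invr_ge0.
  have n1 : (n.+1%:R^-1 : R) <= 1 by rewrite invf_le1 // ler1n.
  rewrite indicE; have [h|h] := pselect (bbox (K + 1) x).
    rewrite mem_set // mulr1 /q normrM ger0_norm // -ler_pdivlMl ?ltr0Sn // mulrC.
    by apply: le_trans (FL _ _ _) _; rewrite ger0_norm.
  rewrite memNset // mulr0 /q !FK ?subrr ?mulr0 ?normr0 // => {}h'; apply: h => j.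
    by apply: lt_le_trans (h' j) _; rewrite lerDl.
  have -> : x 0 j = (x + n.+1%:R^-1 *: edir k) 0 j - n.+1%:R^-1 * edir k 0 j.
    by rewrite [in RHS]mxE [X in _ + X - _]mxE addrK.
  apply: le_lt_trans (ler_normB _ _) _; apply: ltr_leD; first exact: h'.
  rewrite normrM ger0_norm // mxE eqxx /=.
  by case: eqP => _; rewrite ?normr1 ?normr0 ?mulr1 ?mulr0.
have mq n : mf3 (q n) by apply: integ_mf; rewrite qE; apply/integZ/integD => //; exact: integZ.
have cvI := dct mq mF' cv bi qb.
have E : (fun n => I3 (q n)) = fun=> 0 by apply/funext => n; exact: q0.
move: cvI; rewrite E => cvI.
by apply: (cvg_unique _ cvI (cvg_cst 0)).
Qed.

End Integral2.

(** * Mean value theorem along coordinate directions and symmetry of second derivatives *)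

Section Smooth.
Context {R : realType}.
Implicit Types (f g : 'rV[R]_3 -> R) (x y v : 'rV[R]_3).

Lemma line_is_derive f y v (s : R) : derivable f (y + s *: v) v ->
  is_derive s 1 (fun t => f (y + t *: v)) ('D_v f (y + s *: v)).
Proof.
move=> df.
have E : (fun h => h^-1 *: (((fun t => f (y + t *: v)) \o shift s) (h *: (1 : R)) - f (y + s *: v)))
   = (fun h => h^-1 *: ((f \o shift (y + s *: v)) (h *: v) - f (y + s *: v))).
  apply/funext => h /=; congr (_ *: (f _ - _)).
  by rewrite [h *: 1]mulr1 scalerDl addrCA addrA.
by split; rewrite /derivable /derive E.
Qed.

Lemma mvt_dir f x k (h : R) : (forall y, differentiable f y) -> 0 <= h ->
  exists2 c, 0 <= c <= h & f (x + h *: edir k) - f x = h * pderiv k f (x + c *: edir k).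
Proof.
move=> df h0.
have D (s : R) : is_derive s 1 (fun t => f (x + t *: edir k)) (pderiv k f (x + s *: edir k)).
  by apply: line_is_derive; exact: diff_derivable.
have [|c] := MVT_segment h0 (fun s _ => D s).
  apply: continuous_subspaceT => s.
  apply: differentiable_continuous; apply/derivable1_diffP.
  by have [] := D s.
rewrite scale0r addr0 subr0 in_itv /= mulrC => ch ->; exists c => //.
Qed.

Lemma lip_dir f k C : (forall y, differentiable f y) -> (forall y, `|pderiv k f y| <= C) ->
  forall x h, `|f (x + h *: edir k) - f x| <= C * `|h|.
Proof.
move=> df fC; have P x h : 0 <= h -> `|f (x + h *: edir k) - f x| <= C * `|h|.
  move=> h0; have [c _ ->] := mvt_dir x k df h0.
  by rewrite normrM mulrC ler_wpM2r.
move=> x h; have [|h0] := leP 0 h; first exact: P.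
have := P (x + h *: edir k) (- h); rewrite oppr_ge0 normrN => /(_ (ltW h0)).
by rewrite scaleNr addrK distrC.
Qed.

Lemma second_difference f x i j (h : R) : (forall y, differentiable f y) ->
    (forall y, differentiable (pderiv i f) y) -> 0 <= h ->
  exists a b, [/\ 0 <= a <= h, 0 <= b <= h &
    f (x + h *: edir i + h *: edir j) - f (x + h *: edir i) - f (x + h *: edir j) + f x =
    h ^+ 2 * pderiv j (pderiv i f) (x + a *: edir i + b *: edir j)].
Proof.
move=> df ddf h0.
pose u (s : R) := f (x + h *: edir j + s *: edir i) - f (x + s *: edir i).
have D (s : R) : is_derive s 1 u (pderiv i f (x + h *: edir j + s *: edir i) - pderiv i f (x + s *: edir i)).
  have D1 : is_derive s 1 (fun t => f (x + h *: edir j + t *: edir i)) (pderiv i f (x + h *: edir j + s *: edir i)).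
    by apply: line_is_derive; exact: diff_derivable.
  have D2 : is_derive s 1 (fun t => f (x + t *: edir i)) (pderiv i f (x + s *: edir i)).
    by apply: line_is_derive; exact: diff_derivable.
  exact: (is_deriveB D1 D2).
have [|a] := MVT_segment h0 (fun s _ => D s).
  apply: continuous_subspaceT => s.
  apply: differentiable_continuous; apply/derivable1_diffP.
  by have [] := D s.
rewrite in_itv /= subr0 => ah uE.
have [b bh bE] := mvt_dir (x + a *: edir i) j ddf h0.
exists a, b; split => //.
move: uE; rewrite /u !scale0r !addr0 [x + h *: edir j + a *: _]addrAC bE mulrC mulrA -expr2 => <-.
rewrite [x + h *: edir j + h *: _]addrAC; ring.
Qed.

Lemma norm_half_absurd (u v w : R) :
  `|u - w| < `|u - v| / 2 -> `|v - w| < `|u - v| / 2 -> False.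
Proof.
move=> uw vw; have : `|u - v| < `|u - v|; last by rewrite ltxx.
rewrite {2}[`|u - v|]splitr -{1}(subrK w u) -addrA.
by apply: le_lt_trans (ler_normD _ _) _; apply: ltrD => //; rewrite distrC.
Qed.

(** The second difference over a square of side [h] equals [h^2] times each mixed derivative at some
    point of the square; by continuity the two values at [x] cannot differ. *)
Lemma schwarz f i j x : (forall y, differentiable f y) ->
    (forall k y, differentiable (pderiv k f) y) ->
    (forall y, differentiable (pderiv j (pderiv i f)) y) ->
    (forall y, differentiable (pderiv i (pderiv j f)) y) ->
  pderiv j (pderiv i f) x = pderiv i (pderiv j f) x.
Proof.
move=> df ddf dij dji.
apply/eqP; rewrite -subr_eq0 -normr_eq0 eq_le normr_ge0 andbT leNgt; apply/negP.
set A := pderiv j _ x; set B := pderiv i _ x => AB.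
have e0 : 0 < `|A - B| / 2 by rewrite divr_gt0.
have near (F : 'rV[R]_3 -> R) : (forall y, differentiable F y) -> exists2 d : R, 0 < d &
    forall y : 'rV[R]_3, (forall m, `|x 0 m - y 0 m| < d) -> `|F x - F y| < `|A - B| / 2.
  move=> dF; have cF : continuous F by move=> y; exact: differentiable_continuous.
  have [||d d0 H] := @open_box R (F @^-1` ball (F x) (`|A - B| / 2)) x.
  - by move/continuousP : cF; apply; exact: ball_open.
  - exact: ballxx.
  - by exists d.
have [d1 d10 H1] := near _ dij; have [d2 d20 H2] := near _ dji.
(* Points of the square are within [2 h] of [x] in each coordinate, hence strictly within the radius
   of continuity. *)
pose h := Num.min d1 d2 / 3.
have h0 : 0 < h by rewrite divr_gt0 // lt_min d10 d20.
have [a [b [ah bh E1]]] := second_difference x j df (ddf i) (ltW h0).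
have [a' [b' [ah' bh' E2]]] := second_difference x i df (ddf j) (ltW h0).
have close (p q : R) k l : 0 <= p <= h -> 0 <= q <= h ->
    forall m, `|x 0 m - (x + p *: edir k + q *: edir l) 0 m| < Num.min d1 d2.
  move=> /andP[p0 ph] /andP[q0 qh] m.
  have -> : x 0 m - (x + p *: edir k + q *: edir l) 0 m = - (p * (m == k)%:R + q * (m == l)%:R).
    by rewrite !mxE eqxx /=; ring.
  have h3 : h + h + h = Num.min d1 d2 by rewrite /h; field.
  rewrite normrN; apply: (@le_lt_trans _ _ (h + h)); last by rewrite -h3 ltrDl.
  apply: le_trans (ler_normD _ _) _; apply: lerD; rewrite normrM ger0_norm //;
    by case: (m == _); rewrite ?normr1 ?normr0 ?mulr1 ?mulr0 // ltW.
have hh : h ^+ 2 != 0 by rewrite expf_neq0 // gt_eqF.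
have EE : pderiv j (pderiv i f) (x + a *: edir i + b *: edir j) =
          pderiv i (pderiv j f) (x + a' *: edir j + b' *: edir i).
  apply: (mulfI hh); rewrite -[LHS]E1 -[RHS]E2 (addrAC x (h *: edir j)).
  by congr (_ + _); rewrite [LHS]addrAC.
have m1 : Num.min d1 d2 <= d1 by rewrite ge_min lexx.
have m2 : Num.min d1 d2 <= d2 by rewrite ge_min lexx orbT.
have F1 := H1 (x + a *: edir i + b *: edir j) (fun m => lt_le_trans (close _ _ _ _ ah bh m) m1).
have F2 := H2 (x + a' *: edir j + b' *: edir i) (fun m => lt_le_trans (close _ _ _ _ ah' bh' m) m2).
rewrite -EE in F2; exact: (norm_half_absurd F1 F2).
Qed.
End Smooth.

(** * Smooth functions: products, polynomials, and the flat function exp(-1/t) *)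

Section Cinf.
Context {R : realType}.
Local Notation pl := (pl R).
Implicit Types (f g : 'rV[R]_3 -> R) (x y v : 'rV[R]_3) (p q : pl).

(** Finite stages of [Cinfty]: they are peeled from the innermost derivative, which permits
    induction for products and compositions. *)
Fixpoint Cn n f : Prop := (forall x, differentiable f x) /\
  if n is m.+1 then forall j, Cn m (pderiv j f) else True.

Lemma Cinfty_pderiv j f : Cinfty f -> Cinfty (pderiv j f).
Proof.
by move=> h s x; have := h (rcons s j) x; rewrite foldr_rcons.
Qed.

Lemma CinftyP f : Cinfty f <-> forall n, Cn n f.
Proof.
split=> [h n|h s].
  elim: n f h => [|n IH] f h; split=> //; try exact: (h [::]).
  by move=> j; exact/IH/Cinfty_pderiv.
have {h} := h (size s); elim/last_ind: s f => [|s j IH] f; first by move=> /= -[H _ x]; exact: H.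
by rewrite size_rcons foldr_rcons => -[_ h]; exact: IH (h j).
Qed.

Lemma Cinfty_diff f : Cinfty f -> forall x, differentiable f x.
Proof. by move=> h; exact: (h [::]). Qed.
Lemma Cinfty_derivable f : Cinfty f -> forall x v, derivable f x v.
Proof. by move=> h x v; apply: diff_derivable; exact: Cinfty_diff. Qed.
Lemma Cinfty_cont f : Cinfty f -> continuous f.
Proof. by move=> h x; apply: differentiable_continuous; exact: Cinfty_diff. Qed.

Lemma Cinfty_schwarz f i j : Cinfty f -> pderiv j (pderiv i f) = pderiv i (pderiv j f).
Proof.
move=> h; apply/funext => x; apply: schwarz => *; apply: Cinfty_diff => //;
  by do ?apply: Cinfty_pderiv.
Qed.

Lemma pderivD f g j : (forall x, differentiable f x) -> (forall x, differentiable g x) ->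
  pderiv j (fun x => f x + g x) = fun x => pderiv j f x + pderiv j g x.
Proof.
by move=> df dg; apply/funext => x; apply: deriveD; exact: diff_derivable.
Qed.

Lemma pderivM f g j : (forall x, differentiable f x) -> (forall x, differentiable g x) ->
  pderiv j (fun x => f x * g x) = fun x => pderiv j f x * g x + f x * pderiv j g x.
Proof.
move=> df dg; apply/funext => x.
rewrite [LHS]deriveM; [|exact: diff_derivable|exact: diff_derivable].
by rewrite addrC; congr (_ + _); rewrite [LHS]mulrC.
Qed.

Lemma Cn_diff n f : Cn n f -> forall x, differentiable f x.
Proof. by case: n => [|n] []. Qed.

Lemma CnW n f : Cn n.+1 f -> Cn n f.
Proof. by elim: n f => [|n IH] f [h1 h2]; split => // j; exact/IH/h2. Qed.

Lemma CnD n f g : Cn n f -> Cn n g -> Cn n (fun x => f x + g x).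
Proof.
elim: n f g => [|n IH] f g [df hf] [dg hg]; split=> //; try by move=> x; exact: differentiableD.
by move=> j; rewrite pderivD //; exact: IH (hf j) (hg j).
Qed.

Lemma CnM n f g : Cn n f -> Cn n g -> Cn n (fun x => f x * g x).
Proof.
elim: n f g => [|n IH] f g hf hg; have [df hf'] := hf; have [dg hg'] := hg;
  split=> //; try by move=> x; exact: differentiableM.
by move=> j; rewrite pderivM //; apply: CnD; [exact: IH (hf' j) (CnW hg)|exact: IH (CnW hf) (hg' j)].
Qed.

Lemma CinftyM f g : Cinfty f -> Cinfty g -> Cinfty (fun x => f x * g x).
Proof. by move=> /CinftyP hf /CinftyP hg; apply/CinftyP => n; exact: CnM. Qed.

Definition evf p : 'rV[R]_3 -> R := ev^~ p.

Lemma evf_diff p : (forall x, differentiable (evf p) x) /\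
  forall j, pderiv j (evf p) = evf (pd j p).
Proof.
have [n] : exists n, msz p n by exists (mpoly.msize p).
move: n p; apply: (pl_ind (o := fun=> 0)) => /=.
- move=> _; have -> : evf 0 = fun=> 0 by apply/funext => x; exact: ev0.
  split=> [x|j]; first exact: differentiable_cst.
  by apply/funext => x; rewrite pd0 /evf ev0; exact: derive_cst.
- move=> _ c; have -> : evf (cst c) = fun=> c by apply/funext => x; exact: evC.
  split=> [x|j]; first exact: differentiable_cst.
  by apply/funext => x; rewrite pdC /evf ev0; exact: derive_cst.
- move=> _ i p [dp hp]; rewrite cst0 subr0.
  have -> : evf (X i * p) = fun x => x 0 i * evf p x.
    by apply/funext => x; rewrite /evf evM evX.
  have dX : forall x : 'rV[R]_3, differentiable (fun y : 'rV[R]_3 => y 0 i : R) x.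
    by move=> x; exact: differentiable_coord.
  split=> [x|j]; first exact: differentiableM.
  rewrite pderivM //; apply/funext => x; rewrite hp pdM pdX /evf evD !evM evX.
  congr (_ * _ + _); rewrite /pderiv.
  have dd : derivable (fun y : 'rV[R]_3 => y 0 i : R) (x + (0 : R) *: edir j) (edir j).
    exact: diff_derivable.
  have := line_is_derive dd.
  rewrite scale0r addr0 => -[_ <-].
  have -> : (fun t : R => (x + t *: edir j) 0 i) = fun t : R => x 0 i + t * (j == i)%:R.
    by apply/funext => t; rewrite !mxE eqxx /= eq_sym.
  rewrite derive_val.
  by case: eqP => _; rewrite ?ev1 ?ev0 ?scaler0 ?scaler1; rewrite !(mulr1,mulr0,addr0,add0r).
- move=> _ p q [dp hp] [dq hq].
  have -> : evf (p + q) = fun x => evf p x + evf q x.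
    by apply/funext => x; exact: evD.
  split=> [x|j]; first exact: differentiableD.
  by rewrite pderivD // hp hq pdD; apply/funext => x; rewrite /evf evD.
Qed.

Lemma evf_Cinfty p : Cinfty (evf p).
Proof.
apply/CinftyP => n; elim: n p => [|n IH] p; have [dp hp] := evf_diff p; split => // j.
by rewrite hp.
Qed.

Lemma evf_cont p : continuous (evf p).
Proof. exact/Cinfty_cont/evf_Cinfty. Qed.

(* [bump k t = t^-k exp (-1/t)] for [t > 0]: the linear span of these functions is
   closed under differentiation. *)
Definition bump k (t : R) : R := if 0 < t then t ^- k * expR (- t^-1) else 0.

(** Comparison of [expR t^-1] with the term of order [k + 2] of its series; a quadratic bound is
    what makes the derivative at the origin exist and vanish. *)
Lemma bump_le k t : 0 < t -> bump k t <= k.+2`!%:R * t ^+ 2.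
Proof.
move=> t0; rewrite /bump t0.
have : (t^-1) ^+ k.+2 / k.+2`!%:R <= expR t^-1.
  apply: le_trans (expR_ge1Dxn k.+1 _); first by rewrite lerDr.
  by rewrite invr_ge0 ltW.
rewrite expRN ler_pdivrMr ?ltr0n ?fact_gt0 // => h.
rewrite ler_pdivrMr ?expR_gt0 //.
have -> : t ^- k = t ^+ 2 * (t^-1) ^+ k.+2.
  by rewrite -[k.+2]addn2 exprD -!exprVn mulrCA -exprMn mulfV ?gt_eqF // expr1n mulr1.
have -> : k.+2`!%:R * t ^+ 2 * expR t^-1 = t ^+ 2 * (expR t^-1 * k.+2`!%:R) by ring.
by rewrite ler_pM2l ?exprn_gt0.
Qed.

Lemma bump_ge0 k t : 0 <= bump k t.
Proof.
by rewrite /bump; case: ifP => // t0; rewrite mulr_ge0 ?expR_ge0 // invr_ge0 exprn_ge0 // ltW.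
Qed.

Lemma bump_derive k (t : R) : is_derive t 1 (bump k) (- k%:R * bump k.+1 t + bump k.+2 t).
Proof.
have [t0|t0|->] := ltgtP t 0.
- have -> : - k%:R * bump k.+1 t + bump k.+2 t = 0.
    by rewrite /bump !ltNge (ltW t0) /= mulr0 addr0.
  apply: (near_eq_is_derive (f := functions.cst (0 : R))).
  have : \forall s \near t, s < 0 by exact: lt_nbhsl.
  by apply: filterS => s s0; rewrite /bump ltNge (ltW s0).
- have tn : t != 0 by rewrite gt_eqF.
  have D1 : is_derive t 1 (fun s : R => s^-1) (- t ^- 2).
    apply: is_derive_eq (is_deriveV (f := id) _ _) _ => //.
    by rewrite [_ *: 1]mulr1.
  have D2 : is_derive t 1 (fun s : R => expR (- s^-1)) (expR (- t^-1) * t ^- 2).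
    have D1' : is_derive t 1 (fun s : R => - s^-1) (t ^- 2).
      by apply: is_derive_eq (is_deriveN D1) _; rewrite opprK.
    exact: (@is_derive1_comp _ expR (fun s : R => - s^-1) t _ _ (is_derive_expR _) D1').
  have D3 : is_derive t 1 (fun s : R => s ^- k) (- k%:R * t ^- k.+1).
    have -> : (fun s : R => s ^- k) = (fun s : R => s^-1) ^+ k.
      by apply/funext => s; rewrite fctE exprVn.
    apply: is_derive_eq (@is_deriveX _ _ (fun s : R => s^-1) k t 1 _ D1) _.
    case: k => [|k]; first by rewrite /= mul0r scale0r oppr0 mul0r.
    by rewrite /= [LHS]mulrN mulNr -mulrA exprVn -invfM -exprD addn2.
  have D : is_derive t 1 (fun s : R => s ^- k * expR (- s^-1))
      (- k%:R * bump k.+1 t + bump k.+2 t).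
    apply: is_derive_eq (is_deriveM D3 D2) _.
    rewrite /bump t0 /GRing.scale /= !exprS expr0 !invfM invr1 !mulr1; ring.
  apply: near_eq_is_derive D.
  have : \forall s \near t, 0 < s by exact: lt_nbhsr.
  by apply: filterS => s s0; rewrite /bump s0.
- rewrite [bump k.+1 0]/bump [bump k.+2 0]/bump ltxx mulr0 addr0.
  have cv : (fun h : R => h^-1 *: ((bump k \o shift 0) (h *: 1) - bump k 0)) @ 0^' --> (0 : R).
    have b0 : bump k 0 = 0 by rewrite /bump ltxx.
    apply/cvgrPdist_le => e e0; rewrite b0.
    have c0 : 0 < e / k.+2`!%:R by rewrite divr_gt0 // ltr0n fact_gt0.
    exists (e / k.+2`!%:R) => //= h /=; rewrite sub0r normrN => hc h0.
    rewrite subr0 sub0r normrN addr0 [h *: 1]mulr1 [_ *: _]mulrC normrM ger0_norm ?bump_ge0 //.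
    have [hp|hn] := ltP 0 h; last by rewrite /bump ltNge hn mul0r ltW.
    rewrite normfV ler_pdivrMr ?normr_gt0 //; apply: le_trans (bump_le _ hp) _.
    rewrite gtr0_norm // expr2 mulrA ler_pM2r //.
    by rewrite -ler_pdivlMl ?ltr0n ?fact_gt0 // mulrC ltW // -[h]gtr0_norm.
  by split; [apply/cvg_ex; exists 0 | exact: cvg_lim].
Qed.
End Cinf.

(** * Test functions: stability, bounds, supports, bumps composed with polynomials *)

Section Test.
Context {R : realType}.
Local Notation pl := (pl R).
Implicit Types (f g phi : 'rV[R]_3 -> R) (x y v : 'rV[R]_3) (p q : pl).

Definition bumpf k p : 'rV[R]_3 -> R := fun x => bump k (ev x p).

Lemma bumpf_diff k p : (forall x, differentiable (bumpf k p) x) /\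
  forall j, pderiv j (bumpf k p) = fun x => evf (pd j p) x *
    (- k%:R * bumpf k.+1 p x + bumpf k.+2 p x).
Proof.
have [dp hp] := evf_diff p.
have db t : differentiable (bump k : R -> R) t.
  by apply/derivable1_diffP; have [] := bump_derive k t.
have dc x : differentiable (bump k \o evf p) x by exact: differentiable_comp.
split=> [x|j]; first exact: dc.
apply/funext => x; rewrite -hp /pderiv.
rewrite -[bumpf k p]/(bump k \o evf p) deriveE // diff_comp //= diff1E //.
have [_ bd] := bump_derive k (evf p x); rewrite derive1E bd -deriveE //.
Qed.

Lemma evf_Cn n p : Cn n (evf p).
Proof. by have /CinftyP H := evf_Cinfty p; exact: H. Qed.

Lemma bumpf_Cinfty k p : Cinfty (bumpf k p).
Proof.
apply/CinftyP => n; elim: n k p => [|n IH] k p; have [dp hp] := bumpf_diff k p; split => // j.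
rewrite hp; apply: CnM; first exact: evf_Cn.
apply: CnD => //; have -> : (fun x => - k%:R * bumpf k.+1 p x) = fun x => evf (cst (- k%:R)) x * bumpf k.+1 p x.
  by apply/funext => x; rewrite /evf evC.
by apply: CnM => //; exact: evf_Cn.
Qed.

Section TestFun.
Variable T : set 'rV[R]_3.

Lemma test_in phi x : test_fun T phi -> phi x != 0 -> T x.
Proof. by move=> [_ _ sT] px; apply: interior_subset; apply: sT; exact: subset_closure. Qed.

Lemma test_pderiv j phi : test_fun T phi -> test_fun T (pderiv j phi).
Proof.
move=> [sm cS sT]; have S : closure [set x | pderiv j phi x != 0] `<=` closure [set x | phi x != 0].
  have cc : closed (closure [set x | phi x != 0]) by exact: closed_closure.
  rewrite [X in _ `<=` X](proj1 (closure_id _) cc).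
  apply: closureS => x; apply: contraPP => nx.
  have : nbhs x (~` closure [set x | phi x != 0]).
    by apply: open_nbhs_nbhs; split => //; apply: closed_openC; exact: closed_closure.
  move=> nb; apply/negP; rewrite negbK; apply/eqP.
  transitivity ('D_(edir j) (functions.cst (0 : R)) x); last exact: derive_cst.
  apply: near_eq_derive; apply: filterS nb => y ny.
  by apply/eqP/negPn/negP => py; apply: ny; exact: subset_closure.
split; first exact: Cinfty_pderiv.
- apply: (subclosed_compact _ cS S); exact: closed_closure.
- exact: subset_trans S sT.
Qed.

Lemma test_mul phi f : test_fun T phi -> Cinfty f -> test_fun T (fun x => phi x * f x).
Proof.
move=> [sm cS sT] sf.
have S : closure [set x | phi x * f x != 0] `<=` closure [set x | phi x != 0].
  by apply: closureS => x /=; rewrite mulf_eq0 negb_or => /andP[].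
split; first exact: CinftyM.
- apply: (subclosed_compact _ cS S); exact: closed_closure.
- exact: subset_trans S sT.
Qed.

Lemma test_cont phi : test_fun T phi -> continuous phi.
Proof. by move=> [/Cinfty_cont]. Qed.

Lemma test_box phi : test_fun T phi -> exists2 K, 0 <= K & forall x, ~ bbox K x -> phi x = 0.
Proof.
move=> [_ cS _]; have [M [_ HM]] := compact_bounded cS.
exists (`|M| + 2) => [|x nx]; first by rewrite addr_ge0.
apply/eqP/negPn/negP => px; apply: nx => j.
have cx : closure [set x | phi x != 0] x by exact: subset_closure.
have := HM (`|M| + 1) _ x cx.
have -> : M < `|M| + 1 by rewrite (le_lt_trans (ler_norm _)) // ltrDl.
move=> /(_ isT) /= h; apply: (@le_lt_trans _ _ `|x|).
  rewrite [leRHS]mx_normrE; exact: (le_bigmax _ (fun ij : 'I_1 * 'I_3 => `|x ij.1 ij.2|) (0, j)).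
by apply: le_lt_trans h _; rewrite ltrD2l ltr1n.
Qed.

Lemma test_bound phi : test_fun T phi -> exists2 C, 0 <= C & forall x, `|phi x| <= C.
Proof.
move=> tp; have [_ cS _] := tp.
have cf : {within closure [set x | phi x != 0], continuous phi}.
  by apply: continuous_subspaceT; exact: test_cont.
have [M [_ HM]] := compact_bounded (continuous_compact cf cS).
exists (`|M| + 1) => [|x]; first by rewrite addr_ge0.
have [->|px] := eqVneq (phi x) 0; first by rewrite normr0 addr_ge0.
apply: (HM (`|M| + 1)); first by rewrite (le_lt_trans (ler_norm _)) // ltrDl.
by exists x => //; exact: subset_closure.
Qed.

Lemma test_lip phi k : test_fun T phi ->
  exists2 C, 0 <= C & forall x h, `|phi (x + h *: edir k) - phi x| <= C * `|h|.
Proof.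
move=> tp; have [C C0 HC] := test_bound (test_pderiv k tp).
exists C => //; apply: lip_dir => //; case: tp => sm _ _; exact: Cinfty_diff.
Qed.

Lemma test_nice phi : test_fun T phi -> nice phi.
Proof.
move=> tp; split; first exact: mf3_cont (test_cont tp).
- by have [C _ HC] := test_bound tp; exists C.
- by have [K _ HK] := test_box tp; exists K.
Qed.

Lemma bumpf_test p c e : (forall x, 0 < ev x p -> cbox c e x) ->
    (forall x, (forall j, `|c 0 j - x 0 j| <= e) -> interior T x) ->
  test_fun T (bumpf 0 p).
Proof.
move=> pB BT; pose B := [set x : 'rV[R]_3 | forall j, `|c 0 j - x 0 j| <= e].
have cB : closed B.
  have -> : B = \bigcap_j (fun x : 'rV[R]_3 => `|c 0 j - x 0 j|) @^-1` [set t | t <= e].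
    by apply/seteqP; split=> x /= h; [move=> j _; exact: h|move=> j; exact: (h j I)].
  apply: closed_bigI => j _.
  have cf : continuous (fun x : 'rV[R]_3 => `|c 0 j - x 0 j|).
    have -> : (fun x : 'rV[R]_3 => `|c 0 j - x 0 j|) = Num.norm \o evf (cst (c 0 j) - X j).
      by apply/funext => x; rewrite /= /evf !evE.
    by move=> x; apply: continuous_comp; [exact: evf_cont|exact: norm_continuous].
  by apply: (preimage_closed (D := [set t | t <= e])); [move=> x _; exact: cf|exact: closed_le].
have bB : bounded_set B.
  exists (`|c| + e); split; first exact: num_real.
  move=> M hM x Bx; rewrite /= [leLHS]mx_normrE; apply/bigmax_leP; split.
    apply: ltW; apply: le_lt_trans hM; apply: addr_ge0 => //.
    by apply: le_trans (Bx 0).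
  move=> [i j] _ /=; apply: ltW; apply: le_lt_trans hM; rewrite (ord1 i).
  rewrite -[x 0 j](subKr (c 0 j)); apply: le_trans (ler_normB _ _) _.
  apply: lerD; last exact: Bx.
  rewrite [leRHS]mx_normrE; exact: (le_bigmax _ (fun ij : 'I_1 * 'I_3 => `|c ij.1 ij.2|) (0, j)).
have S : closure [set x | bumpf 0 p x != 0] `<=` B.
  rewrite [X in _ `<=` X](proj1 (closure_id _) cB); apply: closureS => x /=.
  rewrite /bumpf /bump; case: ifP => [h _ j|_]; last by rewrite eqxx.
  exact/ltW/pB.
split; first exact: bumpf_Cinfty.
- apply: (subclosed_compact _ (bounded_closed_compact bB cB) S); exact: closed_closure.
- by move=> x /S /BT.
Qed.
End TestFun.

Lemma diffquot_seq f x j : derivable f x (edir j) ->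
  (fun n => n.+1%:R * (f (x + n.+1%:R^-1 *: edir j) - f x)) @ \oo --> pderiv j f x.
Proof.
move=> df.
have c1 : (fun n : nat => n.+1%:R^-1 : R) @ \oo --> 0^'.
  move=> A [e /= e0 HA]; have [N _ HN] := near_infty_natSinv_lt (PosNum e0).
  exists N => // n /HN nn; apply: HA; last by rewrite invr_eq0 pnatr_eq0.
  by rewrite /= sub0r normrN ger0_norm // invr_ge0.
have -> : (fun n => n.+1%:R * (f (x + n.+1%:R^-1 *: edir j) - f x)) =
   (fun h : R => h^-1 *: ((f \o shift x) (h *: edir j) - f x)) \o (fun n => n.+1%:R^-1).
  by apply/funext => n /=; rewrite invrK [_ + x]addrC.
exact: (cvg_comp _ _ c1 df).
Qed.

Lemma pl_bound p M : exists2 C, 0 <= C & forall x, bbox M x -> `|ev x p| <= C.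
Proof.
have [n] : exists n, msz p n by exists (mpoly.msize p).
move: n p; apply: (pl_ind (o := fun=> 0)) => /=.
- by move=> _; exists 0 => // x _; rewrite ev0 normr0.
- by move=> _ c; exists `|c| => // x _; rewrite evC.
- move=> _ i p [C C0 H]; exists (`|M| * C) => [|x Mx]; first exact: mulr_ge0.
  rewrite cst0 subr0 evM evX normrM; apply: ler_pM => //; last exact: H.
  by apply: ltW; apply: lt_le_trans (Mx i) _; exact: ler_norm.
- move=> _ p q [C C0 HC] [D D0 HD]; exists (C + D) => [|x Mx]; first exact: addr_ge0.
  rewrite evD; apply: le_trans (ler_normD _ _) _.
  by apply: lerD; [exact: HC|exact: HD].
Qed.

Lemma bbox_shift M x k (h : R) : bbox M x -> `|h| <= 1 -> bbox (M + 1) (x + h *: edir k).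
Proof.
move=> Mx h1 j; rewrite !mxE eqxx /=; apply: le_lt_trans (ler_normD _ _) _.
apply: ltr_leD; first exact: Mx.
by case: eqP; rewrite ?mulr1 ?mulr0 ?normr0.
Qed.

Lemma pl_lip p k M : exists2 C, 0 <= C & forall x h, bbox M x -> `|h| <= 1 ->
  `|ev (x + h *: edir k) p - ev x p| <= C * `|h|.
Proof.
have [C C0 HC] := pl_bound (pd k p) (M + 2); exists C => // x h Mx h1.
have [dp hp] := evf_diff p.
have P y t : bbox (M + 1) y -> 0 <= t -> t <= 1 -> `|evf p (y + t *: edir k) - evf p y| <= C * `|t|.
  move=> My t0 t1; have [c /andP[c0 ct] ->] := mvt_dir y k dp t0.
  rewrite normrM mulrC ler_wpM2r // hp; apply: HC.
  have -> : M + 2 = M + 1 + 1 by rewrite -addrA.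
  by apply: bbox_shift => //; rewrite ger0_norm // (le_trans ct).
have [h0|h0] := leP 0 h.
  apply: P => //; last by rewrite -(ger0_norm h0).
  by move=> j; apply: lt_le_trans (Mx j) _; rewrite lerDl.
have := P (x + h *: edir k) (- h); rewrite oppr_ge0 normrN scaleNr addrK distrC.
by apply => //; [exact: bbox_shift|exact: ltW|rewrite -(ltr0_norm h0)].
Qed.
End Test.

(** * Barycentric coordinates and the description of the cells *)

Section Geometry.
Context {R : realType}.
Local Notation pl := (pl R).
Variable a : 'I_4 -> 'rV[R]_3.
Hypothesis ha : nondegenerate_tetra a.

Definition edges : 'M[R]_3 := \matrix_(i < 3) (a (lift ord0 i) - a ord0).
(** Gradients of the barycentric coordinates: the columns of the inverse edge matrix and, for the
    base vertex, minus their sum. *)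
Definition blam_grad (l : 'I_4) : 'rV[R]_3 :=
  if unlift ord0 l is Some i then \row_k invmx edges k i
  else - \sum_i \row_k invmx edges k i.
Local Notation d := blam_grad.
Local Notation o := (barycenter a).
Definition bary_vec l := a l - o.
Local Notation r := bary_vec.

Lemma edges_unit : edges \in unitmx. Proof. by rewrite -row_free_unit. Qed.

Lemma dE (i : 'I_3) : d (lift ord0 i) = \row_k invmx edges k i.
Proof. by rewrite /d liftK. Qed.
Lemma d0E : d ord0 = - \sum_(i < 3) d (lift ord0 i).
Proof. by rewrite {1}/d unlift_none; congr (- _); apply: eq_bigr => i _; rewrite dE. Qed.

Lemma d_sum : \sum_l d l = 0.
Proof. by rewrite big_ord_recl d0E addNr. Qed.

Lemma dotp_sumr (I : Type) (s : seq I) (u : 'rV[R]_3) (F : I -> 'rV[R]_3) :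
  dotp u (\sum_(i <- s) F i) = \sum_(i <- s) dotp u (F i).
Proof.
elim/big_rec2: _ => [|i x y _ <-]; last by rewrite dotpDr.
by rewrite /dotp big1 // => k _; rewrite mxE mulr0.
Qed.
Lemma dotp_suml (I : Type) (s : seq I) (u : 'rV[R]_3) (F : I -> 'rV[R]_3) :
  dotp (\sum_(i <- s) F i) u = \sum_(i <- s) dotp (F i) u.
Proof.
rewrite /dotp exchange_big /=; apply: eq_bigr => k _.
by rewrite summxE mulr_suml.
Qed.
Lemma dotpNl (u v : 'rV[R]_3) : dotp (- u) v = - dotp u v.
Proof. by rewrite /dotp -sumrN; apply: eq_bigr => k _; rewrite mxE mulNr. Qed.
Lemma dotpBr (u v w : 'rV[R]_3) : dotp u (v - w) = dotp u v - dotp u w.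
Proof. by rewrite -scaleN1r dotpDr dotpZr mulN1r. Qed.
Lemma dotp0 (u : 'rV[R]_3) : dotp u 0 = 0.
Proof. by rewrite /dotp big1 // => k _; rewrite mxE mulr0. Qed.

Lemma d_edge l k : dotp (d l) (a k - a ord0) = (l == k)%:R - (l == ord0)%:R.
Proof.
have E (i j : 'I_3) : dotp (d (lift ord0 i)) (a (lift ord0 j) - a ord0) = (i == j)%:R.
  rewrite dE /dotp; transitivity ((edges *m invmx edges) j i).
    rewrite mxE; apply: eq_bigr => m _; rewrite mulrC; congr (_ * _); last by rewrite mxE.
    by rewrite /edges !mxE.
  by rewrite mulmxV ?edges_unit // mxE eq_sym.
have [j ->|->] := unliftP ord0 k; last first.
  by rewrite subrr dotp0 subrr.
have [i ->|->] := unliftP ord0 l.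
  by rewrite E (inj_eq (@lift_inj _ _)) subr0.
rewrite d0E dotpNl dotp_suml eqxx (_ : (ord0 == lift ord0 j) = false) //.
rewrite (bigD1 j) //= E eqxx big1 ?addr0 ?sub0r // => i /negbTE ij.
by rewrite E ij.
Qed.

Lemma sum_r : \sum_l r l = 0.
Proof.
rewrite /r sumrB sumr_const card_ord /barycenter -[_ *+ 4]scaler_nat scalerA.
by rewrite divff ?pnatr_eq0 // scale1r subrr.
Qed.

Lemma d_r l k : dotp (d l) (r k) = (l == k)%:R - 4^-1.
Proof.
have E m : dotp (d l) (r k) - dotp (d l) (r m) = (l == k)%:R - (l == m)%:R.
  rewrite -dotpBr /r opprB addrA subrK.
  have -> : a k - a m = (a k - a ord0) - (a m - a ord0) by rewrite opprB addrA subrK.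
  by rewrite dotpBr !d_edge; ring.
have S : \sum_m (dotp (d l) (r k) - dotp (d l) (r m)) = \sum_m ((l == k)%:R - (l == m)%:R).
  by apply: eq_bigr.
have Sr : \sum_m dotp (d l) (r m) = 0 by rewrite -dotp_sumr sum_r dotp0.
rewrite !sumrB Sr subr0 !sumr_const !card_ord in S.
rewrite (bigD1 l) //= eqxx big1 in S; last by move=> m /negbTE ml; rewrite eq_sym ml.
have E4 (z : R) : z *+ 4 = z + z + z + z by rewrite !mulrS mulr0n addr0 !addrA.
by rewrite addr0 /= !E4 in S; move: S; move: (dotp _ _) ((l == k)%:R : R) => u w S; lra.
Qed.

Lemma dotp_reconstruct (y : 'rV[R]_3) : \sum_l dotp (d l) y *: a l = y.
Proof.
rewrite big_ord_recl d0E dotpNl dotp_suml scaleNr scaler_suml addrC -sumrB.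
under eq_bigr do rewrite -scalerBr.
have -> : y = (y *m invmx edges) *m edges by rewrite mulmxKV // edges_unit.
rewrite [RHS]mulmx_sum_row; apply: eq_bigr => i _; rewrite mulmxKV ?edges_unit //.
congr (_ *: _); last by rewrite /edges rowK.
by rewrite mxE; apply: eq_bigr => k _; rewrite dE mxE mulrC.
Qed.

Definition blam l x : R := dotp (d l) (x - o) + 4^-1.

Lemma blam_ev l x : blam l x = ev x (mu o d l) + 4^-1.
Proof. by rewrite ev_mu. Qed.

Lemma blam_sum x : \sum_l blam l x = 1.
Proof.
rewrite big_split /= -dotp_suml d_sum sumr_const card_ord.
have -> : dotp (0 : 'rV[R]_3) (x - o) = 0 by rewrite /dotp big1 // => k _; rewrite mxE mul0r.
by rewrite add0r -[_ *+ 4]mulr_natl divff ?pnatr_eq0.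
Qed.

Lemma blam_combine x : \sum_l blam l x *: a l = x.
Proof.
under eq_bigr do rewrite scalerDl.
rewrite big_split /= dotp_reconstruct -scaler_sumr -/(barycenter a) subrK //.
Qed.

Lemma blam_shift l x v : blam l (x + v) = blam l x + dotp (d l) v.
Proof. by rewrite /blam -addrA addrCA dotpDr; ring. Qed.

Lemma blam_o l : blam l o = 4^-1.
Proof. by rewrite /blam subrr dotp0 add0r. Qed.

Lemma blam_a l k : blam l (a k) = (l == k)%:R.
Proof. by rewrite /blam d_r subrK. Qed.

Lemma blam_affine l (t : 'I_4 -> R) (y : 'I_4 -> 'rV[R]_3) : \sum_i t i = 1 ->
  blam l (\sum_i t i *: y i) = \sum_i t i * blam l (y i).
Proof.
move=> t1; have -> : \sum_i t i *: y i = o + \sum_i t i *: (y i - o).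
  under [in RHS]eq_bigr do rewrite scalerBr.
  by rewrite sumrB -scaler_suml t1 scale1r addrC subrK.
rewrite blam_shift blam_o dotp_sumr.
under eq_bigr do rewrite dotpZr.
have E : 4^-1 = \sum_i t i * 4^-1 :> R by rewrite -mulr_suml t1 mul1r.
rewrite [X in X + _]E -big_split; apply: eq_bigr => i _ /=.
by rewrite /blam mulrDr addrC.
Qed.

Lemma tetraE x : tetra a x <-> forall l, 0 <= blam l x.
Proof.
split=> [[t [t0 t1 ->]] l|H].
  rewrite blam_affine // (bigD1 l) //= blam_a eqxx mulr1 big1 ?addr0 // => i /negbTE il.
  by rewrite blam_a eq_sym il mulr0.
exists (fun l => blam l x); split; [exact: H|exact: blam_sum|by rewrite blam_combine].
Qed.

Lemma alfeldE l x : alfeld a l x <-> 0 <= blam l x /\ forall j, blam l x <= blam j x.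
Proof.
split=> [[t [t0 t1 ->]]|[x0 H]].
  have E j : blam j (\sum_i t i *: (if i == l then o else a i)) =
      (if j == l then 0 else t j) + t l / 4.
    rewrite blam_affine // (bigD1 l) //= eqxx blam_o addrC; congr (_ + _).
    case: eqP => [->|/eqP jl].
      by rewrite big1 // => i /negbTE il; rewrite il blam_a eq_sym il mulr0.
    rewrite (bigD1 j) //= (negbTE jl) blam_a eqxx mulr1 big1 ?addr0 // => i /andP[/negbTE il /negbTE ij].
    by rewrite il blam_a eq_sym ij mulr0.
  have t4 : 0 <= t l / 4 by rewrite divr_ge0.
  split=> [|j]; rewrite !E eqxx add0r // lerDr; by case: ifP.
(* Weight [4 * blam l x] at the barycenter puts [blam l x] on each vertex of [T], leaving the
   differences for the remaining vertices. *)
exists (fun j => if j == l then 4 * blam l x else blam j x - blam l x); split.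
- by move=> j; case: eqP => _; rewrite ?mulr_ge0 // subr_ge0.
- apply: etrans _ (blam_sum x); rewrite (bigD1 l) //= [RHS](bigD1 l) //= eqxx.
  rewrite (eq_bigr (fun j => blam j x - blam l x)); last by move=> i /negbTE ->.
  rewrite sumrB sumr_const.
  have -> : #|(fun i : 'I_4 => i != l)| = 3 by rewrite cardC1 card_ord.
  set S := \sum_(_ < _ | _) _; ring.
- rewrite -[LHS]blam_combine (bigD1 l) //= [RHS](bigD1 l) //= !eqxx.
  under [in RHS]eq_bigr => i /negbTE il do rewrite il scalerBl.
  rewrite sumrB -scaler_sumr.
  have -> : 4 * blam l x *: o = blam l x *: \sum_i a i.
    by rewrite /barycenter scalerA mulrAC divff ?pnatr_eq0 // mul1r.
  by rewrite [\sum_i a i](bigD1 l) //= scalerDr -addrA; congr (_ + _); rewrite addrC subrK.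
Qed.

Lemma blam_evf l : blam l = evf (mu o d l + cst 4^-1).
Proof. by apply/funext => x; rewrite blam_ev /evf evD evC. Qed.

Lemma blam_cont l : continuous (blam l).
Proof. by rewrite blam_evf; exact: evf_cont. Qed.

Lemma open_pos (I : finType) (p : I -> pl) :
  open [set x : 'rV[R]_3 | forall i, 0 < ev x (p i)].
Proof.
have -> : [set x : 'rV[R]_3 | forall i, 0 < ev x (p i)] =
    \bigcap_i (evf (p i) @^-1` [set t | 0 < t]).
  by apply/seteqP; split=> x /= h; [move=> i _; exact: h|move=> i; exact: (h (i : I) Logic.I)].
rewrite -[X in open X]setCK; apply: closed_openC; rewrite setC_bigcap.
apply: closed_bigcup; first exact: finite_finset.
move=> i _; apply: open_closedC; apply: open_comp; last exact: open_gt.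
by move=> x _; exact: evf_cont.
Qed.

Lemma interior_tetra x : (forall l, 0 < blam l x) -> interior (tetra a) x.
Proof.
move=> H; have : nbhs x [set y : 'rV[R]_3 | forall l, 0 < ev y (mu o d l + cst 4^-1)].
  apply: open_nbhs_nbhs; split; first exact: open_pos.
  by move=> l; rewrite evD evC -blam_ev.
apply: filterS => y /= h; apply/tetraE => l; apply: ltW.
by have := h l; rewrite evD evC -blam_ev.
Qed.

(** A cell index with minimal barycentric coordinate, ties being settled by the choice of [pick]. It
    is defined on all of space, so [pw] extends a piecewise polynomial to the four cones with apex
    at the barycenter, and integrals against test functions need not mention [T]. *)
Definition reg x : 'I_4 :=
  odflt ord0 [pick l | [forall j, blam l x <= blam j x]].

Lemma reg_min x j : blam (reg x) x <= blam j x.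
Proof.
rewrite /reg; case: pickP => [l /forallP //|H].
pose l := [arg min_(l < ord0 | true) blam l x]%O.
have := H l; suff -> : [forall j, blam l x <= blam j x] by [].
by apply/forallP => k; rewrite /l; case: Order.TotalTheory.arg_minP => // i _; apply.
Qed.

Lemma reg_alfeld x : tetra a x -> alfeld a (reg x) x.
Proof. by move=> /tetraE H; apply/alfeldE; split => // j; exact: reg_min. Qed.

Lemma alfeld_sub l x : alfeld a l x -> tetra a x.
Proof. by move=> /alfeldE[h H]; apply/tetraE => j; exact: le_trans (H j). Qed.

Lemma reg_uniq l x : (forall j, j != l -> blam l x < blam j x) -> reg x = l.
Proof.
move=> H; apply/eqP/negPn/negP => rl.
by have := H _ rl; rewrite ltNge reg_min.
Qed.

Definition pw (P : 'I_4 -> pl) x : R := ev x (P (reg x)).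

Local Notation mR := (measurableTypeR R).
Local Notation R3 := (mR * mR * mR)%type.

(** The index depends only on the finite table of comparisons between barycentric coordinates, each
    of which is measurable. *)
Lemma measurable_reg l : measurable (@vec3 R @^-1` [set x | reg x = l]).
Proof.
pose bv x := [ffun q : 'I_4 * 'I_4 => blam q.1 x <= blam q.2 x].
pose G (b : {ffun 'I_4 * 'I_4 -> bool}) := odflt ord0 [pick l | [forall j, b (l, j)]].
have regE x : reg x = G (bv x).
  rewrite /reg /G; congr (odflt _ _); apply: eq_pick => k.
  by apply: eq_forallb => j; rewrite ffunE.
have -> : @vec3 R @^-1` [set x | reg x = l] =
    \bigcup_(b in [set b | G b = l]) \bigcap_q (@vec3 R @^-1` [set x | (blam q.1 x <= blam q.2 x) = b q]).
  apply/seteqP; split=> p /=.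
    by rewrite regE => h; exists (bv (vec3 p)) => // q _ /=; rewrite ffunE.
  move=> [b Gb H]; rewrite regE -Gb; congr G; apply/ffunP => q; rewrite ffunE.
  exact: (H q I).
apply: fin_bigcup_measurable; first exact: finite_finset.
move=> b _; apply: fin_bigcap_measurable; first exact: finite_finset.
move=> q _.
have mA : measurable (@vec3 R @^-1` [set x | blam q.1 x <= blam q.2 x]).
  have -> : [set x | blam q.1 x <= blam q.2 x] =
      ~` [set x | forall i : 'I_1, 0 < ev x (mu o d q.1 - mu o d q.2)].
    apply/seteqP; split=> x /=; rewrite !blam_ev lerD2r leNgt.
      by move=> /negP h /(_ ord0); rewrite evB subr_gt0.
    by move=> h; apply/negP => h'; apply: h => _; rewrite evB subr_gt0.
  by rewrite -preimage_setC; apply: measurableC; apply: measurable_open_vec3; exact: open_pos.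
case: (b q).
  by rewrite (_ : [set x | _ = true] = [set x | blam q.1 x <= blam q.2 x]).
rewrite (_ : [set x | _ = false] = ~` [set x | blam q.1 x <= blam q.2 x]).
  by rewrite -preimage_setC; exact: measurableC.
by apply/seteqP; split=> x /=; [move=> ->|move/negP/negbTE].
Qed.

Lemma pwE P : pw P = fun x => \sum_l \1_[set x | reg x = l] x * ev x (P l).
Proof.
apply/funext => x; rewrite (bigD1 (reg x)) //= indicE mem_set // mul1r big1 ?addr0 //.
by move=> l /eqP lx; rewrite indicE memNset ?mul0r // => /esym.
Qed.

Lemma mf3_sum (I : Type) (s : seq I) (F : I -> 'rV[R]_3 -> R) :
  (forall i, mf3 (F i)) -> mf3 (fun x => \sum_(i <- s) F i x).
Proof.
move=> H; elim: s => [|i s IH].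
  by rewrite (_ : (fun x => _) = fun=> 0); [exact: measurable_cst|apply/funext => x; rewrite big_nil].
rewrite (_ : (fun x => _) = fun x => F i x + \sum_(j <- s) F j x).
  exact: (measurable_funD (H i) IH).
by apply/funext => x; rewrite big_cons.
Qed.

Lemma mf3_pw P : mf3 (pw P).
Proof.
rewrite pwE; apply: mf3_sum => l.
apply: (@measurable_funM _ R3 R setT (\1_[set x | reg x = l] \o @vec3 R) (evf (P l) \o @vec3 R)).
  have -> : \1_[set x | reg x = l] \o @vec3 R = \1_(@vec3 R @^-1` [set x | reg x = l]) :> (R3 -> R).
    by apply/funext => p; rewrite /= !indicE.
  by apply: measurable_indic; exact: measurable_reg.
exact: mf3_cont (@evf_cont _ (P l)).
Qed.

Lemma pw_bound P M : exists2 C, 0 <= C & forall x, bbox M x -> `|pw P x| <= C.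
Proof.
have /fin_all_exists2[C C0 HC] : forall l, exists2 C, 0 <= C & forall x, bbox M x -> `|ev x (P l)| <= C.
  by move=> l; exact: pl_bound.
exists (\sum_l C l) => [|x Mx]; first exact: sumr_ge0.
apply: le_trans (HC (reg x) x Mx) _; rewrite (bigD1 (reg x)) //= lerDl.
exact: sumr_ge0.
Qed.
End Geometry.

(** * Integration by parts for continuous piecewise polynomials *)

Section Ibp.
Context {R : realType}.
Local Notation pl := (pl R).
Variable a : 'I_4 -> 'rV[R]_3.
Hypothesis ha : nondegenerate_tetra a.
Local Notation d := (blam_grad a).
Local Notation o := (barycenter a).
Local Notation r := (bary_vec a).
Local Notation T := (tetra a).
Local Notation Cont := (cont o d).
Local Notation Mu := (mu o d).

Lemma ev_mu_shift l x k (h : R) : ev (x + h *: edir k) (Mu l) = ev x (Mu l) + h * d l 0 k.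
Proof.
rewrite ev_muD dotpZr; congr (_ + _ * _).
rewrite /dotp (bigD1 k) //= big1 => [|j /negbTE jk]; last by rewrite mxE jk andbF mulr0.
by rewrite mxE !eqxx mulr1 addr0.
Qed.

Lemma reg_mu x j : ev x (Mu (reg a x)) <= ev x (Mu j).
Proof. by have := reg_min a x j; rewrite !blam_ev lerD2r. Qed.

Lemma crossing_bound (u v A B h : R) : u <= v -> v + h * A <= u + h * B ->
  `|u - v| <= `|B - A| * `|h|.
Proof.
move=> uv H; have -> : `|u - v| = v - u by rewrite distrC ger0_norm // subr_ge0.
rewrite -normrM.
apply: (@le_trans _ _ ((B - A) * h)); last exact: ler_norm.
have -> : (B - A) * h = h * B - h * A by ring.
lra.
Qed.

(** Only the cells [i] of [x] and [j] of the shifted point matter, whatever lies between. The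
    mismatch of [P i] and [P j] at [x] is [mu i - mu j] times a bounded factor, and [mu i - mu j]
    changes sign between the two points, so it is of the size of the shift ([crossing_bound]). *)
Lemma pw_lip P k M : Cont P -> exists2 C, 0 <= C & forall x h, bbox M x -> `|h| <= 1 ->
  `|pw a P (x + h *: edir k) - pw a P x| <= C * `|h|.
Proof.
move=> cP.
have /choice[Q QE] : forall ij : 'I_4 * 'I_4, exists Q : pl,
    P ij.1 - P ij.2 = (Mu ij.1 - Mu ij.2) * Q.
  move=> [i j] /=; have [->|ij] := eqVneq i j; first by exists 0; rewrite !subrr mul0r.
  have [||q _ qE] := @mu_div _ o r d (d_r ha) i j (maxn (mpoly.msize (P i)) (mpoly.msize (P j))) (P i - P j) ij.
  - by apply: mszB; rewrite leq_max leqnn ?orbT.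
  - by move=> x /cP h; rewrite evB h subrr.
  - by exists q.
have /fin_all_exists2[C C0 HC] : forall l, exists2 C, 0 <= C & forall x h, bbox M x -> `|h| <= 1 ->
    `|ev (x + h *: edir k) (P l) - ev x (P l)| <= C * `|h|.
  by move=> l; exact: pl_lip.
have /fin_all_exists2[B B0 HB] : forall ij, exists2 C, 0 <= C & forall x, bbox M x -> `|ev x (Q ij)| <= C.
  by move=> ij; exact: pl_bound.
pose D (ij : 'I_4 * 'I_4) := `|d ij.1 0 k - d ij.2 0 k|.
exists (\sum_l C l + \sum_ij D ij * B ij).
  by apply: addr_ge0; apply: sumr_ge0 => ij _; [exact: C0|exact: mulr_ge0 (normr_ge0 _) (B0 _)].
move=> x h Mx h1; set y := x + _; rewrite /pw; set i := reg a x; set j := reg a y.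
have -> : ev y (P j) - ev x (P i) = (ev y (P j) - ev x (P j)) - ev x (Mu i - Mu j) * ev x (Q (i, j)).
  by rewrite -evM -(QE (i, j)) /= evB opprB addrA subrK.
apply: le_trans (ler_normB _ _) _; rewrite mulrDl; apply: lerD.
  apply: le_trans (HC j x h Mx h1) _; rewrite ler_wpM2r //.
  by rewrite (bigD1 j) //= lerDl sumr_ge0.
rewrite normrM; apply: (@le_trans _ _ (D (i, j) * `|h| * B (i, j))).
  apply: ler_pM => //; last exact: HB.
  rewrite evB; apply: crossing_bound; first exact: reg_mu.
  by have := reg_mu y i; rewrite !ev_mu_shift.
rewrite mulrAC ler_wpM2r // (bigD1 (i, j)) //= lerDl.
by apply: sumr_ge0 => ij _; exact: mulr_ge0 (normr_ge0 _) (B0 _).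
Qed.

Definition generic x := forall i j, i != j -> blam a i x <> blam a j x.

Lemma ae_generic : {ae leb3, forall p, generic (vec3 p)}.
Proof.
have H (ij : 'I_4 * 'I_4) : {ae leb3, forall p, ij.1 != ij.2 -> blam a ij.1 (vec3 p) <> blam a ij.2 (vec3 p)}.
  have [e|ne] := boolP (ij.1 == ij.2); first exact: aeW.
  have n1 : dotp (d ij.1 - d ij.2) (r ij.1) = 1.
    by rewrite dotpBl !d_r // eqxx eq_sym (negbTE ne) /=; ring.
  have := plane_null (dotp (d ij.1 - d ij.2) o) n1.
  apply: filterS => p H _ E; apply: H; move/eqP: E.
  rewrite /blam (inj_eq (addIr _)) !dotpBr -subr_eq0 => /eqP E.
  by rewrite !dotpBl; apply/eqP; rewrite -subr_eq0 -E; apply/eqP; ring.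
have /(filter_forall) := H.
by apply: filterS => p h i j ij; exact: (h (i, j)).
Qed.

Lemma generic_near x : generic x -> nbhs x [set y | reg a y = reg a x].
Proof.
move=> gx; pose p (j : 'I_4) : pl := if j == reg a x then 1 else Mu j - Mu (reg a x).
have : nbhs x [set y : 'rV[R]_3 | forall j, 0 < ev y (p j)].
  apply: open_nbhs_nbhs; split; first exact: open_pos.
  move=> j; rewrite /p; case: (eqVneq j (reg a x)) => [_|jr]; first by rewrite ev1 ltr01.
  rewrite evB subr_gt0 lt_neqAle reg_mu andbT; apply/eqP => E.
  by apply: (gx j (reg a x) jr); rewrite !blam_ev E.
apply: filterS => y /= H; apply: reg_uniq => j jr.
by have := H j; rewrite /p (negbTE jr) evB subr_gt0 !blam_ev ltrD2r.
Qed.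

Lemma mf3M (f g : 'rV[R]_3 -> R) : mf3 f -> mf3 g -> mf3 (fun x => f x * g x).
Proof. by move=> mf mg; exact: (measurable_funM mf mg). Qed.
Lemma mf3D (f g : 'rV[R]_3 -> R) : mf3 f -> mf3 g -> mf3 (fun x => f x + g x).
Proof. by move=> mf mg; exact: (measurable_funD mf mg). Qed.

Lemma nice_pw P phi : test_fun T phi -> nice (fun x => pw a P x * phi x).
Proof.
move=> tp; have [mp _ _] := test_nice tp; have [K K0 HK] := test_box tp.
have [B B0 HB] := test_bound tp; have [C C0 HC] := pw_bound a P K.
split; first by apply: mf3M => //; exact: mf3_pw.
- exists (C * B) => x; have [Kx|nK] := pselect (bbox K x).
    by rewrite normrM; apply: ler_pM => //; exact: HC.
  by rewrite (HK _ nK) mulr0 normr0 mulr_ge0.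
- by exists K => x /HK ->; rewrite mulr0.
Qed.

Lemma integ_pw P phi : test_fun T phi -> integ (fun x => pw a P x * phi x).
Proof. by move=> tp; apply: nice_integ; exact: nice_pw. Qed.

(** [int_deriv0] applied to [pw P * phi]: this product is Lipschitz by [pw_lip], and its difference
    quotients converge at generic points, near which [reg] is constant. *)
Lemma pw_ibp P j phi : Cont P -> test_fun T phi ->
  I3 (fun x => pw a (fun l => pd j (P l)) x * phi x) =
  - I3 (fun x => pw a P x * pderiv j phi x).
Proof.
move=> cP tp; have tdp := test_pderiv j tp.
apply/eqP; rewrite -subr_eq0 opprK; apply/eqP.
rewrite -I3D; [|exact: integ_pw|exact: integ_pw].
have [K K0 HK] := test_box tp; have [B B0 HB] := test_bound tp.
have [Lp Lp0 HLp] := test_lip j tp.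
have [C C0 HC] := pw_bound a P (K + 2).
have [L L0 HL] := pw_lip j (K + 1) cP.
apply: (@int_deriv0 R j (fun x => pw a P x * phi x) _ K (C * Lp + L * B)).
- apply: mf3D; apply: mf3M; try exact: mf3_pw.
    by have [] := test_nice tp.
  by have [] := test_nice tdp.
- exact: nice_pw.
- by move=> x /HK ->; rewrite mulr0.
- by rewrite addr_ge0 // mulr_ge0.
- move=> x h h1; have [Kx|nKx] := pselect (bbox (K + 1) x); last first.
    have n1 : ~ bbox K x.
      by move=> Kx; apply: nKx => i; apply: lt_le_trans (Kx i) _; rewrite lerDl.
    have n2 : ~ bbox K (x + h *: edir j).
      move=> Kx; apply: nKx; rewrite -[x](addrK (h *: edir j)) -scaleNr.
      by apply: bbox_shift; rewrite ?normrN.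
    by rewrite !HK // !mulr0 subrr normr0 mulr_ge0 // addr_ge0 // mulr_ge0.
  have Kh : bbox (K + 2) (x + h *: edir j).
    have -> : K + 2 = K + 1 + 1 by rewrite -addrA.
    exact: bbox_shift.
  set u := pw a P _; set v := pw a P x; set f := phi _; set g := phi x.
  have -> : u * f - v * g = u * (f - g) + (u - v) * g by ring.
  apply: le_trans (ler_normD _ _) _; rewrite [leRHS]mulrDl !normrM; apply: lerD.
    rewrite -[leRHS]mulrA; apply: ler_pM => //; [exact: HC|exact: HLp].
  rewrite mulrAC; apply: ler_pM => //; [exact: (HL x h Kx h1)|exact: HB].
apply: filterS ae_generic => p gp; set x := vec3 p.
have nx := generic_near gp; rewrite -/x in nx.
pose G y := evf (P (reg a x)) y * phi y.
have [sm _ _] := tp.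
have dG : derivable G x (edir j).
  apply: diff_derivable; apply: differentiableM; last exact: Cinfty_diff.
  exact: Cinfty_diff (evf_Cinfty _) x.
have GE : {near x, G =1 (fun y => pw a P y * phi y)}.
  by apply: filterS nx => y /= ry; rewrite /G /evf /pw ry.
have dF := near_eq_derivable GE dG.
have := diffquot_seq dF; rewrite /pderiv -(near_eq_derive _ GE).
have -> : 'D_(edir j) G x = pderiv j G x by [].
rewrite pderivM; [|exact: Cinfty_diff (evf_Cinfty _)|exact: Cinfty_diff].
by have [_ ->] := evf_diff (P (reg a x)).
Qed.
End Ibp.

(** * Weak divergence of normally continuous fields and the fundamental lemma *)

Section Weak.
Context {R : realType}.
Local Notation pl := (pl R).
Variable a : 'I_4 -> 'rV[R]_3.
Hypothesis ha : nondegenerate_tetra a.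
Local Notation d := (blam_grad a).
Local Notation o := (barycenter a).
Local Notation r := (bary_vec a).
Local Notation T := (tetra a).
Local Notation Cont := (cont o d).
Local Notation Ncont := (ncont o d).
Local Notation Mu := (mu o d).
Local Notation pw := (pw a).

Lemma pwD P Q x : pw (fun l => P l + Q l) x = pw P x + pw Q x.
Proof. exact: evD. Qed.

Lemma I3_pwD P Q phi : test_fun T phi ->
  I3 (fun x => pw (fun l => P l + Q l) x * phi x) =
  I3 (fun x => pw P x * phi x) + I3 (fun x => pw Q x * phi x).
Proof.
move=> tp; rewrite -I3D; [|exact: integ_pw|exact: integ_pw].
by congr I3; apply/funext => x; rewrite pwD mulrDl.
Qed.

Lemma I3_pwZ c P phi : test_fun T phi ->
  I3 (fun x => pw (fun l => c *: P l) x * phi x) = c * I3 (fun x => pw P x * phi x).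
Proof.
move=> tp; rewrite -I3Z; last exact: integ_pw.
by congr I3; apply/funext => x; rewrite /pw evZ mulrA.
Qed.

Lemma I3_pwB P Q phi : test_fun T phi ->
  I3 (fun x => pw (fun l => P l - Q l) x * phi x) =
  I3 (fun x => pw P x * phi x) - I3 (fun x => pw Q x * phi x).
Proof.
move=> tp; have -> : (fun l => P l - Q l) = fun l => P l + -1 *: Q l.
  by apply/funext => l; rewrite scaleN1r.
by rewrite I3_pwD // I3_pwZ // mulN1r.
Qed.

Lemma I3_pw_sum (I : finType) (P : I -> 'I_4 -> pl) phi : test_fun T phi ->
  I3 (fun x => pw (fun l => \sum_i P i l) x * phi x) =
  \sum_i I3 (fun x => pw (P i) x * phi x).
Proof.
move=> tp; rewrite -I3_sum; last by move=> i; exact: integ_pw.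
by congr I3; apply/funext => x; rewrite /pw ev_sum mulr_suml.
Qed.

Lemma cont_ncont v : (forall k, Cont (v^~ k)) -> Ncont v.
Proof.
move=> cv i j x xij; apply: big1 => k _.
by rewrite /jump (cv k i j x xij) subrr mulr0.
Qed.

(** [div_lift] and [curl_lift] give [w = v + curl c] with [v] and [c] continuous. [pw_ibp] treats
    [v] directly; for the curl part it moves the derivatives onto [phi], where they cancel. *)
Lemma pw_div_ibp w phi : Ncont w -> test_fun T phi ->
  \sum_k I3 (fun x => pw (w^~ k) x * pderiv k phi x) =
  - I3 (fun x => pw (fun l => div (w l)) x * phi x).
Proof.
move=> nw tp.
pose n := (\max_(q : 'I_4 * 'I_3) mpoly.msize (w q.1 q.2))%N.
have wn l k : msz (w l k) n.
  exact: (@leq_bigmax _ (fun q : 'I_4 * 'I_3 => mpoly.msize (w q.1 q.2)) (l, k)).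
have dwn l : msz (div (w l)) n.-1 by apply: msz_sum => k _; apply: msz_pd.
have [v [vn cv dv]] := @div_lift _ o r d (d_r ha) _ _ dwn.
have [|l k||c [_ cc cE]] := @curl_lift _ o r d (d_r ha) (fun l k => w l k - v l k) n.-1.+1.
- move=> i j x xij; have e1 := nw i j x xij; have e2 := cont_ncont cv xij.
  transitivity (\sum_k (d i - d j) 0 k * jump w i j x k - \sum_k (d i - d j) 0 k * jump v i j x k).
    rewrite -sumrB; apply: eq_bigr => k _.
    by rewrite -mulrBr /jump !evB; congr (_ * _); ring.
  by rewrite e1 e2 subrr.
- by apply: mszB => //; apply: mszW (wn l k); case: (n).
- move=> l; rewrite /div; under eq_bigr do rewrite pdB.
  by rewrite sumrB -!/(div _) dv subrr.
have wE l k : w l k = v l k + curl (c l) k by rewrite cE addrC subrK.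
have tdp k := test_pderiv k tp.
transitivity (\sum_k (I3 (fun x => pw (v^~ k) x * pderiv k phi x) +
                      I3 (fun x => pw (fun l => curl (c l) k) x * pderiv k phi x))).
  apply: eq_bigr => k _; rewrite -I3_pwD //.
  by congr I3; apply/funext => x; rewrite /Defs.pderiv /pw wE.
rewrite big_split /=.
have -> : \sum_k I3 (fun x => pw (fun l => curl (c l) k) x * pderiv k phi x) = 0.
  (* [Z] is symmetric in [i] and [k] by Schwarz, and the six terms of the curl cancel in pairs. *)
  pose Z i j k := I3 (fun x => pw (c^~ j) x * pderiv i (pderiv k phi) x).
  have H i j k : I3 (fun x => pw (fun l => pd i (c l j)) x * pderiv k phi x) = - Z i j k.
    by apply: pw_ibp => //; exact: tdp.
  have ZS i j k : Z i j k = Z k j i.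
    by case: tp => sm _ _; rewrite /Z (Cinfty_schwarz k i sm).
  have J k : I3 (fun x => pw (fun l => curl (c l) k) x * pderiv k phi x) =
      Z (k + 2) (k + 1) k - Z (k + 1) (k + 2) k.
    apply: etrans (I3_pwB (fun l => pd (k + 1) (c l (k + 2))) (fun l => pd (k + 2) (c l (k + 1))) (tdp k)) _.
    by rewrite H H opprK addrC.
  rewrite (eq_bigr _ (fun k _ => J k)) sum3; clearbody Z; rewrite !I3E.
  rewrite (ZS 1 0 2) (ZS 2 0 1) (ZS 2 1 0) (ZS 1 2 0) (ZS 0 1 2) (ZS 0 2 1); move: (ZS 0 2 1) (ZS 1 0 2) (ZS 0 1 2); lra.
rewrite addr0; transitivity (\sum_k - I3 (fun x => pw (fun l => pd k (v l k)) x * phi x)).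
  by apply: eq_bigr => k _; rewrite (pw_ibp ha (P := v^~ k)) ?opprK //; exact: cv.
rewrite sumrN; congr (- _).
apply: etrans (esym (I3_pw_sum (fun k l => pd k (v l k)) tp)) _.
by congr I3; apply/funext => x; rewrite /pw -dv.
Qed.

Lemma pl_open_eq0 (p : pl) (U : set 'rV[R]_3) c : open U -> U c ->
  (forall x, U x -> ev x p = 0) -> p = 0.
Proof.
move=> oU Uc H; apply: ev_inj0 => x; have [e e0 eU] := open_box oU Uc.
pose V := \sum_j `|(x - c) 0 j| + 1.
have V0 : 0 < V by rewrite ltr_wpDl // sumr_ge0.
have -> : x = c + 1 *: (x - c) by rewrite scale1r addrC subrK.
apply: (line_zero (divr_gt0 e0 V0)) => t t0 te.
apply/H/eU => j.
have -> : c 0 j - (c + t *: (x - c)) 0 j = - (t * (x - c) 0 j).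
  by rewrite [in X in _ - X]mxE [X in _ - (_ + X)]mxE; ring.
rewrite normrN normrM gtr0_norm //; move: te; rewrite ltr_pdivlMr //.
apply: le_lt_trans; rewrite ler_pM2l // /V (bigD1 j) //= -addrA lerDl.
by rewrite addr_ge0 // sumr_ge0.
Qed.

Lemma I3_pos (f g : 'rV[R]_3 -> R) x : integ f -> (forall y, 0 <= f y) -> {for x, continuous g} ->
  0 < g x -> (\forall y \near x, g y = f y) -> 0 < I3 f.
Proof.
move=> fi f0 cg gx gf.
have : \forall y \near x, g x / 2 < f y.
  have g2 : g x / 2 < g x by rewrite ltr_pdivrMr // ltr_pMr // ltr1n.
  have : \forall y \near x, g x / 2 < g y by exact: cg _ (lt_nbhsr g2).
  by apply: filterS2 gf => y ->.
move=> /nbhs_ballP[e /= e0 eA].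
apply: (@I3_gt0 R f x e (g x / 2)) => //; first by rewrite divr_gt0.
move=> y xy; apply: ltW; apply: eA; split => // i j.
by rewrite (ord1 i); exact: xy.
Qed.

Definition inside l := [set x : 'rV[R]_3 | 0 < blam a l x /\ forall j, j != l -> blam a l x < blam a j x].

Lemma open_inside l : open (inside l).
Proof.
pose p (j : 'I_4) : pl := if j == l then Mu l + cst 4^-1 else Mu j - Mu l.
have -> : inside l = [set x : 'rV[R]_3 | forall j, 0 < ev x (p j)].
  apply/seteqP; split=> x /= H.
    move=> j; rewrite /p; case: (eqVneq j l) => [_|jl].
      by rewrite evD evC -blam_ev; case: H.
    by rewrite evB subr_gt0 -(ltrD2r 4^-1) -!blam_ev; case: H => _; exact.
  split=> [|j jl]; first by have := H l; rewrite /p eqxx evD evC -blam_ev.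
  by have := H j; rewrite /p (negbTE jl) evB subr_gt0 -(ltrD2r 4^-1) -!blam_ev.
exact: open_pos.
Qed.

Lemma inside_nonempty l : inside l (o - 5^-1 *: r l).
Proof.
have E j : blam a j (o - 5^-1 *: r l) = 4^-1 - 5^-1 * ((j == l)%:R - 4^-1).
  by rewrite -scaleNr blam_shift dotpZr d_r // blam_o mulNr.
split=> [|j /negbTE jl]; rewrite !E eqxx ?jl /=; lra.
Qed.

Lemma inside_interior l x : inside l x -> interior T x.
Proof.
move=> [l0 lj]; apply: interior_tetra => // j.
by have [->//|/lj] := eqVneq j l; exact: lt_trans.
Qed.

Lemma inside_reg l x : inside l x -> reg a x = l.
Proof. by move=> [_ H]; apply: reg_uniq. Qed.

Definition ballq (x0 : 'rV[R]_3) (e : R) : pl := cst (e ^+ 2) - \sum_j (X j - cst (x0 0 j)) ^+ 2.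

Lemma ballq_cbox x0 e x : 0 < e -> 0 < ev x (ballq x0 e) -> cbox x0 e x.
Proof.
move=> e0; rewrite !evE subr_gt0 => H j; rewrite -(ltr_pXn2r (ltn0Sn 1)) ?nnegrE // ?ltW //.
apply: le_lt_trans H; rewrite (bigD1 j) //= !evE real_normK ?num_real // -sqrrN opprB lerDl.
by apply: sumr_ge0 => i _; rewrite !evE sqr_ge0.
Qed.

Lemma ballq_center x0 e : ev x0 (ballq x0 e) = e ^+ 2.
Proof.
by rewrite !evE big1 ?subr0 // => j _; rewrite !evE subrr expr0n.
Qed.

Lemma bump_gt0 k (t : R) : 0 < t -> 0 < bump k t.
Proof. by move=> t0; rewrite /bump t0 mulr_gt0 ?expR_gt0 // invr_gt0 exprn_gt0. Qed.

(** At a point of an open cell where [P l] is nonzero, a bump supported where [P l] keeps its sign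
    would have a nonzero integral against it; so [P l] vanishes on an open set. *)
Lemma pw_weak0 P : (forall phi, test_fun T phi -> I3 (fun x => pw P x * phi x) = 0) ->
  forall l, P l = 0.
Proof.
move=> H l; refine (@pl_open_eq0 (P l) (inside l) _ (@open_inside l) (@inside_nonempty l) _) => x0 Ux0.
apply/eqP/negPn/negP => nz; pose s := Num.sg (ev x0 (P l)).
have sp : 0 < s * ev x0 (P l) by rewrite -normrEsg normr_gt0.
have oV : open (inside l `&` [set x | forall i : 'I_1, 0 < ev x (s *: P l)]).
  by apply: openI; [exact: open_inside|exact: open_pos].
have [|e e0 eV] := open_box oV (x := x0); first by split => // _; rewrite evZ.
pose phi := bumpf 0 (ballq x0 (e / 2)).
have e20 : 0 < e / 2 by rewrite divr_gt0.
have e2 : e / 2 < e by rewrite ltr_pdivrMr // ltr_pMr // ltr1n.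
have tp : test_fun T phi.
  apply: (@bumpf_test _ _ _ x0 (e / 2)) => [x|x h]; first exact: ballq_cbox.
  apply: (@inside_interior l); have [] // := eV x _.
  by move=> j; exact: le_lt_trans (h j) e2.
have phi0 x : ~ cbox x0 e x -> phi x = 0.
  move=> nx; rewrite /phi /bumpf /bump; case: ifP => // /(ballq_cbox e20) h.
  by exfalso; apply: nx => j; exact: lt_trans (h j) e2.
have : 0 < I3 (fun x => s * (pw P x * phi x)).
  apply: (@I3_pos _ (fun x => evf (s *: P l) x * phi x) x0).
  - by apply: integZ; exact: integ_pw.
  - move=> x; have [cx|/phi0 ->] := pselect (cbox x0 e x); last by rewrite !mulr0.
    have [Ux /(_ ord0)] := eV x cx; rewrite evZ /pw (inside_reg Ux) mulrA => h.
    exact: mulr_ge0 (ltW h) (bump_ge0 _ _).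
  - apply: continuousM; first exact: evf_cont.
    exact: test_cont tp x0.
  - by rewrite mulr_gt0 // ?/evf ?evZ // /phi /bumpf ballq_center bump_gt0 // exprn_gt0.
  - have : nbhs x0 (inside l) by apply: open_nbhs_nbhs; split => //; exact: open_inside.
    by apply: filterS => x Ux; rewrite /evf evZ /pw (inside_reg Ux) mulrA.
by rewrite I3Z ?H ?mulr0 ?ltxx //; exact: integ_pw.
Qed.
End Weak.

(** * Identification of an integrable weak divergence with the piecewise one *)

Section Identify.
Context {R : realType}.
Local Notation pl := (pl R).
Variable a : 'I_4 -> 'rV[R]_3.
Hypothesis ha : nondegenerate_tetra a.
Local Notation d := (blam_grad a).
Local Notation o := (barycenter a).
Local Notation r := (bary_vec a).
Local Notation T := (tetra a).
Local Notation Cont := (cont o d).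
Local Notation Ncont := (ncont o d).
Local Notation Mu := (mu o d).
Local Notation pw := (pw a).

(** A smooth approximation of the indicator of the cone of [l]: it vanishes off the cone, and in its
    interior each factor [exp (- 1 / ((n + 1) (mu j - mu l)))] tends to 1. *)
Definition cutoff (l : 'I_4) (n : nat) (x : 'rV[R]_3) : R :=
  \prod_j (if j == l then 1 else bump 0 (ev x (n.+1%:R *: (Mu j - Mu l)))).

Lemma prod_Cinfty (I : Type) (s : seq I) (F : I -> 'rV[R]_3 -> R) :
  (forall j, Cinfty (F j)) -> Cinfty (fun x => \prod_(j <- s) F j x).
Proof.
move=> H; elim: s => [|j s IH].
  have -> : (fun x => \prod_(j <- [::]) F j x) = evf 1.
    by apply/funext => x; rewrite big_nil /evf ev1.
  exact: evf_Cinfty.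
have -> : (fun x => \prod_(i <- j :: s) F i x) = fun x => F j x * \prod_(i <- s) F i x.
  by apply/funext => x; rewrite big_cons.
exact: CinftyM.
Qed.

Lemma cutoff_Cinfty l n : Cinfty (cutoff l n).
Proof.
apply: prod_Cinfty => j; case: eqP => _; last exact: bumpf_Cinfty.
have -> : (fun _ : 'rV[R]_3 => 1 : R) = evf 1 by apply/funext => x; rewrite /evf ev1.
exact: evf_Cinfty.
Qed.

Lemma bump0_le1 (t : R) : bump 0 t <= 1.
Proof.
rewrite /bump; case: ifP => // t0; rewrite expr0 invr1 mul1r.
by rewrite -expR0 ler_expR oppr_le0 invr_ge0 ltW.
Qed.

Lemma cutoff_bound l n x : `|cutoff l n x| <= 1.
Proof.
rewrite normr_prod; apply: prodr_ile1 => j _; rewrite normr_ge0 /=.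
by case: eqP => _; rewrite ?normr1 // ger0_norm ?bump_ge0 // bump0_le1.
Qed.

Lemma cutoff0 l n x : reg a x != l -> cutoff l n x = 0.
Proof.
move=> rl; rewrite /cutoff (bigD1 (reg a x)) //= (negbTE rl) /bump evZ evB.
rewrite pmulr_rgt0 ?ltr0Sn // subr_gt0 ltNge reg_mu //= mul0r //.
Qed.

Lemma cvg_prod1 (I : Type) (s : seq I) (F : I -> nat -> R) :
  (forall j, F j n @[n --> \oo] --> (1 : R)) ->
  (\prod_(j <- s) F j n) @[n --> \oo] --> (1 : R).
Proof.
move=> H; elim: s => [|j s IH].
  by under eq_fun do rewrite big_nil; exact: cvg_cst.
under eq_fun do rewrite big_cons.
by have /= := cvgM (H j) IH; rewrite mulr1; apply.
Qed.

Lemma cutoff_cvg x : generic a x ->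
  (\sum_l cutoff l n x) @[n --> \oo] --> (1 : R).
Proof.
move=> gx.
have -> : (fun n => \sum_l cutoff l n x) = fun n => cutoff (reg a x) n x.
  apply/funext => n; rewrite (bigD1 (reg a x)) //= big1 ?addr0 // => l lr.
  by rewrite cutoff0 // eq_sym.
apply: cvg_prod1 => j; case: (eqVneq j (reg a x)) => [_|jr]; first exact: cvg_cst.
set t := ev x (Mu j - Mu (reg a x)).
have t0 : 0 < t.
  rewrite /t evB subr_gt0 lt_neqAle reg_mu // andbT; apply/eqP => E.
  by apply: (gx j (reg a x) jr); rewrite !blam_ev E.
have -> : (fun n => bump 0 (ev x (n.+1%:R *: (Mu j - Mu (reg a x))))) =
    expR \o (fun n => - t^-1 * n.+1%:R^-1).
  apply/funext => n; rewrite evZ -/t /bump pmulr_rgt0 ?ltr0Sn // t0 expr0 invr1 mul1r /=.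
  by rewrite invfM mulrC mulNr.
have c0 : (fun n : nat => - t^-1 * n.+1%:R^-1) @ \oo --> (- t^-1 * 0 : R).
  exact: (cvgM (cvg_cst _) (@cvg_harmonic R)).
have cE := cvg_comp _ _ c0 (@continuous_expR R (- t^-1 * 0)).
by rewrite mulr0 expR0 in cE.
Qed.

Lemma integ_mulb (G h : 'rV[R]_3 -> R) B : integ G -> mf3 h -> (forall x, `|h x| <= B) ->
  integ (fun x => G x * h x).
Proof.
move=> Gi mh hB; apply: (le_integrable measurableT _ _ (integZ B Gi)).
  by apply/measurable_EFinP; apply: mf3M => //; exact: integ_mf.
move=> x _ /=; rewrite lee_fin !normrM mulrC ler_wpM2r //.
by apply: le_trans (hB _) _; exact: ler_norm.
Qed.

Lemma integ_norm (G : 'rV[R]_3 -> R) : integ G -> integ (fun x => `|G x|).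
Proof.
move=> Gi; apply: (le_integrable measurableT _ _ Gi).
  apply/measurable_EFinP; apply: measurableT_comp => //; exact: integ_mf.
by move=> x _ /=; rewrite lee_fin normr_id.
Qed.

(** The product [phi * cutoff l n] sees only the cell [l], so [w] may be replaced by the single
    polynomial field [w l], which has no jumps. *)
Lemma cutoff_ibp w l n phi : test_fun T phi ->
  \sum_k - I3 (fun x => pw (w^~ k) x * pderiv k (fun y => phi y * cutoff l n y) x) =
  I3 (fun x => pw (fun l => div (w l)) x * (phi x * cutoff l n x)).
Proof.
move=> tp; pose psi := fun y => phi y * cutoff l n y; rewrite -/psi; have tpsi : test_fun T psi by apply: test_mul => //; exact: cutoff_Cinfty.
have -> : (fun x => pw (fun l => div (w l)) x * (phi x * cutoff l n x)) =
    fun x => pw (fun=> div (w l)) x * psi x.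
  apply/funext => x; have [e|rl] := eqVneq (reg a x) l; first by rewrite /pw e.
  by rewrite /psi cutoff0 // !mulr0.
have nc : Ncont (fun=> w l).
  by move=> i j x _; apply: big1 => k _; rewrite /jump subrr mulr0.
have := pw_div_ibp ha nc tpsi => /(congr1 -%R); rewrite opprK => <-.
rewrite sumrN; congr (- _); apply: eq_bigr => k _.
have tk := test_pderiv k tpsi.
have mk : mf3 (pderiv k psi) by have [] := test_nice tk.
apply: I3_ae; [by apply: mf3M => //; exact: mf3_pw|by apply: mf3M => //; exact: mf3_pw|].
apply: filterS (ae_generic ha) => p gp; have [e|rl] := eqVneq (reg a (vec3 p)) l; first by rewrite /pw e.
have -> : pderiv k psi (vec3 p) = 0; last by rewrite !mulr0.
transitivity ('D_(edir k) (functions.cst (0 : R)) (vec3 p)); last exact: derive_cst.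
apply: near_eq_derive; apply: filterS (generic_near gp) => y /= ry.
by rewrite /psi cutoff0 ?mulr0 // ry.
Qed.

(** Test with [phi * cutoff l n], sum over [l] and let [n] grow: the cutoffs add up to a function
    bounded by 4 and tending to 1 almost everywhere. Nothing about the jumps of [w] enters. *)
Lemma weak_div_identify w (G : 'rV[R]_3 -> R) : integ G ->
    (forall phi, test_fun T phi ->
      \sum_k - I3 (fun x => pw (w^~ k) x * pderiv k phi x) = I3 (fun x => G x * phi x)) ->
  forall phi, test_fun T phi ->
    I3 (fun x => G x * phi x) = I3 (fun x => pw (fun l => div (w l)) x * phi x).
Proof.
move=> Gi H phi tp.
have [B B0 HB] := test_bound tp.
have mphi : mf3 phi by have [] := test_nice tp.
have mcut l n : mf3 (cutoff l n).
  by apply: mf3_cont; apply: Cinfty_cont; exact: cutoff_Cinfty.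
have msum n : mf3 (fun x => \sum_l cutoff l n x) by apply: mf3_sum.
have cv (F : 'rV[R]_3 -> R) : integ F ->
    I3 (fun x => (F x * phi x) * (\sum_l cutoff l n x)) @[n --> \oo] --> I3 (fun x => F x * phi x).
  move=> Fi; have Fp := integ_mulb Fi mphi HB.
  apply: (@dct R _ _ (fun x => 4 * `|F x * phi x|)).
  - by move=> n; apply: mf3M => //; exact: integ_mf.
  - exact: integ_mf.
  - apply: filterS (ae_generic ha) => p gp.
    have := cvgM (cvg_cst (F (vec3 p) * phi (vec3 p))) (cutoff_cvg gp); rewrite mulr1; apply.
  - by apply: integZ; exact: integ_norm.
  - move=> n x; rewrite normrM mulrC ler_wpM2r //.
    apply: le_trans (ler_norm_sum _ _ _) _.
    apply: (@le_trans _ _ (\sum_(l < 4) 1)); first by apply: ler_sum => l _; exact: cutoff_bound.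
    by rewrite sumr_const card_ord.
have [K K0 HK] := test_box tp.
(* The piecewise divergence is truncated to a box carrying [phi], to be integrable over the whole
   space. *)
pose D x := pw (fun l => div (w l)) x * \1_[set x | bbox K x] x.
have Di : integ D.
  have [C C0 HC] := pw_bound a (fun l => div (w l)) K.
  have mD : mf3 D by apply: mf3M; [exact: mf3_pw|exact: integ_mf (integ_box K)].
  apply: (integ_le mD (integZ C (integ_box K))) => x; rewrite /D indicE.
  have [h|h] := pselect (bbox K x); last by rewrite memNset // !mulr0 normr0.
  by rewrite mem_set // !mulr1; exact: HC.
have DE x : D x * phi x = pw (fun l => div (w l)) x * phi x.
  rewrite /D indicE; have [h|h] := pselect (bbox K x); last by rewrite HK // !mulr0.
  by rewrite mem_set // mulr1.
have E n : I3 (fun x => (G x * phi x) * (\sum_l cutoff l n x)) =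
           I3 (fun x => (D x * phi x) * (\sum_l cutoff l n x)).
  have S (F : 'rV[R]_3 -> R) : integ F -> I3 (fun x => (F x * phi x) * (\sum_l cutoff l n x)) =
     \sum_l I3 (fun x => F x * (phi x * cutoff l n x)).
    move=> Fi; rewrite -I3_sum.
      by congr I3; apply/funext => x; rewrite -mulrA mulr_sumr mulr_sumr.
    move=> l; apply: (@integ_mulb _ _ B) => //; first exact: mf3M.
    move=> x; rewrite normrM -[B]mulr1; apply: ler_pM => //; exact: cutoff_bound.
  rewrite !S //; apply: eq_bigr => l _.
  rewrite -H; last by apply: test_mul => //; exact: cutoff_Cinfty.
  rewrite cutoff_ibp //; congr I3; apply/funext => x.
  by rewrite [LHS]mulrA [RHS]mulrA DE.
have := cv D Di; have := cv G Gi.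
have -> : (fun n => I3 (fun x => (G x * phi x) * (\sum_l cutoff l n x))) =
    fun n => I3 (fun x => (D x * phi x) * (\sum_l cutoff l n x)).
  exact/funext.
move=> c1 c2; have := cvg_unique _ c1 c2.
move=> ->//; by congr I3; apply/funext => x; exact: DE.
Qed.
End Identify.

(** * A lens-shaped test function detects normal jumps *)

Section Lens.
Context {R : realType}.
Local Notation pl := (pl R).
Variable a : 'I_4 -> 'rV[R]_3.
Hypothesis ha : nondegenerate_tetra a.
Local Notation d := (blam_grad a).
Local Notation o := (barycenter a).
Local Notation r := (bary_vec a).
Local Notation T := (tetra a).
Local Notation Ncont := (ncont o d).
Local Notation Mu := (mu o d).
Local Notation pw := (pw a).

Lemma bump2E (t : R) : 0 < t -> bump 2 t = t ^- 2 * bump 0 t.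
Proof. by move=> t0; rewrite /bump t0 expr0 invr1 mul1r. Qed.

(** With [y = x - x0] this is [e^2 - |y|^2 + 2 s n . y]. It is positive on the ball centred at
    [x0 + s n] whose boundary meets the plane [n . y = 0] in the circle of radius [e] about [x0]. *)
Definition lensq (x0 n : 'rV[R]_3) (e s : R) : pl :=
  cst (e ^+ 2) - \sum_k (X k - cst (x0 0 k)) ^+ 2 +
  \sum_k (2 * s * n 0 k) *: (X k - cst (x0 0 k)).

Lemma pd_lensq x0 n e s x k :
  ev x (pd k (lensq x0 n e s)) = 2 * s * n 0 k - 2 * (x 0 k - x0 0 k).
Proof.
rewrite /lensq pdD pdB pdC !pd_sum (bigD1 k) //= [X in _ + X](bigD1 k) //=.
rewrite big1 => [|j /negbTE jk]; last first.
  by rewrite expr2 pdM pdB pdX pdC eq_sym jk subrr mul0r mulr0 addr0.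
rewrite [X in _ + (_ + X)]big1 => [|j /negbTE jk]; last first.
  by rewrite pdZ pdB pdX pdC eq_sym jk subrr scaler0.
by rewrite expr2 pdZ pdM !pdB pdX !pdC eqxx !evE /=; ring.
Qed.

(* The lens [lensq x0 n e s > 0] meets the side [n . (x - x0) <= 0] of the face in a cap
   of radius [e], while its total diameter is of order [s]. *)
Lemma lensq_bound x0 n e s x : 0 < ev x (lensq x0 n e s) -> e <= s -> 0 < e ->
  \sum_k (x 0 k - x0 0 k) ^+ 2 < s ^+ 2 * (2 + 4 * \sum_k n 0 k ^+ 2).
Proof.
rewrite /lensq !evE; under eq_bigr do rewrite !evE.
under [X in _ + X]eq_bigr do rewrite !evE.
rewrite !sum3; set y0 := x 0 0 - _; set y1 := x 0 1 - _; set y2 := x 0 2 - _.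
move=> H es e0.
have s0 : 0 < s by exact: lt_le_trans es.
have h : e ^+ 2 <= s ^+ 2 by rewrite ler_pXn2r // nnegrE ltW.
have := sqr_ge0 (y0 - 2 * s * n 0 0); have := sqr_ge0 (y1 - 2 * s * n 0 1).
have := sqr_ge0 (y2 - 2 * s * n 0 2); nra.
Qed.

Lemma lensq_cap x0 n e s x : 0 < ev x (lensq x0 n e s) -> 0 < s ->
  \sum_k n 0 k * (x 0 k - x0 0 k) <= 0 ->
  \sum_k (x 0 k - x0 0 k) ^+ 2 < e ^+ 2 /\ ev x (lensq x0 n e s) <= e ^+ 2.
Proof.
rewrite /lensq !evE; under eq_bigr do rewrite !evE.
under [X in _ + X]eq_bigr do rewrite !evE.
rewrite !sum3; set y0 := x 0 0 - _; set y1 := x 0 1 - _; set y2 := x 0 2 - _.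
move=> H s0 N; have := sqr_ge0 y0; have := sqr_ge0 y1; have := sqr_ge0 y2.
have : s * (n 0 0 * y0 + n 0 1 * y1 + n 0 2 * y2) <= 0 by rewrite pmulr_rle0.
by move=> *; split; lra.
Qed.

Lemma sqr_coord (x0 x : 'rV[R]_3) e : 0 <= e -> \sum_k (x 0 k - x0 0 k) ^+ 2 < e ^+ 2 ->
  forall j, `|x0 0 j - x 0 j| < e.
Proof.
move=> e0 H j; rewrite -(ltr_pXn2r (ltn0Sn 1)) ?nnegrE //.
apply: le_lt_trans H; rewrite (bigD1 j) //= real_normK ?num_real // -sqrrN opprB lerDl.
by apply: sumr_ge0 => i _; rewrite sqr_ge0.
Qed.

(* On the cap the transversal term [q . grad t * t^-2] dominates. *)
Lemma cap_estimate (t eps c dq : R) : 0 < t -> t <= eps ^+ 2 -> 0 < eps -> eps <= 1 ->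
  `|dq| * eps < c -> 0 < c * bump 2 t + dq * bump 0 t.
Proof.
move=> t0 te e0 e1 H; have b0 := bump_gt0 0 t0.
rewrite bump2E // mulrA -mulrDl pmulr_lgt0 //.
have t2 : t ^+ 2 <= eps.
  have : t ^+ 2 <= (eps ^+ 2) ^+ 2 by rewrite ler_pXn2r // nnegrE ltW // exprn_gt0.
  move/le_trans; apply; rewrite -exprM -[leRHS]expr1; apply: ler_wiXn2l => //; exact: ltW.
have t2i : eps^-1 <= t ^- 2 by rewrite lef_pV2 ?posrE ?exprn_gt0.
have c0 : 0 < c by apply: le_lt_trans H; rewrite mulr_ge0 // ltW.
have h1 : `|dq| < c * t ^- 2.
  by apply: (@lt_le_trans _ _ (c * eps^-1)); [rewrite ltr_pdivlMr|rewrite ler_pM2l].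
have : - dq <= `|dq| by rewrite -normrN ler_norm.
lra.
Qed.

Variable w : 'I_4 -> 'I_3 -> pl.
Hypothesis w0 : forall phi, test_fun T phi ->
  \sum_k I3 (fun x => pw (w^~ k) x * pderiv k phi x) +
  I3 (fun x => pw (fun l => div (w l)) x * phi x) = 0.

(** An open neighbourhood of the relative interior of the interface, on which only the cells [i] and
    [j] occur. *)
Definition face_inside i j := [set x : 'rV[R]_3 | [/\ 0 < blam a i x, 0 < blam a j x &
  forall k, k != i -> k != j -> blam a i x < blam a k x /\ blam a j x < blam a k x]].

Lemma open_face_inside i j : open (face_inside i j).
Proof.
pose p (u : 'I_4 * bool) : pl := let m := if u.2 then i else j in
  if (u.1 == i) || (u.1 == j) then Mu m + cst 4^-1 else Mu u.1 - Mu m.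
have -> : face_inside i j = [set x : 'rV[R]_3 | forall u, 0 < ev x (p u)].
  apply/seteqP; split=> x /=.
    move=> [h1 h2 h3] [k b]; rewrite /p /=; case: ifP => [_|/negbT].
      by rewrite evD evC -blam_ev; case: b.
    rewrite negb_or => /andP[ki kj]; have [h4 h5] := h3 k ki kj.
    by rewrite evB subr_gt0 -(ltrD2r 4^-1) -!blam_ev; case: b.
  move=> H; split.
  - by have := H (i, true); rewrite /p /= eqxx evD evC -blam_ev.
  - by have := H (i, false); rewrite /p /= eqxx evD evC -blam_ev.
  - move=> k ki kj; split.
      by have := H (k, true); rewrite /p /= (negbTE ki) (negbTE kj) evB subr_gt0 -(ltrD2r 4^-1) -!blam_ev.
    by have := H (k, false); rewrite /p /= (negbTE ki) (negbTE kj) evB subr_gt0 -(ltrD2r 4^-1) -!blam_ev.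
exact: open_pos.
Qed.

Lemma face_inside_interior i j x : face_inside i j x -> interior T x.
Proof.
move=> [i0 j0 H]; apply: interior_tetra => // k.
have [->//|ki] := eqVneq k i; have [->//|kj] := eqVneq k j.
by have [h _] := H k ki kj; exact: lt_trans h.
Qed.

Lemma face_inside_reg i j x : face_inside i j x -> reg a x = i \/ reg a x = j.
Proof.
move=> [i0 j0 H]; have [|ki] := eqVneq (reg a x) i; first by left.
have [|kj] := eqVneq (reg a x) j; first by right.
by have [h _] := H _ ki kj; have := reg_min a x i; rewrite leNgt h.
Qed.

(** Test with the bump of a lens bulging into the cell [j]. After subtraction of the global
    polynomial [w j], the integrand lives on the thin cap in the cell [i]. There the gradient of the
    bump is nearly [2 s n] times [bump 2], so the normal jump contributes a positive multiple of
    [bump 2], which dominates the divergence term by [cap_estimate]. A nonnegative integrand,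
    positive somewhere, would have integral zero. *)
Lemma lens_absurd i j x0 : i != j -> on_face o d i j x0 -> face_inside i j x0 ->
  0 < ev x0 (\sum_k (d i - d j) 0 k *: (w i k - w j k)) -> False.
Proof.
move=> ij xij Fx; set Q := \sum_k _; set Q0 := ev x0 Q => Qpos.
pose n := d i - d j; pose N2 := \sum_k n 0 k ^+ 2.
have N20 : 0 < N2.
  rewrite lt_neqAle sumr_ge0 ?andbT; last by move=> k _; rewrite sqr_ge0.
  rewrite eq_sym; apply/eqP => N0.
  have n0 k : n 0 k = 0.
    by apply/eqP; rewrite -sqrf_eq0; move/eqP: N0; rewrite psumr_eq0 => [/allP/(_ k (mem_index_enum _))|m _]; rewrite ?sqr_ge0.
  have : dotp n (r i) = 1 by rewrite /n dotpBl !d_r // eqxx eq_sym (negbTE ij) /=; ring.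
  by rewrite /dotp big1 => [/eqP|k _]; rewrite ?n0 ?mul0r // eq_sym oner_eq0.
pose V := face_inside i j `&` [set x | forall _ : 'I_1, 0 < ev x (Q - cst (Q0 / 2))].
have oV : open V by apply: openI; [exact: open_face_inside|exact: open_pos].
have [|de de0 dV] := open_box oV (x := x0).
  by split => // _; rewrite evB evC -/Q0 subr_gt0 ltr_pdivrMr // ltr_pMr // ltr1n.
pose M := \sum_k `|x0 0 k| + de.
have cM x : cbox x0 de x -> bbox M x.
  move=> cx k; rewrite -[x 0 k](subKr (x0 0 k)).
  apply: le_lt_trans (ler_normB _ _) _; apply: ler_ltD; last exact: cx.
  by rewrite (bigD1 k) //= lerDl sumr_ge0.
have /fin_all_exists2[B B0 HB] k := pl_bound (w i k - w j k) M.
pose Bq := \sum_k B k.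
have Bq0 : 0 <= Bq by apply: sumr_ge0.
have [D D0 HD] := pl_bound (div (w i) - div (w j)) M.
(* Small enough that the whole lens lies within [de / 2] of [x0], by [lensq_bound]. *)
pose s := de / (4 * (1 + N2)).
have n40 : 0 < 4 * (1 + N2) by rewrite mulr_gt0 // addr_gt0.
have s0 : 0 < s by rewrite divr_gt0.
have sde : s ^+ 2 * (2 + 4 * N2) <= (de / 2) ^+ 2.
  have -> : de = s * (4 * (1 + N2)) by rewrite divfK // gt_eqF.
  have := sqr_ge0 s; set s2 := s ^+ 2.
  have -> : (s * (4 * (1 + N2)) / 2) ^+ 2 = s2 * (4 * (1 + N2) ^+ 2) by rewrite /s2; field.
  move=> s20; apply: ler_wpM2l => //; nra.
(* With [eps * den <= s * Q0], the main term [s * Q0] beats both the deviation of the gradient from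
   the normal, at most [2 * Bq * eps], and the divergence term, at most [D * eps]. *)
pose den := 12 * Bq + 2 * D + 2.
have den0 : 0 < den by rewrite ltr_wpDl // addr_ge0 // mulr_ge0.
pose eps := Num.min (Num.min 1 s) (s * Q0 / den).
have eps0 : 0 < eps by rewrite !lt_min ltr01 s0 divr_gt0 // mulr_gt0.
have eps1 : eps <= 1 by rewrite !ge_min lexx.
have epss : eps <= s by rewrite !ge_min lexx orbT.
have epsd : eps * den <= s * Q0 by rewrite -ler_pdivlMr // ge_min lexx orbT.
pose t := lensq x0 n eps s; pose phi := bumpf 0 t.
have tbox x : 0 < ev x t -> forall k, `|x0 0 k - x 0 k| < de / 2.
  move=> tx; apply: sqr_coord; first by rewrite ltW // divr_gt0.
  by apply: lt_le_trans sde; exact: lensq_bound tx epss eps0.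
have de2 : de / 2 < de by rewrite ltr_pdivrMr // ltr_pMr // ltr1n.
have tV x : 0 < ev x t -> V x.
  by move=> /tbox h; apply: dV => k; exact: lt_trans (h k) de2.
have tp : test_fun T phi.
  apply: (@bumpf_test _ _ _ x0 (de / 2)) => [x /tbox//|x h].
  apply: (@face_inside_interior i j); have [] // := dV x _.
  by move=> k; exact: le_lt_trans (h k) de2.
have dphi k x : pderiv k phi x = ev x (pd k t) * bump 2 (ev x t).
  by have [_ ->] := bumpf_diff 0 t; rewrite /evf /bumpf oppr0 mul0r add0r.
(* The field [w j] satisfies the weak identity by [pw_div_ibp], so subtracting it keeps the integral
   zero and makes the integrand vanish in the cell [j]. *)
pose f x := \sum_k pw (fun l => w l k - w j k) x * pderiv k phi x +
            pw (fun l => div (w l) - div (w j)) x * phi x.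
have tk k := test_pderiv k tp.
have fi : integ f.
  by apply: integD; [apply: integ_sum => k|]; exact: integ_pw.
have f_0 : I3 f = 0.
  rewrite /f I3D; [|by apply: integ_sum => k; exact: integ_pw|exact: integ_pw].
  rewrite I3_sum; last by move=> k; exact: integ_pw.
  have nc : Ncont (fun=> w j).
    by move=> i' j' x _; apply: big1 => k _; rewrite /jump subrr mulr0.
  have e1 := w0 tp; have e2 := pw_div_ibp ha nc tp.
  rewrite (eq_bigr _ (fun k _ => I3_pwB (w^~ k) (fun=> w j k) (tk k))) sumrB.
  rewrite (I3_pwB (fun l => div (w l)) (fun=> div (w j)) tp).
  by rewrite e2 opprK addrACA e1 subrr addr0.
have fneg x : ev x t <= 0 -> f x = 0.
  move=> tx; rewrite /f big1 => [|k _]; rewrite ?dphi /phi /bumpf /bump ltNge tx /= !mulr0 ?addr0 //.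
have nE (x : 'rV[R]_3) : \sum_k n 0 k * (x 0 k - x0 0 k) = blam a i x - blam a j x.
  have -> : blam a i x - blam a j x = (blam a i x - blam a j x) - (blam a i x0 - blam a j x0).
    by rewrite !blam_ev [ev x0 (Mu i)]xij subrr subr0.
  rewrite /blam.
  have -> : forall A B C E z : R, A + z - (B + z) - (C + z - (E + z)) = (A - B) - (C - E) by move=> *; ring.
  rewrite -!dotpBl -dotpBr opprB addrA subrK.
  by apply: eq_bigr => k _; rewrite !mxE.
pose g x := \sum_k ev x (w i k - w j k) * (ev x (pd k t) * bump 2 (ev x t)) +
            ev x (div (w i) - div (w j)) * bump 0 (ev x t).
have fg x : reg a x = i -> f x = g x.
  move=> rx; rewrite /f /g /pw rx; congr (_ + _); apply: eq_bigr => k _.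
  by rewrite dphi.
have gpos x : 0 < ev x t -> blam a i x <= blam a j x -> 0 < g x.
  move=> tx bx; have [_ /(_ ord0)] := tV x tx; rewrite evB evC subr_gt0 => Qx.
  have nx : \sum_k n 0 k * (x 0 k - x0 0 k) <= 0 by rewrite nE subr_le0.
  have [ys yt] := lensq_cap tx s0 nx.
  have yc := sqr_coord (ltW eps0) ys.
  have bM : bbox M x by apply: cM => k; exact: lt_trans (tbox x tx k) de2.
  have -> : g x = (\sum_k ev x (w i k - w j k) * ev x (pd k t)) * bump 2 (ev x t) +
      ev x (div (w i) - div (w j)) * bump 0 (ev x t).
    by rewrite /g mulr_suml; congr (_ + _); apply: eq_bigr => k _; rewrite mulrA.
  apply: (@cap_estimate _ eps) => //.
  have -> : \sum_k ev x (w i k - w j k) * ev x (pd k t) =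
      2 * s * ev x Q - \sum_k 2 * (ev x (w i k - w j k) * (x 0 k - x0 0 k)).
    rewrite /Q ev_sum mulr_sumr -sumrB; apply: eq_bigr => k _.
    by rewrite pd_lensq evZ; ring.
  have h1 : s * Q0 <= 2 * s * ev x Q.
    have gen (u b c : R) : 0 <= u -> b <= c * 2 -> u * b <= 2 * u * c by clear; move=> *; nra.
    by apply: gen; [exact: ltW|rewrite -ler_pdivrMr // ltW].
  have h2 : \sum_k 2 * (ev x (w i k - w j k) * (x 0 k - x0 0 k)) <= 2 * Bq * eps.
    rewrite /Bq mulr_sumr mulr_suml; apply: ler_sum => k _; rewrite -mulrA ler_wpM2l //.
    apply: le_trans (ler_norm _) _; rewrite normrM; apply: ler_pM => //; first exact: HB.
    by rewrite distrC ltW.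
  have h3 : `|ev x (div (w i) - div (w j))| * eps <= D * eps.
    by rewrite ler_wpM2r ?HD // ltW.
  have h4 : eps * den = 12 * Bq * eps + 2 * D * eps + 2 * eps by rewrite /den; ring.
  have h5 : 0 <= Bq * eps by rewrite mulr_ge0 // ltW.
  have h6 : 0 <= D * eps by rewrite mulr_ge0 // ltW.
  move: epsd; rewrite h4 => epsd; lra.
have f_ge0 x : 0 <= f x.
  have [tx|tx] := leP (ev x t) 0; first by rewrite fneg.
  have [Fxx _] := tV x tx; have [rx|rx] := face_inside_reg Fxx.
    by rewrite fg // ltW // gpos // -rx; exact: reg_min.
  rewrite /f /pw rx big1 => [|k _]; by rewrite subrr ev0 mul0r ?addr0.
(* A step against the normal, short enough to stay in the lens, leads from the face into the open
   cell [i], where the integrand is positive. *)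
pose tau := eps ^+ 2 / (2 * (1 + N2 * (1 + 2 * s))).
pose x1 := x0 - tau *: n.
have c0 : 0 < 1 + N2 * (1 + 2 * s) by rewrite ltr_wpDr // mulr_ge0 ?ltW // addr_gt0 // mulr_gt0.
have tau0 : 0 < tau by rewrite divr_gt0 ?exprn_gt0 // mulr_gt0.
have x1E k : x1 0 k - x0 0 k = - (tau * n 0 k) by rewrite /x1 !mxE; ring.
have t1 : 0 < ev x1 t.
  rewrite /t /lensq !evE; under eq_bigr do rewrite !evE x1E sqrrN exprMn.
  under [X in _ + X]eq_bigr do rewrite !evE x1E.
  rewrite -mulr_sumr -/N2.
  have -> : \sum_k 2 * s * n 0 k * - (tau * n 0 k) = - (2 * s * tau * N2).
    by rewrite /N2 mulr_sumr -sumrN; apply: eq_bigr => k _; ring.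
  have tE : tau * (2 * (1 + N2 * (1 + 2 * s))) = eps ^+ 2 by rewrite divfK // gt_eqF // mulr_gt0.
  have tau1 : tau <= 1.
    rewrite ler_pdivrMr ?mulr_gt0 // mul1r; apply: (@le_trans _ _ 1); first by rewrite exprn_ile1 // ltW.
    have := mulr_ge0 (ltW N20) (addr_ge0 ler01 (mulr_ge0 (ler0n R 2) (ltW s0))); lra.
  rewrite -tE; have : tau ^+ 2 * N2 <= tau * N2.
    apply: ler_wpM2r; first exact: ltW.
    by rewrite expr2; apply: ler_piMl => //; exact: ltW.
  have : 0 < tau * N2 by rewrite mulr_gt0.
  have : 0 < tau * N2 * s by apply: mulr_gt0 => //; exact: mulr_gt0.
  clearbody tau N2 s; move: tau0; clear; move=> *; nra.
have b1 : blam a i x1 < blam a j x1.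
  rewrite -subr_lt0 -nE; under eq_bigr do rewrite x1E mulrN mulrCA -expr2.
  by rewrite sumrN -mulr_sumr oppr_lt0 mulr_gt0.
have in1 : inside a i x1.
  have [[h1 h2 h3] _] := tV x1 t1; split => // k ki.
  by have [->//|kj] := eqVneq k j; have [] := h3 k ki kj.
have : 0 < I3 f.
  apply: (@I3_pos _ f g x1) => //; last first.
  - have : nbhs x1 (inside a i) by apply: open_nbhs_nbhs; split => //; exact: open_inside.
    by apply: filterS => x /inside_reg h; rewrite fg.
  - by apply: gpos => //; exact: ltW.
  have bc k (p : pl) : continuous (fun x : 'rV[R]_3 => bump k (ev x p)).
    by apply: Cinfty_cont; exact: bumpf_Cinfty.
  have gc : continuous g.
    have -> : g = fun x => ev x (\sum_k (w i k - w j k) * pd k t) * bump 2 (ev x t) +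
            ev x (div (w i) - div (w j)) * bump 0 (ev x t).
      apply/funext => x; rewrite /g ev_sum; congr (_ + _); rewrite [RHS]mulr_suml.
      by apply: eq_bigr => k _; rewrite evM mulrA.
    have ec p : continuous (fun x : 'rV[R]_3 => ev x p) by exact: evf_cont.
    move=> x; have := cvgD (cvgM (ec (\sum_k (w i k - w j k) * pd k t) x) (bc 2%N t x))
      (cvgM (ec (div (w i) - div (w j)) x) (bc 0%N t x)); exact.
  exact: gc.
by rewrite f_0 ltxx.
Qed.
End Lens.

(** * Normal continuity from the weak divergence *)

Section Normal.
Context {R : realType}.
Local Notation pl := (pl R).
Variable a : 'I_4 -> 'rV[R]_3.
Hypothesis ha : nondegenerate_tetra a.
Local Notation d := (blam_grad a).
Local Notation o := (barycenter a).
Local Notation r := (bary_vec a).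
Local Notation T := (tetra a).
Local Notation Ncont := (ncont o d).
Local Notation Mu := (mu o d).
Local Notation pw := (pw a).

Lemma segment_open (U : set 'rV[R]_3) c y : open U -> U c ->
  exists2 e : R, 0 < e & forall t, 0 < t -> t < e -> U (c + t *: y).
Proof.
move=> oU Uc; have [e e0 He] := open_box oU Uc.
pose N := 1 + \sum_k `|y 0 k|.
have N0 : 0 < N by rewrite ltr_pwDl // sumr_ge0.
exists (e / N) => [|t t0 te]; first by rewrite divr_gt0.
apply: He => k; rewrite !mxE opprD addrA subrr sub0r normrN normrM gtr0_norm //.
apply: le_lt_trans (_ : t * N < e); last by rewrite -ltr_pdivlMr.
apply: ler_wpM2l; first exact: ltW.
by rewrite /N (bigD1 k) //= addrCA lerDl addr_ge0 // sumr_ge0.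
Qed.

(** Its barycentric coordinates are 3/20 at [i] and [j] and 7/20 at the other two vertices. *)
Definition face_center i j := o - 5^-1 *: (r i + r j).

Lemma blam_face_center i j l : blam a l (face_center i j) = 
  4^-1 - 5^-1 * ((l == i)%:R + (l == j)%:R - 2^-1).
Proof.
rewrite /face_center -scaleNr blam_shift blam_o dotpZr dotpDr !d_r // mulNr.
by congr (_ - _ * _); field.
Qed.

Lemma face_center_inside i j : i != j -> face_inside a i j (face_center i j).
Proof.
move=> ij; have ji : j == i = false by rewrite eq_sym (negbTE ij).
split; rewrite ?blam_face_center ?eqxx ?ji ?(negbTE ij) /=; [lra..|].
move=> k ki kj; rewrite !blam_face_center ?eqxx ?ji ?(negbTE ij) (negbTE ki) (negbTE kj) /=.
by split; lra.
Qed.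

Lemma face_center_on i j : on_face o d i j (face_center i j).
Proof.
apply: (@addIr _ 4^-1); rewrite -!blam_ev !blam_face_center !eqxx.
by rewrite [j == i]eq_sym [X in _ = _ - _ * (X - _)]addrC.
Qed.

(** [lens_absurd] for [w] and for its opposite kills the normal jump on the open face. The jump is
    polynomial, so it vanishes along every line of the plane through [face_center], hence on the
    plane. *)
Lemma ncont_of_weak (w : 'I_4 -> 'I_3 -> pl) :
  (forall phi, test_fun T phi ->
    \sum_k I3 (fun x => pw (w^~ k) x * pderiv k phi x) =
    - I3 (fun x => pw (fun l => div (w l)) x * phi x)) -> Ncont w.
Proof.
move=> H i j x xij.
have [->|ij] := eqVneq i j.
  by apply: big1 => k _; rewrite !mxE subrr mul0r.
pose Q := \sum_k (d i - d j) 0 k *: (w i k - w j k).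
have -> : \sum_k (d i - d j) 0 k * jump w i j x k = ev x Q.
  by rewrite /Q ev_sum; apply: eq_bigr => k _; rewrite evZ evB.
have Q0 y : on_face o d i j y -> face_inside a i j y -> ev y Q = 0.
  move=> yij Fy; have [h|h|//] := ltgtP (ev y Q) 0; exfalso; last first.
    apply: (lens_absurd ha (w := w) _ ij yij Fy h) => phi tp.
    by rewrite H // addNr.
  apply: (lens_absurd ha (w := fun l k => -1 *: w l k) _ ij yij Fy); last first.
    rewrite -oppr_gt0 -evN in h; rewrite (_ : \sum_k _ = - Q) // /Q -sumrN.
    by apply: eq_bigr => k _; rewrite !scaleN1r -opprD scalerN.
  move=> phi tp; have tk k := test_pderiv k tp.
  have E : (fun l => div (fun k => -1 *: w l k)) = fun l => -1 *: div (w l).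
    apply/funext => l; rewrite /div scaler_sumr; apply: eq_bigr => k _.
    by rewrite pdZ.
  rewrite E (I3_pwZ _ _ tp).
  rewrite (eq_bigr _ (fun k _ => I3_pwZ (-1) (w^~ k) (tk k))).
  by rewrite -mulr_sumr H // -mulrDr addNr mulr0.
have [e e0 He] := segment_open (x - face_center i j) (@open_face_inside _ a i j) (face_center_inside ij).
move: (face_center i j) (face_center_on i j) He => c cij He.
have -> : x = c + 1 *: (x - c) by rewrite scale1r addrC subrK.
apply: (line_zero e0) => t t0 te; apply: Q0; last exact: He.
move: xij cij; rewrite /on_face => xij' cij.
rewrite !ev_muD !dotpZr cij; congr (_ + _ * _).
by rewrite !dotpBr; move: cij xij'; rewrite !ev_mu !dotpBr; lra.
Qed.

(* The weak divergence determines the normal continuity. *)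
Lemma weak_div w (G : 'rV[R]_3 -> R) : integ G ->
    (forall phi, test_fun T phi ->
      \sum_k - I3 (fun x => pw (w^~ k) x * pderiv k phi x) = I3 (fun x => G x * phi x)) ->
  Ncont w.
Proof.
move=> iG HG; apply: ncont_of_weak => phi tp.
rewrite -(weak_div_identify ha iG HG tp) -HG // sumrN opprK //.
Qed.
End Normal.

(** * Square integrable functions on the tetrahedron and their action on test functions *)

Section Fields.
Context {R : realType}.
Local Notation pl := (pl R).
Local Notation mR := (measurableTypeR R).
Local Notation R3 := (mR * mR * mR)%type.
Variable a : 'I_4 -> 'rV[R]_3.
Hypothesis ha : nondegenerate_tetra a.
Local Notation d := (blam_grad a).
Local Notation o := (barycenter a).
Local Notation r := (bary_vec a).
Local Notation T := (tetra a).
Local Notation Cont := (cont o d).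
Local Notation Ncont := (ncont o d).
Local Notation Tcont := (tcont o d).
Local Notation pw := (pw a).

Lemma tetra_bounded : exists M, forall x, T x -> bbox M x.
Proof.
exists (1 + \sum_i \sum_j `|a i 0 j|) => x [t [t0 t1 ->]] j.
rewrite summxE; apply: le_lt_trans (ler_norm_sum _ _ _) _.
apply: (@le_lt_trans _ _ (\sum_i \sum_j `|a i 0 j|)); last by rewrite ltrDr.
apply: ler_sum => i _; rewrite mxE normrM (ger0_norm (t0 i)).
apply: (@le_trans _ _ `|a i 0 j|); last by rewrite (bigD1 j) //= lerDl sumr_ge0.
by rewrite ler_piMl // -t1 (bigD1 i) //= lerDl sumr_ge0.
Qed.

Lemma measurable_tetra : measurable (@vec3 R @^-1` T).
Proof.
rewrite -[X in measurable X]setCK preimage_setC; apply: measurableC.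
apply: measurable_open_vec3.
have -> : ~` T = \bigcup_l [set x | forall _ : 'I_1, 0 < ev x (- mu o d l - cst 4^-1)].
  apply/seteqP; split=> x /=.
    move=> /(contra_notP _); apply => H; apply/(tetraE ha) => l.
    rewrite leNgt; apply/negP => h; apply: H; exists l => // _.
    by move: h; rewrite blam_ev evB evN evC; lra.
  move=> [l _ /(_ ord0)]; rewrite evB evN evC => h /(tetraE ha)/(_ l).
  by rewrite blam_ev; lra.
by apply: bigcup_open => l _; exact: open_pos.
Qed.

Lemma int_onE f : int_on T f = I3 (f \_ T).
Proof.
by rewrite /int_on Rintegral_mkcond.
Qed.

Lemma int_on_test g phi : test_fun T phi ->
  int_on T (fun x => g x * phi x) = I3 (fun x => (g \_ T) x * phi x).
Proof.
move=> tp; rewrite int_onE; congr I3; apply/funext => x; rewrite /patch.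
by case: ifP => // _; rewrite mul0r.
Qed.

Lemma int_on_test_out (g : 'rV[R]_3 -> R) phi : test_fun T phi ->
  int_on T (fun x => g x * phi x) = I3 (fun x => g x * phi x).
Proof.
move=> tp; rewrite int_onE; congr I3; apply/funext => x; rewrite /patch.
case: ifPn => // xT; have [->|h] := eqVneq (phi x) 0; first by rewrite mulr0.
by move/negP: xT; rewrite inE; case; exact: (test_in tp).
Qed.

Lemma L2E g : L2 T g = (((g \_ T) \o @vec3 R : R3 -> R) \in Lfun leb3 2%:E).
Proof. by []. Qed.

Lemma L2_mf g : L2 T g -> mf3 (g \_ T).
Proof. by rewrite L2E => /sub_Lfun_mfun; rewrite inE. Qed.

(** [T] is bounded and [|f| <= f^2 + 1]. *)
Lemma L2_integ g : L2 T g -> integ (g \_ T).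
Proof.
move=> Lg; have mg := L2_mf Lg; have [M HM] := tetra_bounded.
move: Lg; rewrite L2E => /Lfun2_integrable_sqr Ig.
apply: (integ_le mg (integD (f := fun x => (g \_ T) x ^+ 2) Ig (integ_box M))) => x /=.
have [xT|xT] := pselect (T x); last first.
  have -> : (g \_ T) x = 0 by rewrite /patch memNset.
  by rewrite normr0 expr0n add0r; rewrite indicE.
have -> : \1_[set y | bbox M y] x = 1 :> R by rewrite indicE mem_set //; exact: HM.
move: (_ \_ _) => f; rewrite -[f x ^+ 2]real_normK ?num_real //.
by have := sqr_ge0 (`|f x| - 2^-1); nra.
Qed.

Lemma bounded_L2 g M C : mf3 (g \_ T) -> (forall x, T x -> bbox M x) -> 
  (forall x, T x -> `|g x| <= C) -> L2 T g.
Proof.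
move=> mg HM HC; rewrite L2E; have f0 x : ~ T x -> (g \_ T) x = 0 by move=> h; rewrite /patch memNset.
have fC x : `|(g \_ T) x| <= `|C|.
  have [xT|xT] := pselect (T x); last by rewrite f0 // normr0.
  by rewrite /patch mem_set //; apply: le_trans (HC _ xT) (ler_norm _).
move: mg f0 fC; move: (_ \_ _) => f mf f0 fC.
have nf : nice (fun x => f x ^+ 2).
  split; first by rewrite /mf3; exact: (@measurable_funX _ _ _ setT _ 2 mf).
    exists (`|C| ^+ 2) => x; rewrite normrX; apply: lerXn2r => //; rewrite nnegrE //.
  by exists M => x h; rewrite f0 ?expr0n // => /HM.
have /integrableP[_ fi] := nice_integ nf.
rewrite inE; apply/andP; split; first by rewrite inE.
rewrite inE /= /finite_norm unlock; apply: poweR_lty; apply: le_lt_trans fi.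
rewrite le_eqVlt; apply/orP; left; apply/eqP; apply: eq_integral => p _ /=.
by rewrite powR_mulrn // normrX.
Qed.

Lemma mf3_patch g : mf3 g -> mf3 (g \_ T).
Proof.
move=> mg; have := (measurable_restrictT (g \o @vec3 R) measurable_tetra).1.
rewrite /mf3; set f := _ \_ _.
have -> : (g \_ T) \o @vec3 R = f by [].
by apply; exact: measurable_funS mg.
Qed.

Lemma L2_pw p : L2 T (pw p).
Proof.
have [M HM] := tetra_bounded; have [C C0 HC] := pw_bound a p M.
apply: (bounded_L2 (M := M) (C := C)) => // [|x /HM]; last exact: HC.
by apply: mf3_patch; exact: mf3_pw.
Qed.

Lemma int_on_ae g h phi : L2 T g -> L2 T h -> test_fun T phi ->
  ae_on T (fun x => g x = h x) ->
  int_on T (fun x => g x * phi x) = int_on T (fun x => h x * phi x).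
Proof.
move=> Lg Lh tp gh; rewrite !int_on_test //.
have mp := mf3_cont (test_cont tp).
apply: I3_ae; [exact: mf3M (L2_mf Lg) mp|exact: mf3M (L2_mf Lh) mp|].
move: gh; rewrite /ae_on; apply: filterS => p H; congr (_ * _); rewrite /patch; case: ifP => //.
by rewrite inE => /H.
Qed.
End Fields.

(** * Distributions represented by piecewise polynomials *)

Section Represent.
Context {R : realType}.
Local Notation pl := (pl R).
Variable a : 'I_4 -> 'rV[R]_3.
Hypothesis ha : nondegenerate_tetra a.
Local Notation d := (blam_grad a).
Local Notation o := (barycenter a).
Local Notation r := (bary_vec a).
Local Notation T := (tetra a).
Local Notation Cont := (cont o d).
Local Notation Ncont := (ncont o d).
Local Notation Tcont := (tcont o d).
Local Notation pw := (pw a).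

Definition pwm m n (P : 'I_4 -> 'I_m -> 'I_n -> pl) : mxfield R m n :=
  fun x => \matrix_(i, j) pw (fun l => P l i j) x.

(** The bridge between distributions and algebra: differential operators on [D] are computed on the
    polynomials [P], which [D] determines by [rep_uniq]. *)
Definition rep m n (D : @matrix (@dist R) m n) (P : 'I_4 -> 'I_m -> 'I_n -> pl) :=
  forall phi, test_fun T phi -> forall i j,
    D i j phi = I3 (fun x => pw (fun l => P l i j) x * phi x).

Lemma L2_field_pwm m n (P : 'I_4 -> 'I_m -> 'I_n -> pl) : L2_field T (pwm P).
Proof.
move=> i j; rewrite (_ : (fun _ => _) = pw (fun l => P l i j)); first exact: L2_pw.
by apply/funext => x; rewrite mxE.
Qed.

Lemma rep_pwm m n (P : 'I_4 -> 'I_m -> 'I_n -> pl) : rep (distr T (pwm P)) P.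
Proof.
move=> phi tp i j; rewrite mxE int_on_test_out //.
by congr I3; apply/funext => x; rewrite mxE.
Qed.

Lemma rep_ae m n (u : mxfield R m n) P : L2_field T u ->
  (forall i j, ae_on T (fun x => u x i j = pw (fun l => P l i j) x)) -> rep (distr T u) P.
Proof.
move=> Lu H phi tp i j; rewrite -(rep_pwm P tp) !mxE; apply: int_on_ae => //.
  exact: L2_field_pwm.
by move: (H i j); rewrite /ae_on; apply: filterS => p h pT; rewrite h // mxE.
Qed.

Lemma rep_deq m n (D1 D2 : @matrix (@dist R) m n) P : rep D1 P -> deq T D1 D2 -> rep D2 P.
Proof. by move=> H E phi tp i j; rewrite -E // H. Qed.

Lemma deq_rep m n (D1 D2 : @matrix (@dist R) m n) P : rep D1 P -> rep D2 P -> deq T D1 D2.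
Proof. by move=> H1 H2 phi tp i j; rewrite H1 // H2. Qed.

Lemma rep_uniq m n (D : @matrix (@dist R) m n) P Q : rep D P -> rep D Q ->
  forall l i j, P l i j = Q l i j.
Proof.
move=> H1 H2 l i j; apply/eqP; rewrite -subr_eq0; apply/eqP.
apply: (pw_weak0 ha (P := fun l => P l i j - Q l i j)) => phi tp.
by rewrite I3_pwB // -H1 // -H2 // subrr.
Qed.

Lemma rep_ext m n (D : @matrix (@dist R) m n) P Q : rep D P ->
  (forall l i j, P l i j = Q l i j) -> rep D Q.
Proof.
move=> H E phi tp i j; rewrite H //; congr I3; apply/funext => x.
by rewrite /pw E.
Qed.

Lemma rep_dzero m n : rep (dzero m n) (fun _ _ _ => 0).
Proof.
move=> phi tp i j; rewrite mxE; apply: (etrans (esym (mul0r (I3 phi)))).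
rewrite -I3Z; last exact: nice_integ (test_nice tp).
by congr I3; apply/funext => x; rewrite /pw ev0.
Qed.

Lemma generic_reg l x : generic a x -> alfeld a l x -> reg a x = l.
Proof.
move=> gx /(alfeldE ha)[_ h]; apply: reg_uniq => j jl.
by rewrite lt_neqAle h andbT; apply/eqP; apply: gx; rewrite eq_sym.
Qed.

Lemma pw_poly_pwm m n s (P : 'I_4 -> 'I_m -> 'I_n -> pl) :
  (forall l i j, msz (P l i j) s.+1) -> pw_poly s a (pwm P).
Proof.
move=> H; split; first exact: L2_field_pwm.
move=> l i j; exists (P l i j); first exact: H.
have := ae_generic ha; rewrite /ae_on; apply: filterS => p gp /(generic_reg gp) rl.
by rewrite mxE /pw rl.
Qed.

Lemma pw_poly_rep m n s (u : mxfield R m n) : pw_poly s a u ->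
  exists P, (forall l i j, msz (P l i j) s.+1) /\ rep (distr T u) P.
Proof.
move=> [Lu H].
have {H} : forall t : 'I_4 * 'I_m * 'I_n, exists p : pl, msz p s.+1 /\
    ae_on (alfeld a t.1.1) (fun x => u x t.1.2 t.2 = ev x p).
  by move=> [[l i] j]; have [p h1 h2] := H l i j; exists p.
move=> /fin_all_exists[F HF]; exists (fun l i j => F (l, i, j)); split.
  by move=> l i j; have [] := HF (l, i, j).
apply: rep_ae => // i j.
have : {ae leb3, forall p, forall l, alfeld a l (vec3 p) -> u (vec3 p) i j = ev (vec3 p) (F (l, i, j))}.
  by apply: filter_forall => l; have [_] := HF (l, i, j).
rewrite /ae_on; apply: filterS => p h pT; apply: h; exact: reg_alfeld.
Qed.

Lemma rep_sym (u : mxfield R 3 3) P : L2_sym T u -> rep (distr T u) P ->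
  forall l i j, P l i j = P l j i.
Proof.
move=> [Lu su] H; apply: (rep_uniq H) => phi tp i j.
rewrite -H // !mxE; apply: int_on_ae => //.
move: su; rewrite /ae_on; apply: filterS => p h /h E.
by rewrite -[in RHS]E mxE.
Qed.

Lemma L2_sym_pwm (P : 'I_4 -> 'I_3 -> 'I_3 -> pl) :
  (forall l i j, P l i j = P l j i) -> L2_sym T (pwm P).
Proof.
move=> H; split; first exact: L2_field_pwm.
apply/aeW => p _; apply/matrixP => i j; rewrite !mxE /pw; by rewrite H.
Qed.

Lemma in_space_rep m n (A : set (mxfield R m n)) D P : A (pwm P) -> rep D P ->
  in_space T A D.
Proof. by move=> AP H; exists (pwm P) => //; apply: deq_rep H (rep_pwm P). Qed.

Lemma L2_space_integ m n (D : @matrix (@dist R) m n) : in_space T (L2_field T) D ->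
  forall i j, exists2 G, integ G & forall phi, test_fun T phi ->
    D i j phi = I3 (fun x => G x * phi x).
Proof.
move=> [g Lg H] i j; exists ((fun x => g x i j) \_ T); first exact: L2_integ.
by move=> phi tp; rewrite H // mxE int_on_test.
Qed.

End Represent.

(** * Scalar operators: divergence, partial derivatives and curl components *)

Section Operators.
Context {R : realType}.
Local Notation pl := (pl R).
Local Notation dist := (@dist R).
Variable a : 'I_4 -> 'rV[R]_3.
Hypothesis ha : nondegenerate_tetra a.
Local Notation d := (blam_grad a).
Local Notation o := (barycenter a).
Local Notation r := (bary_vec a).
Local Notation T := (tetra a).
Local Notation Cont := (cont o d).
Local Notation Ncont := (ncont o d).
Local Notation Tcont := (tcont o d).
Local Notation pw := (pw a).
Local Notation rep := (rep a).

Definition srep (D : dist) (p : 'I_4 -> pl) := forall phi, test_fun T phi ->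
  D phi = I3 (fun x => pw p x * phi x).

(** A distribution without singular part on the faces. Integrability of [G] is what [weak_div] asks
    for, and square integrability on [T] implies it. *)
Definition regular (D : dist) := exists2 G, integ G &
  forall phi, test_fun T phi -> D phi = I3 (fun x => G x * phi x).

Lemma srep0 : srep (fun=> 0) (fun=> 0).
Proof.
by move=> phi tp; have := rep_dzero tp (ord0 : 'I_1) (ord0 : 'I_1); rewrite mxE.
Qed.

Lemma srepN D p : srep D p -> srep (fun phi => - D phi) (fun l => - p l).
Proof.
move=> H phi tp; rewrite H // -[LHS]sub0r [X in X - _](srep0 tp : 0 = _) -I3_pwB //.
by congr I3; apply/funext => x; rewrite /pw add0r.
Qed.

Lemma srepD D1 p1 D2 p2 : srep D1 p1 -> srep D2 p2 ->
  srep (fun phi => D1 phi + D2 phi) (fun l => p1 l + p2 l).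
Proof. by move=> H1 H2 phi tp; rewrite H1 // H2 // -I3_pwD. Qed.

Lemma srepZ c D p : srep D p -> srep (fun phi => c * D phi) (fun l => c *: p l).
Proof. by move=> H phi tp; rewrite H // -I3_pwZ. Qed.

Lemma srep_sum (I : finType) (D : I -> dist) p : (forall i, srep (D i) (p i)) ->
  srep (fun phi => \sum_i D i phi) (fun l => \sum_i p i l).
Proof.
move=> H phi tp; rewrite I3_pw_sum //.
by apply: eq_bigr => i _; rewrite H.
Qed.

Lemma srep_eq D D' p : (forall phi, test_fun T phi -> D phi = D' phi) -> srep D p -> srep D' p.
Proof. by move=> E H phi tp; rewrite -E // H. Qed.

Section Divergence.
Variables (D : 'I_3 -> dist) (q : 'I_4 -> 'I_3 -> pl).
Hypothesis Dq : forall k, srep (D k) (q^~ k).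

Lemma srep_div : Ncont q -> srep (fun phi => \sum_k dpart k (D k) phi) (fun l => div (q l)).
Proof.
move=> nq phi tp; rewrite -[RHS]opprK -(pw_div_ibp ha nq tp) -sumrN.
by apply: eq_bigr => k _; rewrite /dpart Dq //; exact: test_pderiv.
Qed.

Lemma regular_div : regular (fun phi => \sum_k dpart k (D k) phi) -> Ncont q.
Proof.
move=> [G iG HG]; apply: (weak_div ha iG) => phi tp; rewrite -HG //.
by apply: eq_bigr => k _; rewrite /dpart Dq //; exact: test_pderiv.
Qed.
End Divergence.

Section Partial.
Variables (D : dist) (p : 'I_4 -> pl).
Hypothesis Dp : srep D p.
(** The partial derivative in direction [j] is the divergence of the field whose only entry is [D],
    in position [j]. *)
Let D' (j k : 'I_3) : dist := if k == j then D else fun=> 0.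
Let q (j : 'I_3) l (k : 'I_3) : pl := if k == j then p l else 0.

Lemma single_div (j : 'I_3) phi : \sum_k dpart k (D' j k) phi = dpart j D phi.
Proof.
rewrite (bigD1 j) //= /D' eqxx big1 ?addr0 // => k /negbTE ->.
by rewrite /dpart oppr0.
Qed.

Lemma single_rep j k : srep (D' j k) ((q j)^~ k).
Proof. by rewrite /D' /q; case: ifP => // _; exact: srep0. Qed.

Lemma srep_dpart j : Cont p -> srep (dpart j D) (fun l => pd j (p l)).
Proof.
move=> cp; apply: srep_eq (fun phi _ => single_div j phi) _.
have := srep_div (single_rep j); rewrite (_ : (fun l => div (q j l)) = fun l => pd j (p l)).
  apply; apply: cont_ncont => k i i' x xi; rewrite /q; case: ifP => // _; exact: cp.
apply/funext => l; rewrite /div (bigD1 j) //= /q eqxx big1 ?addr0 // => k /negbTE ->.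
by rewrite pd0.
Qed.

(** The three directions show that the jump of [p] times every component of [d i - d i'] is zero;
    pairing with [r i], where the normal takes the value 1, frees the jump. *)
Lemma regular_dpart : (forall j, regular (dpart j D)) -> Cont p.
Proof.
move=> H i i' x xi; have N j : (d i - d i') 0 j * (ev x (p i) - ev x (p i')) = 0.
  have : Ncont (q j).
    apply: regular_div (single_rep j) _; have [G iG HG] := H j.
    by exists G => // phi tp; rewrite single_div HG.
  move=> /(_ i i' x xi); rewrite (bigD1 j) //= big1 ?addr0 => [|k kj].
    by rewrite /jump /q eqxx.
  by rewrite /jump /q (negbTE kj) ev0 subrr mulr0.
have [->//|ii] := eqVneq i i'.
apply/eqP; rewrite -subr_eq0 -[X in X == _]mul1r.
have -> : 1 = dotp (d i - d i') (r i).
  by rewrite dotpBl !d_r // eqxx [i' == i]eq_sym (negbTE ii) /=; ring.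
by rewrite /dotp mulr_suml big1 // => k _; rewrite mulrAC N mul0r.
Qed.
End Partial.

Section Curl.
Variables (D : 'I_3 -> dist) (q : 'I_4 -> 'I_3 -> pl).
Hypothesis Dq : forall k, srep (D k) (q^~ k).
(** The component [j] of the curl as the divergence of a field with two entries. Normal continuity
    of these three fields is tangential continuity of [q]. *)
Let D' (j k : 'I_3) : dist := if k == j + 1 then D (j + 2) else
  if k == j + 2 then fun phi => - D (j + 1) phi else fun=> 0.
Let q' (j : 'I_3) l k : pl := if k == j + 1 then q l (j + 2) else
  if k == j + 2 then - q l (j + 1) else 0.

Lemma curl_sum (V : zmodType) (j : 'I_3) (u : V) v (F : 'I_3 -> V -> V) :
  (forall k, F k 0 = 0) ->
  \sum_k F k (if k == j + 1 then u else if k == j + 2 then v else 0) = F (j + 1) u + F (j + 2) v.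
Proof.
by move=> F0; elim/ord3P: j; rewrite sum3 !I3E ?eqxx ?I3N F0 ?addr0 ?add0r // addrC.
Qed.

Lemma pair_div (j : 'I_3) phi : \sum_k dpart k (D' j k) phi =
  dpart (j + 1) (D (j + 2)) phi - dpart (j + 2) (D (j + 1)) phi.
Proof.
rewrite /D' /dpart; elim/ord3P: j; rewrite sum3 !I3E ?eqxx ?I3N /=; ring.
Qed.

Lemma pair_rep j k : srep (D' j k) ((q' j)^~ k).
Proof. by rewrite /D' /q'; do 2 (case: ifP => // _); [exact: srepN|exact: srep0]. Qed.

Lemma pair_curl j l : div (q' j l) = curl (q l) j.
Proof.
by rewrite /div /q' (curl_sum _ _ _ (F := fun k p => pd k p)) ?pdN // => k; rewrite pd0.
Qed.

Lemma pair_ncont i i' x j :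
  \sum_k (d i - d i') 0 k * jump (q' j) i i' x k =
  (d i - d i') 0 (j + 1) * jump q i i' x (j + 2) - (d i - d i') 0 (j + 2) * jump q i i' x (j + 1).
Proof.
rewrite /jump /q'; elim/ord3P: j; rewrite sum3 !I3E ?eqxx ?I3N /= ?evN ?ev0; ring.
Qed.

Lemma srep_curl j : Tcont q -> srep (fun phi =>
    dpart (j + 1) (D (j + 2)) phi - dpart (j + 2) (D (j + 1)) phi) (fun l => curl (q l) j).
Proof.
move=> tq; apply: srep_eq (fun phi _ => pair_div j phi) _.
have := srep_div (pair_rep j); rewrite (_ : (fun l => div (q' j l)) = fun l => curl (q l) j).
  by apply=> i i' x xi; rewrite pair_ncont; apply/eqP; rewrite subr_eq0; apply/eqP; exact: tq.
by apply/funext => l; exact: pair_curl.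
Qed.

Lemma regular_curl : (forall j, regular (fun phi =>
    dpart (j + 1) (D (j + 2)) phi - dpart (j + 2) (D (j + 1)) phi)) -> Tcont q.
Proof.
move=> H i i' x xi; have N j : (d i - d i') 0 (j + 1) * jump q i i' x (j + 2) =
    (d i - d i') 0 (j + 2) * jump q i i' x (j + 1).
  apply/eqP; rewrite -subr_eq0 -pair_ncont; apply/eqP.
  have : Ncont (q' j).
    apply: regular_div (pair_rep j) _; have [G iG HG] := H j.
    by exists G => // phi tp; rewrite pair_div HG.
  exact.
have := N 0; have := N 1; have := N 2; rewrite !I3E => N2 N1 N0.
by elim/ord3P => b'; elim/ord3P: b' => //; rewrite ?N0 ?N1 ?N2.
Qed.
End Curl.
End Operators.

(** * Row-wise operators on represented matrix distributions *)

Section MatrixOperators.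
Context {R : realType}.
Local Notation pl := (pl R).
Local Notation dist := (@dist R).
Variable a : 'I_4 -> 'rV[R]_3.
Hypothesis ha : nondegenerate_tetra a.
Local Notation d := (blam_grad a).
Local Notation o := (barycenter a).
Local Notation r := (bary_vec a).
Local Notation T := (tetra a).
Local Notation Cont := (cont o d).
Local Notation Ncont := (ncont o d).
Local Notation Tcont := (tcont o d).
Local Notation pw := (pw a).
Local Notation rep := (rep a).
Local Notation srep := (srep a).
Local Notation regular := (regular a).

Definition curlm m (t : 'I_m -> 'I_3 -> pl) (i : 'I_m) (j : 'I_3) : pl := curl (t i) j.
Definition divm (t : 'I_3 -> 'I_3 -> pl) (_ : 'I_1) (j : 'I_3) : pl := div (t j).
Definition defm (v : 'I_1 -> 'I_3 -> pl) (i j : 'I_3) : pl :=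
  2^-1 *: (pd j (v 0 i) + pd i (v 0 j)).
Definition sinv (t : 'I_3 -> 'I_3 -> pl) (i j : 'I_3) : pl :=
  t j i - (2^-1 *: \sum_l t l l) *+ (i == j).
Definition incm t := curlm (sinv (curlm t)).

Lemma rep_srep m n (D : @matrix dist m n) P : rep D P <->
  forall i j, srep (D i j) (fun l => P l i j).
Proof. by split=> [H i j phi tp|H phi tp i j]; exact: H. Qed.

Lemma regular_L2 m n (D : @matrix dist m n) i j :
  in_space T (L2_field T) D -> regular (D i j).
Proof. by move=> H; exact: L2_space_integ. Qed.

Lemma rep_dcurl m (D : @matrix dist m 3) P : (forall i, Tcont (fun l => P l i)) ->
  rep D P -> rep (dcurl D) (fun l => curlm (P l)).
Proof.
move=> tP /rep_srep H; apply/rep_srep => i j; rewrite mxE.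
exact: (srep_curl ha (H i) j (tP i)).
Qed.

Lemma tcont_L2 m (D : @matrix dist m 3) P : rep D P ->
  in_space T (L2_field T) (dcurl D) -> forall i, Tcont (fun l => P l i).
Proof.
move=> /rep_srep H L i; apply: (regular_curl ha (H i)) => j.
by have := regular_L2 i j L; rewrite mxE.
Qed.

Lemma rep_ddiv (D : @matrix dist 3 3) P : (forall i, Ncont (fun l => P l i)) ->
  rep D P -> rep (ddiv D) (fun l => divm (P l)).
Proof.
move=> nP /rep_srep H; apply/rep_srep => i j; rewrite mxE.
exact: (srep_div ha (H j) (nP j)).
Qed.

Lemma ncont_L2 (D : @matrix dist 3 3) P : rep D P ->
  in_space T (L2_field T) (ddiv D) -> forall i, Ncont (fun l => P l i).
Proof.
move=> /rep_srep H L i; apply: (regular_div ha (H i)).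
by have := regular_L2 0 i L; rewrite mxE.
Qed.

Lemma cont_H1 m n (D : @matrix dist m n) P : rep D P -> in_H1 T D ->
  forall i j, Cont (fun l => P l i j).
Proof.
move=> /rep_srep H [_ L] i j; apply: (regular_dpart ha (H i j)) => k.
by have := regular_L2 i j (L k); rewrite mxE.
Qed.

Lemma in_H1_rep m n (D : @matrix dist m n) P : rep D P ->
  (forall i j, Cont (fun l => P l i j)) -> in_H1 T D.
Proof.
move=> H cP; split; first exact: in_space_rep (L2_field_pwm ha P) H.
move=> k; apply: (in_space_rep (P := fun l i j => pd k (P l i j))) (L2_field_pwm ha _) _.
move/rep_srep: H => H; apply/rep_srep => i j; rewrite mxE.
exact: (srep_dpart ha (H i j) k (cP i j)).
Qed.

Lemma rep_ddef (D : 'rV[dist]_3) P : (forall j, Cont (fun l => P l 0 j)) ->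
  rep D P -> rep (ddef D) (fun l => defm (P l)).
Proof.
move=> cP /rep_srep H; apply/rep_srep => i j.
have h i' j' := srep_dpart ha (H 0 i') j' (cP i').
by move=> phi tp; rewrite !mxE; exact: (srepZ 2^-1 (srepD (h i j) (h j i)) tp).
Qed.

Lemma rep_Sinv (D : @matrix dist 3 3) P : rep D P -> rep (Sinv D) (fun l => sinv (P l)).
Proof.
move=> /rep_srep H; apply/rep_srep => i j phi tp; rewrite !mxE.
have [ij|ij] := eqVneq i j; last first.
  rewrite mulr0n subr0 (H j i _ tp); congr I3; apply/funext => x.
  by rewrite /pw /sinv (negbTE ij) mulr0n subr0.
have hs := srep_sum (fun l => H l l); have := srepD (H j i) (srepN (srepZ 2^-1 hs)).
move=> /(_ _ tp) h; apply: etrans (etrans _ h) _; first by rewrite mulr1n.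
by congr I3; apply/funext => x; rewrite /pw /sinv ij eqxx mulr1n.
Qed.

Lemma regular0 : regular (fun=> 0).
Proof.
have := regular_L2 0 0 (in_space_rep (L2_field_pwm ha (fun (_ : 'I_4) (_ _ : 'I_1) => 0)) (@rep_dzero R a 1 1)).
by rewrite mxE.
Qed.

Lemma regular_eq0 (D : dist) : (forall phi, test_fun T phi -> D phi = 0) -> regular D.
Proof.
by have [G iG HG] := regular0 => H; exists G => // phi tp; rewrite H // -HG.
Qed.

(** The distributional curl of a gradient is zero, hence regular, so the converse direction
    [regular_curl] yields tangential continuity. *)
Lemma tcont_grad p : Cont p -> Tcont (fun l k => pd k (p l)).
Proof.
move=> cp; have [D Dp] : exists D, srep D p by exists (fun phi => I3 (fun x => pw p x * phi x)).
apply: (regular_curl ha (D := fun k => dpart k D)) => [k|j]; first exact: srep_dpart.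
apply: regular_eq0 => phi [sm _ _]; rewrite /dpart.
by rewrite (Cinfty_schwarz (j + 1) (j + 2) sm) subrr.
Qed.

(** Same device as for [tcont_grad], with the distributional divergence of a curl. *)
Lemma ncont_curl q : Tcont q -> Ncont (fun l => curl (q l)).
Proof.
move=> tq; have [D Dq] : exists D, forall k, srep (D k) (q^~ k).
  by exists (fun k phi => I3 (fun x => pw (q^~ k) x * phi x)).
apply: (regular_div ha (fun k => srep_curl ha Dq k tq)).
apply: regular_eq0 => phi [sm _ _]; rewrite /dpart sum3 !I3E.
rewrite (Cinfty_schwarz 0 1 sm) (Cinfty_schwarz 0 2 sm) (Cinfty_schwarz 1 2 sm).
move: (D 2 _) (D 1 (pderiv 0 _)) (D 0 _) => x y z; ring.
Qed.
End MatrixOperators.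

(** * Continuity at the vertices of the split *)

Section VertexContinuity.
Context {R : realType}.
Local Notation pl := (pl R).
Variable a : 'I_4 -> 'rV[R]_3.
Hypothesis ha : nondegenerate_tetra a.
Local Notation d := (blam_grad a).
Local Notation o := (barycenter a).
Local Notation r := (bary_vec a).
Local Notation T := (tetra a).
Local Notation Cont := (cont o d).
Local Notation Tcont := (tcont o d).
Local Notation pw := (pw a).

(** Near [z] only the cells whose coordinate is minimal at [z] occur, and their polynomials all have
    the same value there. *)
Lemma pw_cvg (z : 'rV[R]_3) p : (forall l, (forall j, blam a l z <= blam a j z) -> ev z (p l) = pw p z) ->
  pw p x @[x --> z] --> pw p z.
Proof.
have FF : Filter (nbhs z) by exact: nbhs_filter.
move=> H; apply/cvgrPdist_lt => e e0.
have : \forall x \near z, forall l, (forall j, blam a l z <= blam a j z) -> `|pw p z - ev x (p l)| < e.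
  apply: (@filter_forall _ _ _ (nbhs z) FF) => l.
  have [h|h] := pselect (forall j, blam a l z <= blam a j z); last by apply: filterE => x /h.
  have /cvgrPdist_lt/(_ e e0) := @evf_cont R (p l) z.
  by rewrite /evf (H _ h); apply: filterS => x hx _.
have : \forall x \near z, forall l j, blam a j z < blam a l z -> blam a j x < blam a l x.
  apply: (@filter_forall _ _ _ (nbhs z) FF) => l; apply: (@filter_forall _ _ _ (nbhs z) FF) => j.
  have [h|h] := ltP (blam a j z) (blam a l z); last by apply: filterE.
  have : {for z, continuous (blam a l - blam a j)}.
    by apply: cvgB; exact: blam_cont.
  move=> /cvgrPdist_lt /(_ (blam a l z - blam a j z)); rewrite subr_gt0 => /(_ h).
  apply: filterS => x; rewrite !fctE => hx _; have := ler_norm (blam a l z - blam a j z - (blam a l x - blam a j x)).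
  lra.
apply: filterS2 => x h1 h2; apply: h2 => j.
rewrite leNgt; apply/negP => /h1; apply/negP; rewrite -leNgt; exact: reg_min.
Qed.

Lemma cvg_mx m n (U : topologicalType) (F : set_system U) (f : U -> 'M[R]_(m.+1, n.+1)) (A : 'M[R]_(m.+1, n.+1)) : Filter F ->
  (forall i j, f x i j @[x --> F] --> A i j) -> f x @[x --> F] --> A.
Proof.
move=> FF H; apply/cvg_ballP => e e0.
have : \forall x \near F, forall i j, ball (A i j) e (f x i j).
  apply: filter_forall => i; apply: filter_forall => j.
  by have /cvg_ballP/(_ e e0) := H i j.
by apply: filterS => x h; split.
Qed.

Lemma fourth (i j m : 'I_4) : exists k, [/\ k != i, k != j & k != m].
Proof.
have [k /and3P[*]|H] := pickP [pred k : 'I_4 | [&& k != i, k != j & k != m]]; first by exists k.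
have := card_size [:: i; j; m]; rewrite leqNgt => /negP; case.
suff /eq_card -> : mem [:: i; j; m] =i predT by rewrite cardT size_enum_ord.
by move=> k; rewrite !inE; have := H k; rewrite /= -!negb_or => /negbFE.
Qed.

Variable P : 'I_4 -> 'I_3 -> 'I_3 -> pl.
Hypothesis sP : forall l i j, P l i j = P l j i.
Hypothesis tP : forall i, Tcont (fun l => P l i).

(* Across a face the jump of [P] is a multiple of [n n^T]. *)
Lemma sym_jump i j x : i != j -> on_face o d i j x -> exists q : 'rV[R]_3,
  (forall b c, ev x (P i b c) - ev x (P j b c) = (d i - d j) 0 c * q 0 b) /\
  (forall b c, (d i - d j) 0 c * q 0 b = (d i - d j) 0 b * q 0 c).
Proof.
move=> ij xij; exists (\row_b ev x (jcoef r (fun l => P l b) i j)).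
have H b c : ev x (P i b c) - ev x (P j b c) =
    (d i - d j) 0 c * (\row_b ev x (jcoef r (fun l => P l b) i j)) 0 b.
  by rewrite mxE -(jcoefE (d_r ha) (tP b) ij xij c).
by split=> // b c; rewrite -!H ![P _ b c]sP.
Qed.

Lemma dual_n i j k : i != j -> dotp (d i - d j) (r k) = (i == k)%:R - (j == k)%:R.
Proof. by move=> ij; rewrite dotpBl !d_r //; ring. Qed.

(** Around a point common to three cells the jumps add up to zero, each being a multiple of [n n^T]
    for its own normal. Pairing with [r i] and [r j] isolates the jump from [i] to [j]: [d j - d k]
    annihilates [r i], and [d k - d i] annihilates [r j]. *)
Lemma three_cells i j k x : i != j -> j != k -> k != i -> on_face o d i j x ->
  on_face o d j k x -> forall b c, ev x (P i b c) = ev x (P j b c).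
Proof.
move=> ij jk ki xij xjk.
have xki : on_face o d k i x by rewrite /on_face xij xjk.
have [q [H1 H1s]] := sym_jump ij xij.
have [q' [H2 H2s]] := sym_jump jk xjk.
have [q'' [H3 _]] := sym_jump ki xki.
have D (u v n p : 'rV[R]_3) : \sum_b \sum_c n 0 c * p 0 b * (u 0 b * v 0 c) = dotp p u * dotp n v.
  rewrite /dotp mulr_suml; apply: eq_bigr => b _; rewrite mulr_sumr; apply: eq_bigr => c _; ring.
have : \sum_b \sum_c ((d i - d j) 0 c * q 0 b * (r i 0 b * r j 0 c) +
   (d j - d k) 0 c * q' 0 b * (r i 0 b * r j 0 c) +
   (d k - d i) 0 c * q'' 0 b * (r i 0 b * r j 0 c)) = 0.
  apply: big1 => b _; apply: big1 => c _; rewrite -H1 -H2 -H3; ring.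
under eq_bigr do rewrite 2!big_split /=.
rewrite 2!big_split /= !D.
(* The symmetry of the jump exchanges the roles of [r i] and [r j]. *)
have -> : dotp q' (r i) * dotp (d j - d k) (r j) = 0.
  have n0 : dotp (d j - d k) (r i) = 0 by rewrite dual_n // (negbTE ki) eq_sym (negbTE ij) subrr.
  transitivity (dotp q' (r j) * dotp (d j - d k) (r i)); last by rewrite n0 mulr0.
  rewrite -!D exchange_big /=; apply: eq_bigr => c _; apply: eq_bigr => b _.
  by rewrite H2s; congr (_ * _); rewrite mulrC.
rewrite !dual_n // !eqxx (negbTE ij) [k == j]eq_sym (negbTE jk) subrr mulr0 !addr0 sub0r mulrN1.
move=> /eqP; rewrite oppr_eq0 => /eqP q0 b c.
apply/eqP; rewrite -subr_eq0 H1.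
have -> : q 0 b = 0.
  have n1 : dotp (d i - d j) (r i) = 1 by rewrite dual_n // eqxx eq_sym (negbTE ij) subr0.
  rewrite -[LHS]mul1r -n1 /dotp mulr_suml.
  transitivity ((d i - d j) 0 b * dotp q (r i)); last by rewrite q0 mulr0.
  rewrite /dotp mulr_sumr; apply: eq_bigr => e _.
  by rewrite mulrAC H1s mulrA.
by rewrite mulr0.
Qed.

(** Any two cells at a vertex of the split share it with a third one: a vertex of [T] lies in the
    three cells of the other indices, the barycenter in all four. *)
Lemma continuous_vertices : continuous_at_vertices a (pwm a P).
Proof.
exists (pwm a P); first by apply/aeW.
move=> z Hz; apply: cvg_within_filter; apply: cvg_mx => b c.
rewrite mxE (_ : (fun x => _) = pw (fun l => P l b c)); last by apply/funext => x; rewrite mxE.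
apply: pw_cvg => i Hi; rewrite /pw; move: (reg_min a z); move: (reg a z) => j Hj.
have [->//|ij] := eqVneq i j.
have on k : blam a k z = blam a j z -> on_face o d j k z.
  by rewrite !blam_ev => /addIr.
have eij : blam a i z = blam a j z by apply/le_anti; rewrite Hi Hj.
suff [k [ki kj kz]] : exists k, [/\ k != i, k != j & blam a k z = blam a j z].
  apply: (@three_cells i j k) => //; first by rewrite eq_sym.
    by rewrite /on_face; have := on i eij.
  exact: on.
case: Hz => [[m _ mz]|/= zo]; last first.
  by have [k [ki kj _]] := fourth i j i; exists k; split=> //; rewrite zo !blam_o.
have nm l : (forall j, blam a l z <= blam a j z) -> l != m.
  move=> h; apply/eqP => lm; have [k [km _ _]] := fourth m m m.
  by have := h k; rewrite lm -mz !blam_a // eqxx (negbTE km) ler10.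
have [k [ki kj km]] := fourth i j m; exists k; split=> //.
by rewrite -mz !blam_a // (negbTE km) (negbTE (nm j Hj)).
Qed.
End VertexContinuity.

(** * The BGG identities between def, curl, inc, div and the algebraic maps *)

Section CellAlgebra.
Context {R : realType}.
Local Notation pl := (pl R).
Implicit Types (t : 'I_3 -> 'I_3 -> pl) (w : 'I_3 -> pl) (v : 'I_1 -> 'I_3 -> pl).

Lemma div_curl w : div (curl w) = 0.
Proof.
rewrite /div /curl sum3 !I3E !pdB (pd_comm 0 1) (pd_comm 0 2) (pd_comm 1 2).
by ring.
Qed.

Lemma curl_grad (p : pl) j : curl (fun k => pd k p) j = 0.
Proof. by rewrite /curl pd_comm subrr. Qed.

(** The curl of a symmetric matrix field is trace-free, so [sinv] merely transposes it. *)
Lemma sinv_curl_sym t : (forall i j, t i j = t j i) ->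
  forall i j, sinv (curlm t) i j = curl (t j) i.
Proof.
move=> st i j; rewrite /sinv /curlm [\sum_l _](_ : _ = 0) ?scaler0 ?mul0rn ?subr0 //.
rewrite sum3 /curl !I3E (st 2 0) (st 2 1) (st 1 0); ring.
Qed.

Lemma incm_sym t : (forall i j, t i j = t j i) -> forall i j, incm t i j = incm t j i.
Proof.
move=> st i j; rewrite /incm /curlm /curl !(sinv_curl_sym st) /curl !pdB.
rewrite (pd_comm (j + 1) (i + 1)) (pd_comm (j + 1) (i + 2)) (pd_comm (j + 2) (i + 1)).
rewrite (pd_comm (j + 2) (i + 2)) (st (j + 2)) (st (j + 1) (i + 2)) (st (j + 2) (i + 1)) (st (j + 1)).
ring.
Qed.

Lemma defm_sym v i j : defm v i j = defm v j i.
Proof. by rewrite /defm addrC. Qed.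

Lemma sinv_curl_def v i j : sinv (curlm (defm v)) i j = 2^-1 *: pd j (curl (v 0) i).
Proof.
rewrite sinv_curl_sym; last exact: defm_sym.
rewrite /curl /defm !pdZ !pdD !pdN -scalerBr; congr (_ *: _).
rewrite (pd_comm (i + 1) (i + 2)) (pd_comm (i + 1) j) (pd_comm (i + 2) j); ring.
Qed.

Lemma incm_def v i j : incm (defm v) i j = 0.
Proof.
rewrite /incm /curlm /curl !sinv_curl_def !pdZ -scalerBr.
by rewrite (pd_comm (j + 1)) subrr scaler0.
Qed.

(** The matrix of [y -> w x y], that is, the skew matrix with axial vector [w]. *)
Definition skw w (i j : 'I_3) : pl :=
  if j == i + 1 then - w (i + 2) else if j == i + 2 then w (i + 1) else 0.

Lemma skw_anti w i j : skw w i j = - skw w j i.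
Proof.
by elim/ord3P: i; elim/ord3P: j; rewrite /skw !I3E ?eqxx ?I3N ?opprK ?oppr0.
Qed.

Lemma skw_of t : (forall i j, t i j = - t j i) -> 
  forall i j, t i j = skw (fun k => t (k + 2) (k + 1)) i j.
Proof.
move=> at_; have t0 i : t i i = 0.
  have /eqP := at_ i i; rewrite -addr_eq0 -mulr2n -scaler_nat scaler_eq0 pnatr_eq0 /=.
  by move/eqP.
by elim/ord3P; elim/ord3P; rewrite /skw !I3E ?eqxx ?I3N ?t0 // -at_.
Qed.

Lemma half_scale (p : pl) : 2^-1 *: (p *+ 2) = p.
Proof.
rewrite -scalerMnr scalerMnl (_ : 2^-1 *+ 2 = 1) ?scale1r //.
by rewrite -[_ *+ 2]mulr_natr mulVf ?pnatr_eq0.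
Qed.

Lemma sinv_curl_skw w i j : sinv (curlm (skw w)) i j = - pd j (w i).
Proof.
have E k l : curlm (skw w) k l = (div w) *+ (k == l) - pd k (w l).
  rewrite /curlm /curl /skw /div sum3.
  by elim/ord3P: k; elim/ord3P: l; rewrite !I3E ?eqxx ?I3N ?pdN ?pd0 ?mulr1n ?mulr0n; ring.
have tr : \sum_l curlm (skw w) l l = div w *+ 2.
  rewrite sum3 !E !eqxx !mulr1n /div !sum3; ring.
rewrite /sinv tr half_scale E eq_sym addrAC subrr sub0r //.
Qed.

(** The algebraic map S, whose inverse is [sinv]. *)
Definition Smx t (i j : 'I_3) : pl := t j i - (\sum_l t l l) *+ (i == j).

Lemma SmxK t i j : sinv (Smx t) i j = t i j.
Proof.
have tr : \sum_l Smx t l l = - ((\sum_l t l l) *+ 2).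
  by rewrite /Smx sum3 !eqxx !mulr1n !sum3; ring.
rewrite /sinv tr scalerN half_scale mulNrn opprK /Smx eq_sym subrK //.
Qed.

Lemma sinvK t i j : Smx (sinv t) i j = t i j.
Proof.
have tr : \sum_l sinv t l l = - (2^-1 *: \sum_l t l l).
  rewrite (eq_bigr (fun l => t l l - 2^-1 *: \sum_l t l l)) => [|l _]; last by rewrite /sinv eqxx mulr1n.
  rewrite sumrB sumr_const card_ord; set s := \sum_l t l l; set h := _ *: s.
  have -> : s = h *+ 2 by rewrite scalerMnr half_scale.
  ring.
by rewrite /Smx tr mulNrn opprK /sinv eq_sym subrK.
Qed.

(** The right-hand side measures the asymmetry of the row-wise curl of [t]: correcting an asymmetry
    by a curl amounts to solving a divergence equation. *)
Lemma div_Smx t i : div (Smx t i) = curl (t (i + 2)) (i + 1) - curl (t (i + 1)) (i + 2).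
Proof.
rewrite /div /Smx /curl !sum3.
elim/ord3P: i; rewrite !I3E ?eqxx ?I3N !mulr1n !mulr0n !(pdD, pdN, pd0); ring.
Qed.

Lemma sinvD t t' i j : sinv (fun i j => t i j + t' i j) i j = sinv t i j + sinv t' i j.
Proof.
rewrite /sinv big_split /= scalerDr mulrnDl; ring.
Qed.

Lemma curlD w w' j : curl (fun k => w k + w' k) j = curl w j + curl w' j.
Proof. rewrite /curl !pdD; ring. Qed.

Lemma sinv_curlD t t' i j : sinv (curlm (fun i j => t i j + t' i j)) i j =
  sinv (curlm t) i j + sinv (curlm t') i j.
Proof.
rewrite -sinvD /sinv /curlm curlD; congr (_ - (_ *: _) *+ _).
by apply: eq_bigr => l _; rewrite curlD.
Qed.

Lemma sinv_inj0 t : (forall i j, sinv t i j = 0) -> forall i j, t i j = 0.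
Proof.
move=> H i j; rewrite -sinvK /Smx H sub0r big1 ?mul0rn ?oppr0 // => l _; exact: H.
Qed.

(** The hypotheses say that the symmetric and the skew part of the gradient vanish. *)
Lemma def_curl0 v : (forall i j, defm v i j = 0) -> (forall j, curl (v 0) j = 0) ->
  forall i j, pd i (v 0 j) = 0.
Proof.
move=> H0 C; have H i j : pd j (v 0 i) = - pd i (v 0 j).
  apply/eqP; rewrite -addr_eq0; have /eqP := H0 i j.
  by rewrite /defm scaler_eq0 invr_eq0 pnatr_eq0.
have S i j : pd j (v 0 i) = pd i (v 0 j).
  have := C 0; have := C 1; have := C 2; rewrite /curl !I3E.
  move=> /eqP; rewrite subr_eq0 => /eqP E2 /eqP; rewrite subr_eq0 => /eqP E1 /eqP.
  rewrite subr_eq0 => /eqP E0.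
  by elim/ord3P: i; elim/ord3P: j.
move=> i j; have /eqP := H i j; rewrite S -addr_eq0 -mulr2n -scaler_nat scaler_eq0 pnatr_eq0 /=.
by move/eqP.
Qed.
End CellAlgebra.

(** * The spaces of the sequence in terms of families of polynomials *)

Section Spaces.
Context {R : realType}.
Local Notation pl := (pl R).
Local Notation dist := (@dist R).
Variable a : 'I_4 -> 'rV[R]_3.
Hypothesis ha : nondegenerate_tetra a.
Local Notation d := (blam_grad a).
Local Notation o := (barycenter a).
Local Notation r := (bary_vec a).
Local Notation T := (tetra a).
Local Notation Cont := (cont o d).
Local Notation Ncont := (ncont o d).
Local Notation Tcont := (tcont o d).
Local Notation rep := (rep a).

Lemma contD p q : Cont p -> Cont q -> Cont (fun l => p l + q l).
Proof. by move=> cp cq i j x xij; rewrite !evD (cp i j) // (cq i j). Qed.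

Lemma contZ c p : Cont p -> Cont (fun l => c *: p l).
Proof. by move=> cp i j x xij; rewrite !evZ (cp i j). Qed.

Lemma contN p : Cont p -> Cont (fun l => - p l).
Proof. by move=> cp i j x xij; rewrite !evN (cp i j). Qed.

Lemma cont_global (p : pl) : Cont (fun=> p).
Proof. by []. Qed.

Lemma cont_skw (w : 'I_4 -> 'I_3 -> pl) i j : (forall k, Cont (w^~ k)) ->
  Cont (fun l => skw (w l) i j).
Proof.
move=> cw; rewrite /skw; case: (j == i + 1); first exact: contN.
by case: (j == i + 2).
Qed.

Lemma cont_tcont q : (forall k, Cont (q^~ k)) -> Tcont q.
Proof.
by move=> cq i j x xij b c; rewrite /jump !(cq _ i j x xij) !subrr !mulr0.
Qed.

Lemma tcontD q q' : Tcont q -> Tcont q' -> Tcont (fun l k => q l k + q' l k).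
Proof.
move=> tq tq' i j x xij b c; have := tq i j x xij b c; have := tq' i j x xij b c.
rewrite /jump => h' h.
have E A A' B B' : (A + A') - (B + B') = (A - B) + (A' - B') :> R by ring.
by rewrite !evD !E [LHS]mulrDr [RHS]mulrDr h h'.
Qed.

Lemma tcontZ s q : Tcont q -> Tcont (fun l k => s *: q l k).
Proof.
move=> tq i j x xij b c; have := tq i j x xij b c.
by rewrite /jump !evZ -!mulrBr => h; rewrite !(mulrCA _ s) h.
Qed.

Lemma tcont_ext q q' : Tcont q -> (forall l k, q l k = q' l k) -> Tcont q'.
Proof. by move=> tq E i j x xij b c; rewrite /jump -!E; exact: tq. Qed.

Lemma ncontD q q' : Ncont q -> Ncont q' -> Ncont (fun l k => q l k + q' l k).
Proof.
move=> nq nq' i j x xij.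
transitivity (\sum_k (d i - d j) 0 k * jump q i j x k + \sum_k (d i - d j) 0 k * jump q' i j x k).
  by rewrite -big_split; apply: eq_bigr => k _; rewrite /jump !evD /=; ring.
by rewrite nq // nq' // addr0.
Qed.

Lemma in_V s (P : 'I_4 -> 'I_1 -> 'I_3 -> pl) : (forall l i j, msz (P l i j) s.+1) ->
  (forall j, Cont (fun l => P l 0 j)) -> (forall j, Cont (fun l => curl (P l 0) j)) ->
  V_1_curl s a (pwm a P).
Proof.
move=> mP cP ccP; split; first exact: pw_poly_pwm.
have cP' i j : Cont (fun l => P l i j) by rewrite ord1.
have H : rep (distr T (pwm a P)) P by exact: rep_pwm.
 split; first exact: L2_field_pwm.
  exact: in_H1_rep H cP'.
apply: (in_H1_rep ha (P := fun l => curlm (P l))) => [|i j]; last by rewrite ord1; exact: ccP.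
by apply: rep_dcurl => // i; apply: cont_tcont => k; exact: cP'.
Qed.

Lemma V_rep s v : V_1_curl s a v -> exists P, [/\ forall l i j, msz (P l i j) s.+1,
  rep (distr T v) P, forall j, Cont (fun l => P l 0 j) &
  forall j, Cont (fun l => curl (P l 0) j)].
Proof.
move=> [/(pw_poly_rep ha)[P [mP HP]] [_ H1 H2]]; exists P.
have cP := cont_H1 ha HP H1.
split=> // j; have tP i : Tcont (fun l => P l i) by apply: cont_tcont.
exact: (cont_H1 ha (rep_dcurl ha tP HP) H2 0 j).
Qed.

Lemma sub_in_space m n (A B : set (mxfield R m n)) D : A `<=` B ->
  in_space T A D -> in_space T B D.
Proof. by move=> AB [g /AB]; exists g. Qed.

Lemma rep_sinv_dcurl (D : 'M[dist]_3) P : (forall i, Tcont (fun l => P l i)) ->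
  rep D P -> rep (Sinv (dcurl D)) (fun l => sinv (curlm (P l))).
Proof. by move=> tP H; apply: rep_Sinv => //; exact: rep_dcurl. Qed.

Lemma rep_dinc (D : 'M[dist]_3) P : (forall i, Tcont (fun l => P l i)) ->
  (forall i, Tcont (fun l => sinv (curlm (P l)) i)) ->
  rep D P -> rep (dinc D) (fun l => incm (P l)).
Proof. by move=> tP tQ H; apply: rep_dcurl => //; exact: rep_sinv_dcurl. Qed.

Lemma in_Sinc s P : (forall l i j, msz (P l i j) s.+1) ->
  (forall l i j, P l i j = P l j i) -> (forall i, Tcont (fun l => P l i)) ->
  (forall i, Tcont (fun l => sinv (curlm (P l)) i)) -> Sigma_inc s a (pwm a P).
Proof.
move=> mP sP tP tQ; have H : rep (distr T (pwm a P)) P by exact: rep_pwm.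
 have L := L2_sym_pwm ha sP.
split; last exact: continuous_vertices.
  by split=> //; exact: pw_poly_pwm.
split=> //; first exact: in_space_rep (L2_field_pwm ha _) (rep_dcurl ha tP H).
apply: in_space_rep (rep_dinc tP tQ H); apply: L2_sym_pwm => // l i j.
exact: incm_sym.
Qed.

Lemma Sinc_rep s u : Sigma_inc s a u -> exists P, [/\ forall l i j, msz (P l i j) s.+1,
  rep (distr T u) P, forall l i j, P l i j = P l j i, forall i, Tcont (fun l => P l i) &
  forall i, Tcont (fun l => sinv (curlm (P l)) i)].
Proof.
move=> [[/(pw_poly_rep ha)[P [mP HP]] L] [_ H1 H2] _]; exists P.
have tP := tcont_L2 ha HP H1; split=> //; first exact: rep_sym L HP.
apply: tcont_L2 (rep_sinv_dcurl tP HP) _ => //.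
by apply: sub_in_space H2 => g [].
Qed.

Lemma in_Sdiv s P : (forall l i j, msz (P l i j) s.+1) ->
  (forall l i j, P l i j = P l j i) -> (forall i, Ncont (fun l => P l i)) ->
  Sigma_div s a (pwm a P).
Proof.
move=> mP sP nP; have L := L2_sym_pwm ha sP.
split; first by split=> //; exact: pw_poly_pwm.
split=> //; apply: in_space_rep (L2_field_pwm ha _) (rep_ddiv ha nP (rep_pwm P)) => //.
Qed.

Lemma Sdiv_rep s u : Sigma_div s a u -> exists P, [/\ forall l i j, msz (P l i j) s.+1,
  rep (distr T u) P, forall l i j, P l i j = P l j i & forall i, Ncont (fun l => P l i)].
Proof.
move=> [[/(pw_poly_rep ha)[P [mP HP]] L] [_ H]]; exists P.
split=> //; first exact: rep_sym L HP.
exact: ncont_L2 HP H.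
Qed.

Lemma msz_curl n (w : 'I_3 -> pl) j : (forall k, msz (w k) n.+1) -> msz (curl w j) n.
Proof. by move=> H; apply: mszB; exact: (msz_pd _ (n := n.+1)). Qed.

Lemma msz_div n (w : 'I_3 -> pl) : (forall k, msz (w k) n.+1) -> msz (div w) n.
Proof. by move=> H; apply: msz_sum => k _; exact: (msz_pd _ (n := n.+1)). Qed.

Lemma msz_def n (v : 'I_1 -> 'I_3 -> pl) i j : (forall k, msz (v 0 k) n.+1) -> msz (defm v i j) n.
Proof. by move=> H; apply: mszZ; apply: mszD; exact: (msz_pd _ (n := n.+1)). Qed.

Lemma msz_sinv n t i j : (forall i j, msz (t i j) n) -> msz (sinv t i j : pl) n.
Proof.
move=> H; apply: mszB => //; case: eqP => _; last by rewrite mulr0n msz0.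
by rewrite mulr1n; apply: mszZ; apply: msz_sum.
Qed.

Lemma msz_skw n (w : 'I_3 -> pl) i j : (forall k, msz (w k) n) -> msz (skw w i j) n.
Proof.
by move=> H; rewrite /skw; case: ifP => _; [exact: mszN|case: ifP => _ //; exact: msz0].
Qed.

Lemma msz_Smx n t i j : (forall i j, msz (t i j) n) -> msz (Smx t i j : pl) n.
Proof.
move=> H; apply: mszB => //; case: eqP => _; last by rewrite mulr0n msz0.
by rewrite mulr1n; apply: msz_sum.
Qed.

(** All the planes pass through [o], where the constants of any two cells can be compared. *)
Lemma const_cont p : (forall l i, pd i (p l) = 0) -> Cont p -> forall l, p l = p ord0.
Proof.
move=> H cp l; rewrite (pd_const (H l)) (pd_const (H ord0)).
set c := mpoly.mcoeff _ _; set c' := mpoly.mcoeff _ _.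
have E : ev o (cst c) = ev o (cst c').
  rewrite -(pd_const (H l)) -(pd_const (H ord0)); apply: cp.
  by rewrite /on_face !ev_mu subrr !dotp0.
by move: E; rewrite !evC => ->.
Qed.
End Spaces.

(** * The complex property and exactness at each space *)

Section Complex.
Context {R : realType}.
Local Notation pl := (pl R).
Local Notation dist := (@dist R).
Variable a : 'I_4 -> 'rV[R]_3.
Hypothesis ha : nondegenerate_tetra a.
Local Notation d := (blam_grad a).
Local Notation o := (barycenter a).
Local Notation r := (bary_vec a).
Local Notation T := (tetra a).
Local Notation Cont := (cont o d).
Local Notation Ncont := (ncont o d).
Local Notation Tcont := (tcont o d).
Local Notation rep := (rep a).

Definition rigid (b c : 'rV[R]_3) (_ : 'I_1) (j : 'I_3) : pl :=
  cst (b 0 j) + (c 0 (j + 1) *: X (j + 2) - c 0 (j + 2) *: X (j + 1)).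

Lemma rigid_shift b c i j : rigid b c i j = cst (b 0 j) + rigid 0 c i j.
Proof. by rewrite /rigid [(0 : 'rV[R]_3) 0 j]mxE cst0 add0r. Qed.

Lemma pd_rigid b c i j : pd i (rigid b c 0 j) =
  cst (c 0 (j + 1) * (i == j + 2)%:R - c 0 (j + 2) * (i == j + 1)%:R).
Proof.
rewrite /rigid pdD pdC add0r pdB !pdZ !pdX.
by rewrite !cstE scalerBl -!scalerA; congr (_ *: _ - _ *: _); case: (i == _); rewrite ?scale1r ?scale0r.
Qed.

Lemma def_rigid b c i j : defm (rigid b c) i j = 0.
Proof.
rewrite /defm !pd_rigid -mpoly.mpolyCD -[RHS](scaler0 _ 2^-1) -cst0; congr (_ *: cst _).
by elim/ord3P: i; elim/ord3P: j; rewrite !I3E ?eqxx ?I3N /=; ring.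
Qed.

Lemma curl_rigid b c j : curl (rigid b c 0) j = cst (2 * c 0 j).
Proof.
rewrite /curl !pd_rigid -mpoly.mpolyCB; congr cst.
by elim/ord3P: j; rewrite !I3E ?eqxx ?I3N /=; ring.
Qed.

Lemma rigid_pwm b c : (fun x => b + cross c x) = pwm a (fun=> rigid b c).
Proof.
by apply/funext => x; apply/rowP => j; rewrite !mxE /pw /rigid !evE.
Qed.

Lemma msz_rigid b c i j : msz (rigid b c i j) 2.
Proof.
apply: mszD; first by apply: mszW (mszC _ 0).
by apply: mszB; apply: mszZ; exact: mszX.
Qed.

Lemma maps_RM s : maps_to T id RM (V_1_curl s.+1 a).
Proof.
move=> u [b [c ->]]; exists (pwm a (fun=> rigid b c)); last by rewrite rigid_pwm.
apply: in_V => // l i j; apply: mszW (msz_rigid b c i j) => //.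
Qed.

(** [def v] is the gradient, tangentially continuous as [v] is continuous, minus its skew part,
    whose entries are halves of curl components up to sign and so continuous. *)
Lemma tcont_def P : (forall j, Cont (fun l => P l 0 j)) ->
  (forall j, Cont (fun l => curl (P l 0) j)) -> forall i, Tcont (fun l => defm (P l) i).
Proof.
move=> cP ccP i; have h j : Cont (fun l => 2^-1 *: (pd j (P l 0 i) - pd i (P l 0 j))).
  apply: contZ; have := ccP 0; have := ccP 1; have := ccP 2; rewrite /curl !I3E => c2 c1 c0.
  have sw p q : Cont (fun l => p l - q l) -> Cont (fun l => q l - p l : pl).
    by move=> /contN c k k' x xk; have := c k k' x xk; rewrite !opprB.
  elim/ord3P: i; elim/ord3P: j => //; try (by apply: sw);
    by move=> k k' x xk; rewrite !subrr.
have := tcontD (tcont_grad ha (cP i)) (cont_tcont (fun j => contN (h j))).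
move/tcont_ext; apply => l j; rewrite /defm.
rewrite -{1}(half_scale (pd j (P l 0 i))) -scalerBr; congr (_ *: _); ring.
Qed.

Lemma maps_def s : maps_to T (@ddef R) (V_1_curl s.+1 a) (Sigma_inc s a).
Proof.
move=> u /(V_rep ha)[P [mP HP cP ccP]]; apply: in_space_rep (rep_ddef ha cP HP).
apply: in_Sinc => // [l i j|l i j||i].
- by apply: msz_def => k.
- exact: defm_sym.
- exact: tcont_def.
apply: (tcont_ext (tcontZ 2^-1 (tcont_grad ha (ccP i)))) => l k.
by rewrite sinv_curl_def.
Qed.

Lemma maps_inc s : maps_to T (@dinc R) (Sigma_inc s.+2 a) (Sigma_div s a).
Proof.
move=> u /(Sinc_rep ha)[P [mP HP sP tP tQ]]; apply: in_space_rep (rep_dinc ha tP tQ HP).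
apply: in_Sdiv => // [l i j|l i j|i].
- by apply: msz_curl => k; apply: msz_sinv => *; apply: msz_curl => ?; exact: mP.
- exact: incm_sym.
exact: (ncont_curl ha (tQ i)).
Qed.

Lemma maps_div s : maps_to T (@ddiv R) (Sigma_div s.+1 a) (@pw_poly R 1 3 s a).
Proof.
move=> u /(Sdiv_rep ha)[P [mP HP sP nP]]; apply: in_space_rep (rep_ddiv ha nP HP).
by apply: pw_poly_pwm => // l i j; apply: msz_div.
Qed.

(** If [def v = 0], [sinv_curl_def] makes [curl v] constant on each cell, and by continuity
    globally. Removing the rotation with the same curl leaves a field with zero gradient
    ([def_curl0]), again globally constant. *)
Lemma exact_V s : exact_at T id RM (V_1_curl s.+1 a) (@ddef R).
Proof.
move=> w /(V_rep ha)[P [mP HP cP ccP]]; split=> [D0|[u [b [c ->]] E]]; last first.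
  have H := rep_pwm (a := a) (fun=> rigid b c); rewrite -rigid_pwm in H.
  apply: deq_rep (rep_ddef ha (P := fun=> rigid b c) _ _) _ => //; first exact: rep_deq E.
  by apply: rep_ext (@rep_dzero _ a _ _) _ => l i j; rewrite def_rigid.
have D l i j : defm (P l) i j = 0.
  exact: (rep_uniq ha (rep_ddef ha cP HP) (rep_deq (@rep_dzero _ a _ _) (fun phi tp i j => esym (D0 phi tp i j)))).
have K l i j : pd j (curl (P l 0) i) = 0.
  have := incm_def; have /eqP := sinv_curl_def (P l) i j.
  rewrite sinv_curl_sym; last exact: defm_sym.
  rewrite /curl !D !pd0 subrr eq_sym scaler_eq0 invr_eq0 pnatr_eq0 /= => /eqP //.
pose c : 'rV[R]_3 := \row_i (2^-1 * mpoly.mcoeff (@mpoly.mnm0 3) (curl (P ord0 0) i)).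
have cE l i : curl (P l 0) i = cst (2 * c 0 i).
  rewrite (const_cont (p := fun l => curl (P l 0) i) _ (ccP i) l) //.
  by rewrite (pd_const (K ord0 i)) mxE mulrA divff ?mul1r ?pnatr_eq0.
have G l i j : pd i (P l 0 j - rigid 0 c 0 j) = 0.
  apply: (def_curl0 (v := fun _ j => P l 0 j - rigid 0 c 0 j)) => [i' j'|j'].
    have := D l i' j'; have := def_rigid 0 c i' j'; rewrite /defm => h1 h2.
    by rewrite !pdB addrACA -opprD scalerBr h1 h2 subrr.
  transitivity (curl (P l 0) j' - curl (rigid 0 c 0) j'); last by rewrite cE curl_rigid subrr.
  by rewrite /curl !pdB; ring.
pose b : 'rV[R]_3 := \row_j mpoly.mcoeff (@mpoly.mnm0 3) (P ord0 0 j - rigid 0 c 0 j).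
exists (fun x => b + cross c x); first by exists b, c.
apply: deq_rep HP; rewrite rigid_pwm; apply: rep_ext (rep_pwm _) _ => l i j.
rewrite ord1.
have -> : P l 0 j = (P l 0 j - rigid 0 c 0 j) + rigid 0 c 0 j by rewrite subrK.
have cc : Cont (fun l => P l 0 j - rigid 0 c 0 j) by apply: contD => //; exact: contN.
rewrite (const_cont (p := fun l => P l 0 j - rigid 0 c 0 j) _ cc l) //.
by rewrite (pd_const (fun i => G ord0 i j)) (rigid_shift b) [b 0 j]mxE.
Qed.

(** The rows of [sinv (curlm P)] are curl-free and tangentially continuous, hence gradients of
    continuous [om i]. Adding [skw om] to [P] cancels [sinv (curlm P)], so the rows of the sum [N]
    are gradients of continuous [v i]; the symmetric part of [N] is [P], so [def v = P]. *)
Lemma exact_Sinc s : exact_at T (@ddef R) (V_1_curl s.+1 a) (Sigma_inc s a) (@dinc R).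
Proof.
move=> w /(Sinc_rep ha)[P [mP HP sP tP tQ]]; split=> [D0|[u /(V_rep ha)[P' [_ HP' cP' ccP']] E]]; last first.
  have PE l i j : defm (P' l) i j = P l i j.
    exact: (rep_uniq ha (rep_deq (rep_ddef ha cP' HP') E) HP).
  apply: deq_rep (rep_dinc ha tP tQ HP) _.
  apply: rep_ext (@rep_dzero _ a _ _) _ => l i j.
  rewrite (_ : P l = defm (P' l)) ?incm_def //.
  by apply/funext => i'; apply/funext => j'; rewrite PE.
have I0 l i j : incm (P l) i j = 0.
  exact: (rep_uniq ha (rep_dinc ha tP tQ HP) (rep_deq (@rep_dzero _ a _ _) (fun phi tp i j => esym (D0 phi tp i j)))).
have curl0 (t : 'I_3 -> pl) : (forall j, curl t j = 0) -> forall b c, pd b (t c) = pd c (t b).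
  move=> H; have := H 0; have := H 1; have := H 2; rewrite /curl !I3E.
  move=> /eqP; rewrite subr_eq0 => /eqP E2 /eqP; rewrite subr_eq0 => /eqP E1 /eqP.
  rewrite subr_eq0 => /eqP E0 b c.
  by elim/ord3P: b; elim/ord3P: c.
have mQ l i k : msz (sinv (curlm (P l)) i k) s.
  by apply: msz_sinv => *; apply: msz_curl => ?; exact: mP.
have [om Hom] := fin_all_exists (fun i => grad_lift (d_r ha) (tQ i) (mQ^~ i)
  (fun l => curl0 _ (I0 l i))).
pose N l i j := P l i j + skw (fun k => om k l) i j.
have com k : Cont (om k) by have [] := Hom k.
have tN i : Tcont (fun l => N l i).
  apply: tcontD => //; apply: cont_tcont => k; exact: (cont_skw (w := fun l k => om k l)).
have mN l i j : msz (N l i j) s.+1.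
  apply: mszD => //; apply: msz_skw => k; by have [] := Hom k.
have N0 l i j : curl (N l i) j = 0.
  apply: (sinv_inj0 (t := curlm (N l))) => {i j} i j.
  rewrite /N sinv_curlD sinv_curl_skw; have [_ _ ->] := Hom i.
  by rewrite subrr.
have [v Hv] := fin_all_exists (fun i => grad_lift (d_r ha) (tN i) (mN^~ i)
  (fun l => curl0 _ (N0 l i))).
pose V l (_ : 'I_1) j := v j l.
have cV j : Cont (fun l => V l 0 j) by have [] := Hv j.
have dV i j l : pd j (v i l) = N l i j by have [] := Hv i.
have VE : rep (distr T (pwm a V)) V by exact: rep_pwm.
exists (pwm a V).
  apply: in_V => // [l i j|j]; first by have [h _ _] := Hv j; exact: h.
  have := contD (com j) (com j); move=> h k k' x xk; have := h k k' x xk.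
  (* The symmetric [P] drops out of the curl of [v], and the skew part leaves twice [om]; thus
     [curl v] is continuous and [v] lies in the first space. *)
  have E l : curl (V l 0) j = om j l + om j l.
    rewrite /curl /V !dV /N (sP _ (j + 2)) opprD addrACA subrr add0r.
    by rewrite [skw _ (j + 2) _]skw_anti -opprD /skw; elim/ord3P: (j); rewrite !I3E ?eqxx ?I3N -opprD opprK.
  by rewrite !E.
apply: deq_rep (rep_ddef ha cV VE) _; apply: rep_ext HP _ => l i j.
rewrite /defm /V !dV /N [P l j i]sP [skw _ j i]skw_anti addrACA subrr addr0.
by rewrite -mulr2n half_scale.
Qed.

(** The rows of [P] are curls of a continuous [et]. Symmetry of [P] makes the rows of [Smx et]
    divergence-free by [div_Smx], hence curls of a continuous [ta], and [sinv (curlm ta) = et].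
    Replacing [ta] by its symmetric part changes [et] by gradients, which the outer curl does not
    see. *)
Lemma exact_Sdiv s : exact_at T (@dinc R) (Sigma_inc s.+2 a) (Sigma_div s a) (@ddiv R).
Proof.
move=> w /(Sdiv_rep ha)[P [mP HP sP nP]]; split=> [D0|[u /(Sinc_rep ha)[P' [_ HP' sP' tP' tQ']] E]]; last first.
  have PE l i j : incm (P' l) i j = P l i j.
    exact: (rep_uniq ha (rep_deq (rep_dinc ha tP' tQ' HP') E) HP).
  apply: deq_rep (rep_ddiv ha nP HP) _.
  apply: rep_ext (@rep_dzero _ a _ _) _ => l i j.
  rewrite /divm (_ : P l j = curl (sinv (curlm (P' l)) j)) ?div_curl //.
  by apply/funext => k; rewrite -PE.
have I0 l j : div (P l j) = 0.
  exact: (rep_uniq ha (rep_ddiv ha nP HP) (rep_deq (@rep_dzero _ a _ _) (fun phi tp i j => esym (D0 phi tp i j))) l 0 j).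
have [et Het] := fin_all_exists (fun i => curl_lift (d_r ha) (nP i) (mP^~ i) (I0^~ i)).
have cet i k : Cont (fun l => et i l k) by have [] := Het i.
pose H l i j := Smx (fun i j => et i l j) i j.
have cH i j : Cont (fun l => H l i j).
  rewrite /H /Smx; apply: contD => //; apply: contN; case: (i == j); rewrite ?mulr0n ?mulr1n //.
  have h := contD (contD (cet 0 0) (cet 1 1)) (cet 2 2).
  by move=> k k' x xk; have := h k k' x xk; rewrite !sum3.
have mH l i j : msz (H l i j) s.+2.
  by apply: msz_Smx => i' j'; have [] := Het i'.
have H0 l i : div (H l i) = 0.
  rewrite /H div_Smx; have [_ _ ->] := Het (i + 2); have [_ _ ->] := Het (i + 1).
  by rewrite (sP _ (i + 2)) subrr.
have [ta Hta] := fin_all_exists (fun i => curl_lift (d_r ha) (cont_ncont (cH i)) (mH^~ i) (H0^~ i)).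
have cta i k : Cont (fun l => ta i l k) by have [] := Hta i.
(* The skew correction that symmetrises [ta]; [om] is its axial vector. *)
pose K l i j := 2^-1 *: (ta j l i - ta i l j).
pose om l k := K l (k + 2) (k + 1).
have Ka l i j : K l i j = - K l j i by rewrite /K -scalerN opprB.
pose t l i j := ta i l j + K l i j.
have tS l i j : t l i j = 2^-1 *: (ta i l j + ta j l i).
  rewrite /t /K -{1}(half_scale (ta i l j)) -scalerDr; congr (_ *: _); ring.
have st l i j : t l i j = t l j i by rewrite !tS addrC.
have ct i j : Cont (fun l => t l i j).
  by apply: contD => //; apply: contZ; apply: contD => //; exact: contN.
have tE l i j : sinv (curlm (t l)) i j = et i l j - pd j (om l i).
  rewrite sinv_curlD; congr (_ + _).
    rewrite -[RHS](SmxK (fun i j => et i l j)); congr sinv; apply/funext => i'; apply/funext => j'.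
    by rewrite /curlm; have [_ _ ->] := Hta i'.
  rewrite -sinv_curl_skw; congr (sinv (curlm _) _ _).
  by apply/funext => i'; apply/funext => j'; rewrite (skw_of (Ka l)).
have com k : Cont (fun l => om l k).
  by apply: contZ; apply: contD => //; exact: contN.
have tt i : Tcont (fun l => t l i) by exact: cont_tcont.
have tQ i : Tcont (fun l => sinv (curlm (t l)) i).
  have h := tcontD (cont_tcont (cet i)) (tcontZ (-1) (tcont_grad ha (com i))).
  by apply: tcont_ext h _ => l k; rewrite tE scaleN1r.
have tR : rep (distr T (pwm a t)) t by exact: rep_pwm.
exists (pwm a t).
  apply: in_Sinc => // l i j; rewrite tS; apply: mszZ.
  by have [h _ _] := Hta i; have [h' _ _] := Hta j; apply: mszD.
apply: deq_rep (rep_dinc ha tt tQ tR) _; apply: rep_ext HP _ => l i j.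
rewrite /incm /curlm (_ : sinv _ i = fun k => et i l k + - pd k (om l i)); last first.
  by apply/funext => k; rewrite tE.
rewrite curlD; have [_ _ ->] := Het i.
by rewrite (_ : (fun k => - pd k _) = fun k => pd k (- om l i)) ?curl_grad ?addr0 //; apply/funext => k; rewrite pdN.
Qed.

(** A continuous, possibly unsymmetric solution [s0] comes from [div_lift] row by row. Adding curls
    keeps the divergence; by [div_Smx] the curl of [et] cancels the asymmetry [g] once [Smx et] has
    divergence [g], which a second [div_lift] provides. *)
Lemma exact_P s : exact_at T (@ddiv R) (Sigma_div s.+1 a) (@pw_poly R 1 3 s a) (fun=> dzero 1 3).
Proof.
move=> w /(pw_poly_rep ha)[f [mf Hf]]; split=> // _.
have [s0 Hs0] := fin_all_exists (fun j => div_lift o (d_r ha) (fun l => mf l 0 j)).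
have cs0 i k : Cont (fun l => s0 i l k) by have [] := Hs0 i.
pose g l i := s0 (i + 1) l (i + 2) - s0 (i + 2) l (i + 1).
have mg l i : msz (g l i) s.+2.
  by apply: mszB; [have [] := Hs0 (i + 1)|have [] := Hs0 (i + 2)].
have [H HH] := fin_all_exists (fun j => div_lift o (d_r ha) (mg^~ j)).
pose et l := sinv (fun i j => H i l j).
have cH i k : Cont (fun l => H i l k) by have [] := HH i.
have cet i j : Cont (fun l => et l i j).
  rewrite /et /sinv; apply: contD => //; apply: contN; case: (i == j); rewrite ?mulr0n ?mulr1n //.
  apply: contZ; have h := contD (contD (cH 0 0) (cH 1 1)) (cH 2 2).
  by move=> k k' x xk; have := h k k' x xk; rewrite !sum3.
pose S l i j := s0 i l j + curl (et l i) j.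
have nS i : Ncont (fun l => S l i).
  apply: ncontD; first exact: cont_ncont.
  exact: ncont_curl (cont_tcont (cet i)).
have sS l i j : S l i j = S l j i.
  have h k : S l (k + 1) (k + 2) = S l (k + 2) (k + 1).
    have := div_Smx (et l) k.
    have -> : Smx (et l) k = H k l by apply/funext => k'; rewrite sinvK.
    have [_ _ ->] := HH k; rewrite /g /S => /eqP; rewrite subr_eq addrAC eq_sym subr_eq addrC.
    by move=> /eqP ->; rewrite addrC.
  have := h 0; have := h 1; have := h 2; rewrite !I3E.
  by elim/ord3P: i; elim/ord3P: j.
have SR : rep (distr T (pwm a S)) S by exact: rep_pwm.
exists (pwm a S).
  apply: in_Sdiv => // l i j; apply: mszD; first by have [] := Hs0 i.
  by apply: msz_curl => k; apply: msz_sinv => i' j'; have [] := HH i'.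
apply: deq_rep (rep_ddiv ha nS SR) _; apply: rep_ext Hf _ => l i j.
rewrite ord1 /divm /S /div; under eq_bigr do rewrite pdD; rewrite big_split /=.
have := div_curl (et l j); rewrite /div => ->; rewrite addr0.
by have [_ _ /(_ l)] := Hs0 j; rewrite /div.
Qed.
End Complex.

Local Close Scope ring_scope.
Local Close Scope classical_set_scope.

Theorem lemma3p6 (R : realType) (a : 'I_4 -> 'rV[R]_3) (k : nat)
    (ha : nondegenerate_tetra a) (hk : (1 <= k)%N) :
  let T := tetra a in
  let V := V_1_curl (k + 3) a in
  let Sinc := Sigma_inc (k + 2) a in
  let Sdiv := Sigma_div k a in
  let P := @pw_poly R 1 3 (k - 1) a in
  [/\ maps_to T id RM V,
      maps_to T (@ddef R) V Sinc,
      maps_to T (@dinc R) Sinc Sdiv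
    & maps_to T (@ddiv R) Sdiv P] /\
  [/\ exact_at T id RM V (@ddef R),
      exact_at T (@ddef R) V Sinc (@dinc R),
      exact_at T (@dinc R) Sinc Sdiv (@ddiv R)
    & exact_at T (@ddiv R) Sdiv P (fun _ => dzero 1 3)].
Proof.
(* With [k] a successor, [k - 1] is its predecessor and all degrees take the form used in the lemmas
   on each space. *)
case: k hk => // k _; rewrite subn1 /= addn3 addn2.
split; split.
- exact: maps_RM.
- exact: maps_def.
- exact: maps_inc.
- exact: maps_div.
- exact: exact_V.
- exact: exact_Sinc.
- exact: exact_Sdiv.
- exact: exact_P.
Qed.
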